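(* There exists a constant $K>0$, independent of the cutoff $\Lambda$, of $n$ and of the graph, such that for every connected vacuum BFL graph $G$ of order $n$ (as defined in the context) its amplitude at cutoff $\Lambda$ satisfies $$|\mathcal{A}^{BFL}_G|\le K^n\,\Lambda^{6+3n}.$$
   Context: Let $\mathrm{SU}(2)$ carry its normalized Haar measure and let $D^j(g)$ denote the spin-$j$ matrix representation. Let $C_\phi$ be the orthogonal projector on $L^2(\mathrm{SU}(2)^3)$ given by $(C_\phi\phi)(g_1,g_2,g_3)=\frac13\sum_{c}\int dh\,\phi(g_{c(1)}h,g_{c(2)}h,g_{c(3)}h)$, the sum running over the three cyclic permutations $c$ of $\{1,2,3\}$. For a cutoff $\Lambda$, let $\mathcal{H}^{(\Lambda)}\subset L^2(\mathrm{SU}(2)^3)$ be the span of the functions $(g_1,g_2,g_3)\mapsto D^{j_1}(g_1)_{m_1n_1}D^{j_2}(g_2)_{m_2n_2}D^{j_3}(g_3)_{m_3n_3}$ with all spins $j_1,j_2,j_3\le\Lambda$, let $\mathcal{H}^{(\Lambda)}_0=\mathcal{H}^{(\Lambda)}\cap\mathrm{Im}\,C_\phi$, and let $C(x,y)$ ($x,y\in\mathrm{SU}(2)^3$) be the integral kernel of the orthogonal projector onto $\mathcal{H}^{(\Lambda)}_0$. A vertex carries six variables $g_1,\dots,g_6\in\mathrm{SU}(2)$ and four slots with triples $X_1,\dots,X_4$. For a tetrahedral vertex: $X_1=(g_1,g_2,g_3)$, $X_2=(g_3,g_4,g_5)$, $X_3=(g_5,g_2,g_6)$, $X_4=(g_6,g_4,g_1)$.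 For a pillow vertex: $X_1=(g_1,g_2,g_3)$, $X_2=(g_3,g_4,g_5)$, $X_3=(g_5,g_4,g_6)$, $X_4=(g_6,g_2,g_1)$. (These are the vertices of the Boulatov–Freidel–Louapre interaction $P[\phi]+\delta T[\phi]$, $|\delta|\le1$.) A vacuum BFL graph $G$ of order $n$ consists of $n$ vertices $v$, each of tetrahedral or pillow type (with variables $g^v=(g^v_1,\dots,g^v_6)$), together with a perfect matching of the $4n$ slots into lines (a line may join two slots of the same vertex); $G$ is connected if the underlying multigraph on the vertices is connected. Its amplitude is $$\mathcal{A}^{BFL}_G=\int\prod_{v}\prod_{i=1}^6dg^v_i\prod_{\text{lines }\{(v,a),(w,b)\}}C\big(X_a(g^v),X_b(g^w)\big).$$
   Formalization: The cutoff is assumed to satisfy Λ ≥ 1; without a lower bound the claim fails: at Λ = 0 every amplitude equals 1 while the right side is 0, and for every Λ < 1 the empty graph (n = 0, amplitude 1) violates the bound. *)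

(* Defs.v *)
From Stdlib Require Import Reals List Relations Factorial.
From Coquelicot Require Import Coquelicot.
Open Scope R_scope.

(* A pair (a,b) represents the matrix [[a, -conj b],[b, conj a]]. *)
Definition su2 : Type := (C * C)%type.
Definition is_su2 (g : su2) : Prop := Cmod (fst g) ^ 2 + Cmod (snd g) ^ 2 = 1.
Definition su2_one : su2 := (RtoC 1, RtoC 0).
Definition su2_mul (g h : su2) : su2 :=
  let (a, b) := g in let (c, d) := h in
  (Cplus (Cmult a c) (Copp (Cmult (Cconj b) d)), Cplus (Cmult b c) (Cmult (Cconj a) d)).

Definition hopf (eta xi1 xi2 : R) : su2 :=
  ((cos eta * cos xi1, cos eta * sin xi1), (sin eta * cos xi2, sin eta * sin xi2)).

(* Normalized Haar measure on SU(2) (= normalized round measure on S^3),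
   volume element sin(eta)cos(eta) d eta d xi1 d xi2, total mass 2 PI^2. *)
Definition haarR (f : su2 -> R) : R :=
  / (2 * PI ^ 2) *
  RInt (fun eta => RInt (fun xi1 => RInt (fun xi2 =>
          sin eta * cos eta * f (hopf eta xi1 xi2)) 0 (2 * PI)) 0 (2 * PI)) 0 (PI / 2).
Definition haar (f : su2 -> C) : C :=
  (haarR (fun g => fst (f g)), haarR (fun g => snd (f g))).
Fixpoint haarN (m : nat) (F : list su2 -> C) : C :=
  match m with
  | O => F nil
  | S m' => haar (fun g => haarN m' (fun l => F (g :: l)))
  end.

Definition csum (f : nat -> C) (n : nat) : C :=
  fold_right Cplus (RtoC 0) (map f (seq 0 n)).
Fixpoint cpow (z : C) (n : nat) : C :=
  match n with O => RtoC 1 | S n' => Cmult z (cpow z n') end.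
Definition binom (n k : nat) : R := INR (Factorial.fact n) / (INR (Factorial.fact k) * INR (Factorial.fact (n - k))).

(* ---------- spin-j representation, N = 2j ---------- *)
(* Action of g on homogeneous polynomials of degree N in (x,y):
   p(x,y) |-> p(x a + y b, - x conj(b) + y conj(a)); matrix in the
   monomial basis x^(N-k) y^k (k = 0..N). *)
Definition polyrep (N k l : nat) (g : su2) : C :=
  let (a, b) := g in
  csum (fun r =>
    if andb (Nat.leb r k) (Nat.leb (k - r) l) then
      Cmult (Cmult (Cmult (Cmult (RtoC (binom (N - l) r * binom l (k - r)))
        (cpow a (N - l - r))) (cpow b r))
        (cpow (Copp (Cconj b)) (l - (k - r)))) (cpow (Cconj a) (k - r))
    else RtoC 0) (S (N - l)).
(* Unitary spin-j matrix D^j(g)_{kl} (orthonormal basis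
   sqrt(binom N k) x^(N-k) y^k), indices k,l in 0..N (k = j - m). *)
Definition wigD (N k l : nat) (g : su2) : C :=
  Cmult (RtoC (sqrt (binom N l / binom N k))) (polyrep N k l g).

Definition triple : Type := (su2 * su2 * su2)%type.
Definition t1 (x : triple) : su2 := fst (fst x).
Definition t2 (x : triple) : su2 := snd (fst x).
Definition t3 (x : triple) : su2 := snd x.
Definition is_su2_3 (x : triple) : Prop := is_su2 (t1 x) /\ is_su2 (t2 x) /\ is_su2 (t3 x).

Definition haar3 (F : triple -> C) : C :=
  haarN 3 (fun l => F (nth 0 l su2_one, nth 1 l su2_one, nth 2 l su2_one)).

(* a term  c * D^{j1}(g1)_{k1 l1} D^{j2}(g2)_{k2 l2} D^{j3}(g3)_{k3 l3}, Ni = 2 ji *)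
Record dterm := { dc : C; dN1 : nat; dN2 : nat; dN3 : nat;
  dk1 : nat; dk2 : nat; dk3 : nat; dl1 : nat; dl2 : nat; dl3 : nat }.
Definition dterm_ok (Lam : R) (t : dterm) : Prop :=
  INR (dN1 t) <= 2 * Lam /\ INR (dN2 t) <= 2 * Lam /\ INR (dN3 t) <= 2 * Lam /\
  (dk1 t <= dN1 t)%nat /\ (dl1 t <= dN1 t)%nat /\
  (dk2 t <= dN2 t)%nat /\ (dl2 t <= dN2 t)%nat /\
  (dk3 t <= dN3 t)%nat /\ (dl3 t <= dN3 t)%nat.
Definition dterm_eval (t : dterm) (x : triple) : C :=
  Cmult (Cmult (Cmult (dc t) (wigD (dN1 t) (dk1 t) (dl1 t) (t1 x)))
    (wigD (dN2 t) (dk2 t) (dl2 t) (t2 x))) (wigD (dN3 t) (dk3 t) (dl3 t) (t3 x)).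

Definition InH (Lam : R) (f : triple -> C) : Prop :=
  exists T : list dterm, List.Forall (dterm_ok Lam) T /\
    forall x, is_su2_3 x ->
      f x = fold_right Cplus (RtoC 0) (map (fun t => dterm_eval t x) T).

Definition Cphi (f : triple -> C) (x : triple) : C :=
  Cmult (RtoC (/ 3))
   (Cplus (Cplus
     (haar (fun h => f (su2_mul (t1 x) h, su2_mul (t2 x) h, su2_mul (t3 x) h)))
     (haar (fun h => f (su2_mul (t2 x) h, su2_mul (t3 x) h, su2_mul (t1 x) h))))
     (haar (fun h => f (su2_mul (t3 x) h, su2_mul (t1 x) h, su2_mul (t2 x) h)))).

Definition InH0 (Lam : R) (f : triple -> C) : Prop :=
  InH Lam f /\ forall x, is_su2_3 x -> Cphi f x = f x.

(* Ck is the (continuous) integral kernel of the orthogonal projector onto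
   H_0^(Lam): Ck(., y) in H_0, Ck hermitian, reproducing on H_0.
   These properties determine Ck uniquely on SU(2)^3 x SU(2)^3. *)
Definition is_proj_kernel (Lam : R) (Ck : triple -> triple -> C) : Prop :=
  (forall y, is_su2_3 y -> InH0 Lam (fun x => Ck x y)) /\
  (forall x y, is_su2_3 x -> is_su2_3 y -> Ck y x = Cconj (Ck x y)) /\
  (forall f, InH0 Lam f -> forall x, is_su2_3 x ->
     haar3 (fun y => Cmult (Ck x y) (f y)) = f x).

(* n vertices 0..n-1; slot (v,a), a in 0..3 (slot a corresponds to X_{a+1});
   variables g^v_1..g^v_6 are indexed 0..5.  tetra v = true: tetrahedral
   vertex, false: pillow vertex.  mate: the perfect matching of slots. *)
Definition slot_vars (t : bool) (a : nat) : nat * nat * nat :=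
  if t then
    match a with 0 => (0,1,2)%nat | 1 => (2,3,4)%nat | 2 => (4,1,5)%nat | _ => (5,3,0)%nat end
  else
    match a with 0 => (0,1,2)%nat | 1 => (2,3,4)%nat | 2 => (4,3,5)%nat | _ => (5,1,0)%nat end.

Definition bfl_wf (n : nat) (mate : nat * nat -> nat * nat) : Prop :=
  forall v a, (v < n)%nat -> (a < 4)%nat ->
    (fst (mate (v, a)) < n)%nat /\ (snd (mate (v, a)) < 4)%nat /\
    mate (mate (v, a)) = (v, a) /\ mate (v, a) <> (v, a).

Definition bfl_adj (n : nat) (mate : nat * nat -> nat * nat) (v w : nat) : Prop :=
  (v < n)%nat /\ exists a, (a < 4)%nat /\ fst (mate (v, a)) = w.

Definition bfl_connected (n : nat) (mate : nat * nat -> nat * nat) : Prop :=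
  forall v w, (v < n)%nat -> (w < n)%nat -> clos_refl_trans nat (bfl_adj n mate) v w.

Definition slots (n : nat) : list (nat * nat) :=
  flat_map (fun v => map (fun a => (v, a)) (seq 0 4)) (seq 0 n).

Definition slot_ltb (s s' : nat * nat) : bool :=
  orb (Nat.ltb (fst s) (fst s'))
      (andb (Nat.eqb (fst s) (fst s')) (Nat.ltb (snd s) (snd s'))).

Definition Xslot (tetra : nat -> bool) (l : list su2) (s : nat * nat) : triple :=
  let '(i, j, k) := slot_vars (tetra (fst s)) (snd s) in
  (nth ((6 * fst s + i)%nat) l su2_one, nth ((6 * fst s + j)%nat) l su2_one,
   nth ((6 * fst s + k)%nat) l su2_one).

(* each line {s, mate s} is counted once, via the slot with s < mate s *)
Definition bfl_integrand (n : nat) (tetra : nat -> bool) (mate : nat * nat -> nat * nat)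
  (Ck : triple -> triple -> C) (l : list su2) : C :=
  fold_right Cmult (RtoC 1)
    (map (fun s => if slot_ltb s (mate s)
                   then Ck (Xslot tetra l s) (Xslot tetra l (mate s))
                   else RtoC 1) (slots n)).

Definition bfl_amplitude (n : nat) (tetra : nat -> bool) (mate : nat * nat -> nat * nat)
  (Ck : triple -> triple -> C) : C :=
  haarN (6 * n)%nat (bfl_integrand n tetra mate Ck).

(* Main.v *)
(** Let [p_i], [i < N], be an orthonormal basis of the polynomials of degree at most [2 Lam] in the
    coordinates of [SU(2) = S^3], so that [N <= 54 Lam ^ 3]. In this basis the kernel [C] becomes an
    orthogonal projector on a space of coefficient tensors, and integrating out a variable of a
    vertex identifies two tensor indices. The four slots of every vertex can be paired so that the
    lines and the pairs (corners) form a single closed circuit: otherwise changing the pairing at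
    some vertex merges two circuits. Hence the amplitude is the trace of a word in projectors and
    corner operators [B_x], each vertex contributing two corners with a common label [x] over which
    one sums. By right invariance one index of a corner can be gauge fixed to the identity, and
    Bessel's inequality gives [sum_x |B_x u|^2 <= N |u|^2], also for the adjoints. Cauchy-Schwarz
    bounds the trace by [N ^ n] times the dimension of the projector, which is at most [N ^ 2] by
    gauge fixing again; so the amplitude is at most [N ^ (n + 2)]. *)
Require Import Defs.
From Stdlib Require Import Reals List Relations Lra Lia Wf_nat FunctionalExtensionality.
From Coquelicot Require Import Coquelicot.
Open Scope R_scope.

(** * Haar integral of polynomials *)

(** The two corners of a vertex share a label but may lie far apart in the word, with corners of
    other vertices in between, so the labels cannot be summed letter by letter with operator norms.
    The bound on [sum_x |B_x u|^2] serves at the corner applied first, where the label stays open,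
    and the bound on the adjoints at the other one, where the label is summed. Each contributes
    [sqrt N] to the norm, hence [N] per vertex.

    The gain over counting indices comes from invariance: evaluating one leg of an orthonormal
    system of invariant tensors at a group element leaves an orthonormal system in the other two
    legs.

    All functions in play are polynomials on the sphere. Integration is therefore a linear form on
    monomials, its invariance follows from integration by parts, and integrability and Fubini reduce
    to finite sums.

    From [N <= 54 Lam ^ 3] one gets [54 ^ (n + 2) * Lam ^ (6 + 3 * n)], and [n + 2 <= 3 * n] for
    [n >= 1] leads to the constant [54 ^ 3]. *)

Fixpoint lsum {T : Type} (f : T -> R) (l : list T) : R :=
  match l with nil => 0 | cons t l' => f t + lsum f l' end.

Lemma lsum_ext {T : Type} (f g : T -> R) (l : list T) :
  (forall t, f t = g t) -> lsum f l = lsum g l.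
Proof. intros e; induction l as [|t l IH]; simpl; [reflexivity|]. now rewrite e, IH. Qed.

Lemma lsum_app {T : Type} (f : T -> R) (l m : list T) :
  lsum f (l ++ m) = lsum f l + lsum f m.
Proof. induction l as [|t l IH]; simpl; [ring|]. rewrite IH; ring. Qed.

Lemma lsum_map {S T : Type} (h : S -> T) (f : T -> R) (l : list S) :
  lsum f (map h l) = lsum (fun s => f (h s)) l.
Proof. induction l as [|t l IH]; simpl; [reflexivity|]. now rewrite IH. Qed.

Lemma lsum_scal {T : Type} (c : R) (f : T -> R) (l : list T) :
  lsum (fun t => c * f t) l = c * lsum f l.
Proof. induction l as [|t l IH]; simpl; [ring|]. rewrite IH; ring. Qed.

Lemma lsum_continuous {T : Type} (f : T -> R -> R) (l : list T) (x : R) :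
  (forall t y, continuous (f t) y) -> continuous (fun y => lsum (fun t => f t y) l) x.
Proof.
  intros cf; induction l as [|t l IH]; simpl; [apply continuous_const|].
  exact (continuous_plus (f t) (fun y => lsum (fun t0 => f t0 y) l) x (cf t x) IH).
Qed.

Lemma ex_RInt_cont (f : R -> R) (a b : R) : (forall x, continuous f x) -> ex_RInt f a b.
Proof. intros cf; apply (ex_RInt_continuous f a b); intros; apply cf. Qed.

Lemma RInt_lsum {T : Type} (f : T -> R -> R) (l : list T) (a b : R) :
  (forall t x, continuous (f t) x) ->
  RInt (fun x => lsum (fun t => f t x) l) a b = lsum (fun t => RInt (f t) a b) l.
Proof.
  intros cf; induction l as [|t l IH]; simpl.
  - rewrite RInt_const; unfold scal; simpl; unfold mult; simpl; ring.
  - rewrite <- IH.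
    apply (RInt_plus (f t) (fun x => lsum (fun t0 => f t0 x) l)).
    + now apply ex_RInt_cont.
    + apply ex_RInt_cont; intros; now apply lsum_continuous.
Qed.

Lemma RInt_mult_l (c : R) (f : R -> R) (a b : R) : (forall x, continuous f x) ->
  RInt (fun x => c * f x) a b = c * RInt f a b.
Proof. intros cf; apply (RInt_scal f a b c); now apply ex_RInt_cont. Qed.

(** A positive value persists on a neighbourhood and would contribute a positive amount to the
    integral. This yields the definiteness of the Haar scalar product on polynomials. *)
Lemma RInt_zero_nonneg (f : R -> R) (a b : R) :
  (forall x, continuous f x) -> (forall x, a <= x <= b -> 0 <= f x) ->
  RInt f a b = 0 -> forall x, a < x < b -> f x = 0.
Proof.
  intros cf f0 I0 x [ax xb].
  destruct (Rle_lt_or_eq_dec 0 (f x)) as [fx|]; [apply f0; lra| |now symmetry].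
  exfalso.
  assert (cx : locally x (fun y => 0 < f y)).
  { apply (cf x (fun z => 0 < z)). exists (mkposreal _ fx). intros y By.
    unfold ball in By; simpl in By; unfold AbsRing_ball, abs, minus, plus, opp in By; simpl in By.
    apply Rabs_def2 in By; lra. }
  destruct cx as [[d d0] Hd]; simpl in Hd.
  set (u := Rmax a (x - d / 2)); set (v := Rmin b (x + d / 2)).
  assert (au : a <= u) by apply Rmax_l.
  assert (vb : v <= b) by apply Rmin_l.
  assert (ux : u < x) by (apply Rmax_lub_lt; lra).
  assert (xv : x < v) by (apply Rmin_glb_lt; lra).
  assert (ud : x - d / 2 <= u) by apply Rmax_r.
  assert (vd : v <= x + d / 2) by apply Rmin_r.
  assert (P : 0 < RInt f u v).
  { apply RInt_gt_0; [lra| |intros; apply cf].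
    intros y Hy; apply Hd. unfold ball; simpl; unfold AbsRing_ball, abs, minus, plus, opp; simpl.
    apply Rabs_def1; lra. }
  assert (e : forall p q, ex_RInt f p q) by (intros; now apply ex_RInt_cont).
  assert (C1 := RInt_Chasles f a u b (e _ _) (e _ _)).
  assert (C2 := RInt_Chasles f u v b (e _ _) (e _ _)).
  unfold plus in C1, C2; simpl in C1, C2.
  assert (0 <= RInt f a u) by (apply RInt_ge_0; [lra|apply e|intros; apply f0; lra]).
  assert (0 <= RInt f v b) by (apply RInt_ge_0; [lra|apply e|intros; apply f0; lra]).
  lra.
Qed.

(** Exponents of the four real coordinates of the sphere. A polynomial is a list of coefficients and
    monomials, possibly with repetitions. *)
Definition mono : Type := (nat * nat * nat * nat)%type.
Definition mval (m : mono) (x : R * R * R * R) : R :=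
  let '(i, j, k, l) := m in let '(x0, x1, x2, x3) := x in
  x0 ^ i * x1 ^ j * (x2 ^ k * x3 ^ l).
Definition pval (p : list (R * mono)) (x : R * R * R * R) : R :=
  lsum (fun t => fst t * mval (snd t) x) p.
Definition coords (g : su2) : R * R * R * R :=
  (fst (fst g), snd (fst g), fst (snd g), snd (snd g)).

Definition circ (m n : nat) : R := RInt (fun t => cos t ^ m * sin t ^ n) 0 (2 * PI).
Definition quarter (m n : nat) : R := RInt (fun t => cos t ^ m * sin t ^ n) 0 (PI / 2).
(** In Hopf coordinates a monomial separates into three trigonometric integrals; the two added units
    of exponent come from the density [sin eta * cos eta]. *)
Definition mhaar (m : mono) : R :=
  let '(i, j, k, l) := m in
  / (2 * PI ^ 2) * (quarter (i + j + 1) (k + l + 1) * circ i j * circ k l).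
Definition phaar (p : list (R * mono)) : R := lsum (fun t => fst t * mhaar (snd t)) p.

Lemma pow_trig_continuous (m n : nat) (x : R) : continuous (fun t => cos t ^ m * sin t ^ n) x.
Proof.
  apply (ex_derive_continuous (fun t => cos t ^ m * sin t ^ n)).
  auto_derive; trivial.
Qed.

Definition trig (m : nat * nat) (t : R) : R := cos t ^ fst m * sin t ^ snd m.
Definition mtrig (m : mono) : (nat * nat) * (nat * nat) * (nat * nat) :=
  let '(i, j, k, l) := m in ((i + j + 1, k + l + 1), (i, j), (k, l))%nat.

Lemma hopf_mval (m : mono) (eta xi1 xi2 : R) :
  sin eta * cos eta * mval m (coords (hopf eta xi1 xi2)) =
  trig (fst (fst (mtrig m))) eta * trig (snd (fst (mtrig m))) xi1 * trig (snd (mtrig m)) xi2.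
Proof.
  destruct m as [[[i j] k] l]; unfold trig, coords, hopf; simpl.
  rewrite !pow_add, !Rpow_mult_distr; simpl; ring.
Qed.

Lemma hopf_pval (p : list (R * mono)) (eta xi1 xi2 : R) :
  sin eta * cos eta * pval p (coords (hopf eta xi1 xi2)) =
  lsum (fun t => fst t * trig (fst (fst (mtrig (snd t)))) eta
     * trig (snd (fst (mtrig (snd t)))) xi1 * trig (snd (mtrig (snd t))) xi2) p.
Proof.
  unfold pval; rewrite <- lsum_scal; apply lsum_ext; intros t.
  rewrite !Rmult_assoc, <- (Rmult_assoc (trig _ eta)), <- hopf_mval; ring.
Qed.

Lemma trig_continuous (m : nat * nat) (x : R) : continuous (trig m) x.
Proof. apply pow_trig_continuous. Qed.

Lemma cmult_continuous (c : R) (f : R -> R) (x : R) :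
  continuous f x -> continuous (fun y => c * f y) x.
Proof. intros cf; exact (continuous_mult (fun _ => c) f x (continuous_const c x) cf). Qed.

Lemma multc_continuous (c : R) (f : R -> R) (x : R) :
  continuous f x -> continuous (fun y => f y * c) x.
Proof. intros cf; exact (continuous_mult f (fun _ => c) x cf (continuous_const c x)). Qed.

Ltac by_derive :=
  match goal with |- continuous ?f ?x => apply (ex_derive_continuous f x); auto_derive; trivial end.

Section Nested.
Variable p : list (R * mono).
Let a (t : R * mono) := trig (fst (fst (mtrig (snd t)))).
Let b (t : R * mono) := trig (snd (fst (mtrig (snd t)))).
Let c (t : R * mono) := trig (snd (mtrig (snd t))).

Lemma inner_integral (eta xi1 : R) :
  RInt (fun xi2 => sin eta * cos eta * pval p (coords (hopf eta xi1 xi2))) 0 (2 * PI) =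
  lsum (fun t => fst t * a t eta * b t xi1 * RInt (c t) 0 (2 * PI)) p.
Proof.
  rewrite (RInt_ext _ (fun xi2 => lsum (fun t => fst t * a t eta * b t xi1 * c t xi2) p))
    by (intros; apply hopf_pval).
  rewrite RInt_lsum by (intros; apply cmult_continuous, trig_continuous).
  apply lsum_ext; intros; apply RInt_mult_l; intros; apply trig_continuous.
Qed.

Lemma middle_integral (eta : R) :
  RInt (fun xi1 => RInt (fun xi2 =>
    sin eta * cos eta * pval p (coords (hopf eta xi1 xi2))) 0 (2 * PI)) 0 (2 * PI) =
  lsum (fun t => fst t * a t eta * RInt (b t) 0 (2 * PI) * RInt (c t) 0 (2 * PI)) p.
Proof.
  rewrite (RInt_ext _ (fun xi1 => lsum (fun t =>
     (fst t * a t eta * RInt (c t) 0 (2 * PI)) * b t xi1) p))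
    by (intros; rewrite inner_integral; apply lsum_ext; intros; ring).
  rewrite RInt_lsum by (intros; apply cmult_continuous, trig_continuous).
  apply lsum_ext; intros; rewrite RInt_mult_l; [ring|]; intros; apply trig_continuous.
Qed.

Lemma haarR_pval : haarR (fun g => pval p (coords g)) = phaar p.
Proof.
  unfold haarR.
  rewrite (RInt_ext _ (fun eta => lsum (fun t =>
     (fst t * RInt (b t) 0 (2 * PI) * RInt (c t) 0 (2 * PI)) * a t eta) p))
    by (intros; rewrite middle_integral; apply lsum_ext; intros; ring).
  rewrite RInt_lsum by (intros; apply cmult_continuous, trig_continuous).
  unfold phaar; rewrite <- lsum_scal; apply lsum_ext; intros t.
  rewrite RInt_mult_l by (intros; apply trig_continuous).
  unfold a, b, c, trig; destruct t as [t [[[i j] k] l]]; unfold mhaar, quarter, circ; simpl; ring.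
Qed.

Hypothesis p0 : forall g, is_su2 g -> 0 <= pval p (coords g).

Lemma hopf_su2 (eta xi1 xi2 : R) : is_su2 (hopf eta xi1 xi2).
Proof.
  unfold is_su2, hopf; simpl fst; simpl snd. unfold Cmod; rewrite !pow2_sqrt; simpl fst; simpl snd.
  - pose proof (sin2_cos2 eta) as A; pose proof (sin2_cos2 xi1) as B; pose proof (sin2_cos2 xi2) as C.
    unfold Rsqr in *.
    transitivity (sin eta * sin eta * (sin xi2 * sin xi2 + cos xi2 * cos xi2)
      + cos eta * cos eta * (sin xi1 * sin xi1 + cos xi1 * cos xi1)); [ring|].
    rewrite B, C; lra.
  - apply Rplus_le_le_0_compat; apply pow2_ge_0.
  - apply Rplus_le_le_0_compat; apply pow2_ge_0.
Qed.

Let PI2pos : 0 <= 2 * PI. Proof. pose proof PI_RGT_0; lra. Qed.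

Lemma integrand_nonneg (eta xi1 xi2 : R) : 0 <= eta <= PI / 2 ->
  0 <= sin eta * cos eta * pval p (coords (hopf eta xi1 xi2)).
Proof.
  intros He; pose proof PI_RGT_0.
  apply Rmult_le_pos; [apply Rmult_le_pos|apply p0, hopf_su2].
  - apply sin_ge_0; lra.
  - apply cos_ge_0; lra.
Qed.

Lemma integrand_continuous (eta xi1 x : R) : continuous (fun xi2 =>
  sin eta * cos eta * pval p (coords (hopf eta xi1 xi2))) x.
Proof.
  apply (continuous_ext (fun xi2 => lsum (fun t => fst t * a t eta * b t xi1 * c t xi2) p)).
  - intros; symmetry; apply hopf_pval.
  - apply lsum_continuous; intros; apply cmult_continuous, trig_continuous.
Qed.

Lemma inner_integral_continuous (eta x : R) : continuous (fun xi1 => RInt (fun xi2 =>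
  sin eta * cos eta * pval p (coords (hopf eta xi1 xi2))) 0 (2 * PI)) x.
Proof.
  apply (continuous_ext (fun xi1 => lsum (fun t =>
     fst t * a t eta * b t xi1 * RInt (c t) 0 (2 * PI)) p)).
  - intros; symmetry; apply inner_integral.
  - apply (lsum_continuous (fun t xi1 => fst t * a t eta * b t xi1 * RInt (c t) 0 (2 * PI))).
    intros; apply multc_continuous, cmult_continuous, trig_continuous.
Qed.

Lemma middle_integral_continuous (x : R) : continuous (fun eta => RInt (fun xi1 => RInt (fun xi2 =>
  sin eta * cos eta * pval p (coords (hopf eta xi1 xi2))) 0 (2 * PI)) 0 (2 * PI)) x.
Proof.
  apply (continuous_ext (fun eta => lsum (fun t =>
     fst t * a t eta * RInt (b t) 0 (2 * PI) * RInt (c t) 0 (2 * PI)) p)).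
  - intros; symmetry; apply middle_integral.
  - apply (lsum_continuous (fun t eta =>
      fst t * a t eta * RInt (b t) 0 (2 * PI) * RInt (c t) 0 (2 * PI))).
    intros; apply multc_continuous, multc_continuous, cmult_continuous, trig_continuous.
Qed.

Lemma inner_integral_nonneg (eta xi1 : R) : 0 <= eta <= PI / 2 -> 0 <= RInt (fun xi2 =>
  sin eta * cos eta * pval p (coords (hopf eta xi1 xi2))) 0 (2 * PI).
Proof.
  intros He; apply RInt_ge_0; [exact PI2pos|apply ex_RInt_cont, integrand_continuous|].
  intros; now apply integrand_nonneg.
Qed.

Lemma middle_integral_nonneg (eta : R) : 0 <= eta <= PI / 2 -> 0 <= RInt (fun xi1 => RInt (fun xi2 =>
  sin eta * cos eta * pval p (coords (hopf eta xi1 xi2))) 0 (2 * PI)) 0 (2 * PI).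
Proof.
  intros He; apply RInt_ge_0; [exact PI2pos|apply ex_RInt_cont, inner_integral_continuous|].
  intros; now apply inner_integral_nonneg.
Qed.

Lemma phaar_nonneg : 0 <= phaar p.
Proof.
  rewrite <- haarR_pval; unfold haarR; pose proof PI_RGT_0.
  apply Rmult_le_pos.
  - left; apply Rinv_0_lt_compat; pose proof (pow_lt PI 2 H); lra.
  - apply RInt_ge_0; [lra|apply ex_RInt_cont, middle_integral_continuous|].
    intros; apply middle_integral_nonneg; lra.
Qed.

(** Extends vanishing from the interior of the Hopf chart to its boundary, where positivity of the
    integral gives no information. *)
Lemma continuous_zero_closure (f : R -> R) (u v : R) : u < v -> (forall x, continuous f x) ->
  (forall x, u < x < v -> f x = 0) -> forall x, u <= x <= v -> f x = 0.
Proof.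
  intros uv cf f0 x ux.
  destruct (Req_dec (f x) 0) as [|nz]; [assumption|exfalso].
  assert (cx : locally x (fun y => f y <> 0)).
  { apply (cf x (fun z => z <> 0)).
    exists (mkposreal _ (Rabs_pos_lt _ nz)); simpl; intros y By.
    unfold ball in By; simpl in By; unfold AbsRing_ball, abs, minus, plus, opp in By; simpl in By.
    intros ->. rewrite Rplus_0_l, Rabs_Ropp in By; lra. }
  destruct cx as [[d d0] Hd]; simpl in Hd.
  set (w := Rmin (d / 2) ((v - u) / 4)).
  assert (w0 : 0 < w) by (apply Rmin_glb_lt; lra).
  assert (wd : w <= d / 2) by apply Rmin_l.
  assert (wv : w <= (v - u) / 4) by apply Rmin_r.
  destruct (Rle_dec x ((u + v) / 2)) as [h|h].
  - apply (Hd (x + w)); [|apply f0; lra].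
    unfold ball; simpl; unfold AbsRing_ball, abs, minus, plus, opp; simpl; apply Rabs_def1; lra.
  - apply (Hd (x - w)); [|apply f0; lra].
    unfold ball; simpl; unfold AbsRing_ball, abs, minus, plus, opp; simpl; apply Rabs_def1; lra.
Qed.

Lemma coords_hopf_continuous (q : list (R * mono)) :
  (forall eta xi1 x, continuous (fun z => pval q (coords (hopf eta xi1 z))) x) /\
  (forall eta xi2 x, continuous (fun z => pval q (coords (hopf eta z xi2))) x) /\
  (forall xi1 xi2 x, continuous (fun z => pval q (coords (hopf z xi1 xi2))) x).
Proof.
  unfold pval; repeat split; intros y z x.
  - apply (lsum_continuous (fun t z0 => fst t * mval (snd t) (coords (hopf y z z0)))).
    intros [r [[[i j] k] l]] w; apply cmult_continuous; simpl.
    by_derive.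
  - apply (lsum_continuous (fun t z0 => fst t * mval (snd t) (coords (hopf y z0 z)))).
    intros [r [[[i j] k] l]] w; apply cmult_continuous; simpl.
    by_derive.
  - apply (lsum_continuous (fun t z0 => fst t * mval (snd t) (coords (hopf z0 y z)))).
    intros [r [[[i j] k] l]] w; apply cmult_continuous; simpl.
    by_derive.
Qed.

(** The three nested integrals are removed one at a time; in the open box the density is positive
    and can be divided out. *)
Lemma phaar_zero : phaar p = 0 -> forall eta xi1 xi2,
  0 <= eta <= PI / 2 -> 0 <= xi1 <= 2 * PI -> 0 <= xi2 <= 2 * PI ->
  pval p (coords (hopf eta xi1 xi2)) = 0.
Proof.
  intros I0; pose proof PI_RGT_0 as pi0.
  destruct (coords_hopf_continuous p) as [c3 [c2 c1]].
  rewrite <- haarR_pval in I0; unfold haarR in I0.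
  apply Rmult_integral in I0; destruct I0 as [I0|I0].
  { exfalso; revert I0; apply Rinv_neq_0_compat; pose proof (pow_lt PI 2 pi0); lra. }
  assert (Z : forall eta xi1 xi2, 0 < eta < PI / 2 -> 0 < xi1 < 2 * PI -> 0 < xi2 < 2 * PI ->
    pval p (coords (hopf eta xi1 xi2)) = 0).
  { intros eta xi1 xi2 he h1 h2.
    assert (he' : 0 <= eta <= PI / 2) by lra.
    assert (J := RInt_zero_nonneg _ _ _ middle_integral_continuous middle_integral_nonneg I0 eta he); simpl in J.
    assert (J' := RInt_zero_nonneg _ _ _ (inner_integral_continuous eta) (fun x _ => inner_integral_nonneg eta x he') J xi1 h1).
    simpl in J'.
    assert (J'' := RInt_zero_nonneg _ _ _ (integrand_continuous eta xi1)
      (fun x _ => integrand_nonneg eta xi1 x he') J' xi2 h2); simpl in J''.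
    assert (0 < sin eta) by (apply sin_gt_0; lra).
    assert (0 < cos eta) by (apply cos_gt_0; lra).
    apply Rmult_integral in J''; destruct J'' as [J''|]; [|assumption].
    apply Rmult_integral in J''; destruct J''; lra. }
  intros eta xi1 xi2 he h1 h2.
  apply (continuous_zero_closure (fun z => pval p (coords (hopf z xi1 xi2))) 0 (PI / 2));
    [lra|apply c1| |assumption].
  clear eta he; intros eta he.
  apply (continuous_zero_closure (fun z => pval p (coords (hopf eta z xi2))) 0 (2 * PI));
    [lra|apply c2| |assumption].
  clear xi1 h1; intros xi1 h1.
  apply (continuous_zero_closure (fun z => pval p (coords (hopf eta xi1 z))) 0 (2 * PI));
    [lra|apply c3| |assumption].
  intros; now apply Z.
Qed.
End Nested.

(** Fundamental theorem of calculus for [cos ^ m * sin ^ n]. The conventional value of [pred 0]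
    always meets a vanishing coefficient. *)
Lemma RInt_pow_trig_deriv (m n : nat) (a b : R) :
  INR n * RInt (fun t => cos t ^ S m * sin t ^ pred n) a b
  - INR m * RInt (fun t => cos t ^ pred m * sin t ^ S n) a b
  = cos b ^ m * sin b ^ n - cos a ^ m * sin a ^ n.
Proof.
  assert (H : is_RInt (fun t => INR n * (cos t ^ S m * sin t ^ pred n) +
      - INR m * (cos t ^ pred m * sin t ^ S n)) a b
      (cos b ^ m * sin b ^ n - cos a ^ m * sin a ^ n)).
  { apply (is_RInt_derive (fun t => cos t ^ m * sin t ^ n)).
    - intros x _; auto_derive; trivial; simpl; ring.
    - intros x _.
      apply (continuous_plus (fun t => INR n * (cos t ^ S m * sin t ^ pred n))
        (fun t => - INR m * (cos t ^ pred m * sin t ^ S n)));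
      apply cmult_continuous, pow_trig_continuous. }
  rewrite <- (is_RInt_unique _ _ _ _ H).
  rewrite (RInt_plus (fun t => INR n * (cos t ^ S m * sin t ^ pred n))
    (fun t => - INR m * (cos t ^ pred m * sin t ^ S n)));
    try (apply ex_RInt_cont; intros; apply cmult_continuous, pow_trig_continuous).
  rewrite !RInt_mult_l by (intros; apply pow_trig_continuous).
  unfold plus; simpl; ring.
Qed.

Lemma circ_deriv (m n : nat) : INR n * circ (S m) (pred n) = INR m * circ (pred m) (S n).
Proof.
  pose proof (RInt_pow_trig_deriv m n 0 (2 * PI)) as H.
  rewrite cos_2PI, sin_2PI, cos_0, sin_0 in H; unfold circ; lra.
Qed.

Lemma quarter_deriv (p q : nat) :
  INR (S p) * quarter p (S (S q)) = INR (S q) * quarter (S (S p)) q.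
Proof.
  pose proof (RInt_pow_trig_deriv (S p) (S q) 0 (PI / 2)) as H.
  rewrite cos_PI2, sin_0, !pow_i in H by lia; unfold quarter; simpl pred in H; lra.
Qed.

Lemma RInt_pow_trig_split (m n : nat) (a b : R) :
  RInt (fun t => cos t ^ m * sin t ^ n) a b =
  RInt (fun t => cos t ^ S (S m) * sin t ^ n) a b +
  RInt (fun t => cos t ^ m * sin t ^ S (S n)) a b.
Proof.
  rewrite <- (RInt_plus (fun t => cos t ^ S (S m) * sin t ^ n)
    (fun t => cos t ^ m * sin t ^ S (S n)));
    try (apply ex_RInt_cont; intros; apply pow_trig_continuous).
  apply RInt_ext; intros x _; unfold plus; simpl.
  pose proof (sin2_cos2 x) as A; unfold Rsqr in A.
  transitivity (cos x ^ m * sin x ^ n * (sin x * sin x + cos x * cos x)); [rewrite A|]; ring.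
Qed.

(** Integration by parts combined with [sin ^ 2 + cos ^ 2 = 1]. *)
Lemma circ_cos (m n : nat) : INR (m + n + 2) * circ (S (S m)) n = INR (S m) * circ m n.
Proof.
  pose proof (circ_deriv (S m) (S n)) as H; simpl pred in H.
  pose proof (RInt_pow_trig_split m n 0 (2 * PI)) as E; fold (circ m n) in E.
  fold (circ (S (S m)) n) in E; fold (circ m (S (S n))) in E.
  rewrite E, Rmult_plus_distr_l, <- H, !plus_INR, !S_INR; simpl; ring.
Qed.

Lemma circ_sin (m n : nat) : INR (m + n + 2) * circ m (S (S n)) = INR (S n) * circ m n.
Proof.
  pose proof (circ_deriv (S m) (S n)) as H; simpl pred in H.
  pose proof (RInt_pow_trig_split m n 0 (2 * PI)) as E; fold (circ m n) in E.
  fold (circ (S (S m)) n) in E; fold (circ m (S (S n))) in E.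
  rewrite E, Rmult_plus_distr_l, H, !plus_INR, !S_INR; simpl; ring.
Qed.

Lemma circ_1l (n : nat) : circ 1 n = 0.
Proof.
  pose proof (circ_deriv 0 (S n)) as H; rewrite Rmult_0_l in H; simpl pred in H.
  apply Rmult_integral in H; destruct H as [H|H]; [|exact H].
  exfalso; pose proof (lt_0_INR (S n)); lra || (assert (0 < INR (S n)) by (apply lt_0_INR; lia); lra).
Qed.

Lemma circ_1r (m : nat) : circ m 1 = 0.
Proof.
  pose proof (circ_deriv (S m) 0) as H; rewrite Rmult_0_l in H; simpl pred in H.
  symmetry in H; apply Rmult_integral in H; destruct H as [H|H]; [|exact H].
  exfalso; assert (0 < INR (S m)) by (apply lt_0_INR; lia); lra.
Qed.

(** Moving a power from one Hopf circle to the other changes all three factors of [mhaar]: the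
    circular ones by their recursions, the one in [eta] by [quarter_deriv]. The factors [p] and [q]
    then cancel. *)
Lemma mhaar_cross (P Q C1 C1' C2 C2' a b p q A : R) :
  0 < p -> 0 < q ->
  p * C1' = a * C1 -> q * C2' = b * C2 -> p * P = q * Q ->
  a * (A * (P * C1 * C2')) = b * (A * (Q * C1' * C2)).
Proof.
  intros p0 q0 e1 e2 e3.
  apply (Rmult_eq_reg_l (p * q)); [|nra].
  transitivity (A * (p * P) * (a * C1) * (q * C2')); [ring|].
  rewrite e3, <- e1, e2; ring.
Qed.

(** For the monomial [m] with these exponents, the integral of [x1 * d0 m - x0 * d1 m] vanishes:
    invariance under infinitesimal rotation of the plane [01]. The other five planes follow. *)
Definition mono_shift01 (i j k l : nat) :
  INR i * mhaar (pred i, S j, k, l) = INR j * mhaar (S i, pred j, k, l).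
Proof.
  destruct i as [|i], j as [|j]; simpl pred; unfold mhaar; rewrite ?circ_1l, ?circ_1r; try (simpl; ring).
  pose proof (circ_deriv (S i) (S j)) as H; simpl pred in H.
  replace (i + S (S j) + 1)%nat with (S (S i) + j + 1)%nat by lia.
  set (q := quarter _ _).
  transitivity (/ (2 * PI ^ 2) * q * circ k l * (INR (S i) * circ i (S (S j)))); [ring|].
  rewrite <- H; ring.
Qed.

Definition mono_shift23 (i j k l : nat) :
  INR k * mhaar (i, j, pred k, S l) = INR l * mhaar (i, j, S k, pred l).
Proof.
  destruct k as [|k], l as [|l]; simpl pred; unfold mhaar; rewrite ?circ_1l, ?circ_1r; try (simpl; ring).
  pose proof (circ_deriv (S k) (S l)) as H; simpl pred in H.
  replace (k + S (S l) + 1)%nat with (S (S k) + l + 1)%nat by lia.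
  set (q := quarter _ _).
  transitivity (/ (2 * PI ^ 2) * q * circ i j * (INR (S k) * circ k (S (S l)))); [ring|].
  rewrite <- H; ring.
Qed.

Ltac cross i j k l L1 L2 :=
  apply (mhaar_cross _ _ _ _ _ _ _ _ (INR (i + j + 2)) (INR (k + l + 2)));
  [apply lt_0_INR; lia | apply lt_0_INR; lia | apply L1 | apply L2 | ];
  let H := fresh in
  pose proof (quarter_deriv (i + j + 1) (k + l + 1)) as H;
  replace (i + j + 2)%nat with (S (i + j + 1)) by lia;
  replace (k + l + 2)%nat with (S (k + l + 1)) by lia;
  etransitivity; [etransitivity; [|exact H]|];
  f_equal; f_equal; lia.

Lemma mono_shift02 (i j k l : nat) :
  INR i * mhaar (pred i, j, S k, l) = INR k * mhaar (S i, j, pred k, l).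
Proof.
  destruct i as [|i], k as [|k]; simpl pred; unfold mhaar; rewrite ?circ_1l, ?circ_1r; try (simpl; ring).
  cross i j k l circ_cos circ_cos.
Qed.

Lemma mono_shift03 (i j k l : nat) :
  INR i * mhaar (pred i, j, k, S l) = INR l * mhaar (S i, j, k, pred l).
Proof.
  destruct i as [|i], l as [|l]; simpl pred; unfold mhaar; rewrite ?circ_1l, ?circ_1r; try (simpl; ring).
  cross i j k l circ_cos circ_sin.
Qed.

Lemma mono_shift12 (i j k l : nat) :
  INR j * mhaar (i, pred j, S k, l) = INR k * mhaar (i, S j, pred k, l).
Proof.
  destruct j as [|j], k as [|k]; simpl pred; unfold mhaar; rewrite ?circ_1l, ?circ_1r; try (simpl; ring).
  cross i j k l circ_sin circ_cos.
Qed.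

Lemma mono_shift13 (i j k l : nat) :
  INR j * mhaar (i, pred j, k, S l) = INR l * mhaar (i, S j, k, pred l).
Proof.
  destruct j as [|j], l as [|l]; simpl pred; unfold mhaar; rewrite ?circ_1l, ?circ_1r; try (simpl; ring).
  cross i j k l circ_sin circ_sin.
Qed.

(** * Invariance of the Haar integral *)

(** Upper triangle of a skew-symmetric 4 by 4 matrix, that is, a general infinitesimal rotation of
    the sphere. *)
Record skew := { w01 : R; w02 : R; w03 : R; w12 : R; w13 : R; w23 : R }.

Definition skew_app (w : skew) (x : R * R * R * R) : R * R * R * R :=
  let '(x0, x1, x2, x3) := x in
  (w01 w * x1 + w02 w * x2 + w03 w * x3, - w01 w * x0 + w12 w * x2 + w13 w * x3,
   - w02 w * x0 - w12 w * x1 + w23 w * x3, - w03 w * x0 - w13 w * x1 - w23 w * x2).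

(** The exponential of [th * w] when [w] squares to minus the identity, which is what
    [complex_structure] says; [rot_add] is then its group law. *)
Definition rot (w : skew) (th : R) (x : R * R * R * R) : R * R * R * R :=
  let '(x0, x1, x2, x3) := x in
  let '(y0, y1, y2, y3) := skew_app w x in
  (cos th * x0 + sin th * y0, cos th * x1 + sin th * y1,
   cos th * x2 + sin th * y2, cos th * x3 + sin th * y3).

Definition complex_structure (w : skew) : Prop := forall x0 x1 x2 x3,
  skew_app w (skew_app w (x0, x1, x2, x3)) = (- x0, - x1, - x2, - x3).

Lemma rot_add (w : skew) (th t : R) (x : R * R * R * R) : complex_structure w ->
  rot w (th + t) x = rot w th (rot w t x).
Proof.
  intros H; destruct x as [[[x0 x1] x2] x3]; specialize (H x0 x1 x2 x3).
  unfold rot, skew_app in *; rewrite cos_plus, sin_plus.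
  injection H; clear H; intros E3 E2 E1 E0.
  set (c := cos th); set (s := sin th); set (c' := cos t); set (s' := sin t).
  assert (F : forall a b, a = b -> s * s' * a = s * s' * b) by (intros; now f_equal).
  apply F in E0; apply F in E1; apply F in E2; apply F in E3.
  f_equal; [f_equal; [f_equal|]|]; lra.
Qed.

Definition mono_deriv (w : skew) (m : mono) : list (R * mono) :=
  let '(i, j, k, l) := m in
  (INR i * w01 w, (pred i, S j, k, l)) :: (INR i * w02 w, (pred i, j, S k, l)) ::
  (INR i * w03 w, (pred i, j, k, S l)) ::
  (- (INR j * w01 w), (S i, pred j, k, l)) :: (INR j * w12 w, (i, pred j, S k, l)) ::
  (INR j * w13 w, (i, pred j, k, S l)) ::
  (- (INR k * w02 w), (S i, j, pred k, l)) :: (- (INR k * w12 w), (i, S j, pred k, l)) ::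
  (INR k * w23 w, (i, j, pred k, S l)) ::
  (- (INR l * w03 w), (S i, j, k, pred l)) :: (- (INR l * w13 w), (i, S j, k, pred l)) ::
  (- (INR l * w23 w), (i, j, S k, pred l)) :: nil.

Lemma phaar_mono_deriv (w : skew) (m : mono) : phaar (mono_deriv w m) = 0.
Proof.
  destruct m as [[[i j] k] l]; unfold phaar, mono_deriv.
  cbn [lsum fst snd].
  pose proof (mono_shift01 i j k l); pose proof (mono_shift02 i j k l).
  pose proof (mono_shift03 i j k l); pose proof (mono_shift12 i j k l).
  pose proof (mono_shift13 i j k l); pose proof (mono_shift23 i j k l).
  assert (F : forall c a b, a = b -> c * a = c * b) by (intros; now f_equal).
  apply (F (w01 w)) in H; apply (F (w02 w)) in H0; apply (F (w03 w)) in H1.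
  apply (F (w12 w)) in H2; apply (F (w13 w)) in H3; apply (F (w23 w)) in H4.
  lra.
Qed.

Lemma is_derive_mval_rot (w : skew) (m : mono) (x : R * R * R * R) :
  is_derive (fun t => mval m (rot w t x)) 0 (pval (mono_deriv w m) x).
Proof.
  destruct m as [[[i j] k] l], x as [[[x0 x1] x2] x3].
  unfold rot, mval, skew_app, pval, mono_deriv, mval; cbn [lsum fst snd].
  auto_derive; [trivial|].
  rewrite cos_0, sin_0, !Rmult_1_l, !Rmult_0_l, !Rplus_0_r; simpl; ring.
Qed.

Definition pderiv (w : skew) (p : list (R * mono)) : list (R * mono) :=
  flat_map (fun t => map (fun s => (fst t * fst s, snd s)) (mono_deriv w (snd t))) p.

Lemma lsum_pderiv (w : skew) (f : mono -> R) (p : list (R * mono)) :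
  lsum (fun t => fst t * f (snd t)) (pderiv w p) =
  lsum (fun t => fst t * lsum (fun s => fst s * f (snd s)) (mono_deriv w (snd t))) p.
Proof.
  induction p as [|t p IH]; [reflexivity|].
  unfold pderiv in *; cbn [flat_map lsum]; rewrite lsum_app, IH, lsum_map, <- lsum_scal.
  f_equal; apply lsum_ext; intros s; simpl; ring.
Qed.

Lemma phaar_pderiv (w : skew) (p : list (R * mono)) : phaar (pderiv w p) = 0.
Proof.
  unfold phaar; rewrite (lsum_pderiv w mhaar).
  rewrite (lsum_ext _ (fun _ => 0 * 0)).
  - rewrite lsum_scal; ring.
  - intros t; fold (phaar (mono_deriv w (snd t))); rewrite phaar_mono_deriv; ring.
Qed.

Lemma is_derive_lsum {T : Type} (f : T -> R -> R) (df : T -> R) (l : list T) (x : R) :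
  (forall t, is_derive (f t) x (df t)) -> is_derive (fun y => lsum (fun t => f t y) l) x (lsum df l).
Proof.
  intros H; induction l as [|t l IH]; simpl.
  - apply (is_derive_const (V := R_NormedModule) 0 x).
  - exact (is_derive_plus (f t) (fun y => lsum (fun t => f t y) l) x _ _ (H t) IH).
Qed.

Lemma is_derive_pval_rot (w : skew) (p : list (R * mono)) (x : R * R * R * R) :
  is_derive (fun t => pval p (rot w t x)) 0 (pval (pderiv w p) x).
Proof.
  unfold pval at 2; rewrite (lsum_pderiv w (fun m => mval m x)).
  apply (is_derive_lsum (fun s t => fst s * mval (snd s) (rot w t x))); intros s.
  apply (is_derive_scal (fun t => mval (snd s) (rot w t x))), is_derive_mval_rot.
Qed.

(** Coefficients depending on the angle, bundled with a derivative. A rotated polynomial is a finite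
    sum of such coefficients times fixed monomials, so its mean is differentiated in the angle
    without differentiating under the integral sign. *)
Record dfun := { dval : R -> R; dder : R -> R; dvalP : forall t, is_derive dval t (dder t) }.

Definition dfun_const (r : R) : dfun.
Proof. exists (fun _ => r) (fun _ => 0); intros; apply (is_derive_const (V := R_NormedModule)). Defined.

Definition dfun_mul (f g : dfun) : dfun.
Proof.
  exists (fun t => dval f t * dval g t) (fun t => dder f t * dval g t + dval f t * dder g t).
  intros t; apply (is_derive_mult (dval f) (dval g)); [apply dvalP|apply dvalP|].
  intros; apply Rmult_comm.
Defined.

Definition dfun_cos : dfun.
Proof. exists cos (fun t => - sin t); intros; auto_derive; trivial; ring. Defined.

Definition dfun_sin : dfun.
Proof. exists sin cos; intros; auto_derive; trivial; ring. Defined.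

Definition fval (F : list (dfun * mono)) (th : R) (x : R * R * R * R) : R :=
  lsum (fun t => dval (fst t) th * mval (snd t) x) F.

Definition is_family (G : R -> R * R * R * R -> R) : Prop :=
  exists F, forall th x, G th x = fval F th x.

Definition mono_mul (m m' : mono) : mono :=
  let '(i, j, k, l) := m in let '(i', j', k', l') := m' in
  (i + i', j + j', k + k', l + l')%nat.

Lemma mval_mul (m m' : mono) (x : R * R * R * R) :
  mval (mono_mul m m') x = mval m x * mval m' x.
Proof.
  destruct m as [[[i j] k] l], m' as [[[i' j'] k'] l'], x as [[[x0 x1] x2] x3].
  simpl; rewrite !pow_add; ring.
Qed.

Lemma family_mul (G H : R -> R * R * R * R -> R) :
  is_family G -> is_family H -> is_family (fun th x => G th x * H th x).
Proof.
  intros [F HF] [F' HF'].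
  exists (flat_map (fun t => map (fun s => (dfun_mul (fst t) (fst s), mono_mul (snd t) (snd s))) F') F).
  intros th x; rewrite HF, HF'; unfold fval; clear.
  induction F as [|t F IH]; cbn [flat_map lsum]; [ring|].
  rewrite lsum_app, <- IH, lsum_map, Rmult_plus_distr_r; f_equal.
  rewrite <- lsum_scal; apply lsum_ext; intros s; simpl; rewrite mval_mul; ring.
Qed.

Lemma family_plus (G H : R -> R * R * R * R -> R) :
  is_family G -> is_family H -> is_family (fun th x => G th x + H th x).
Proof.
  intros [F HF] [F' HF']; exists (F ++ F').
  intros th x; rewrite HF, HF'; unfold fval; now rewrite lsum_app.
Qed.

Lemma family_dfun (f : dfun) : is_family (fun th _ => dval f th).
Proof.
  exists ((f, (0, 0, 0, 0)%nat) :: nil); intros th [[[x0 x1] x2] x3]; unfold fval; simpl; ring.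
Qed.

Lemma family_pow (G : R -> R * R * R * R -> R) (n : nat) :
  is_family G -> is_family (fun th x => G th x ^ n).
Proof.
  intros HG; induction n as [|n IH].
  - apply (family_dfun (dfun_const 1)).
  - now apply (family_mul G (fun th x => G th x ^ n)).
Qed.

Lemma family_lincomb (a0 a1 a2 a3 : dfun) :
  is_family (fun th x => let '(x0, x1, x2, x3) := x in
    dval a0 th * x0 + dval a1 th * x1 + dval a2 th * x2 + dval a3 th * x3).
Proof.
  exists ((a0, (1, 0, 0, 0)%nat) :: (a1, (0, 1, 0, 0)%nat) :: (a2, (0, 0, 1, 0)%nat)
    :: (a3, (0, 0, 0, 1)%nat) :: nil).
  intros th [[[x0 x1] x2] x3]; unfold fval; simpl; ring.
Qed.

Lemma is_family_ext (G H : R -> R * R * R * R -> R) :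
  (forall th x, G th x = H th x) -> is_family G -> is_family H.
Proof. intros e [F HF]; exists F; intros; now rewrite <- e. Qed.

Lemma family_mval_rot (w : skew) (m : mono) : is_family (fun th x => mval m (rot w th x)).
Proof.
  destruct m as [[[i j] k] l].
  set (sc := fun r => dfun_mul dfun_sin (dfun_const r)).
  assert (L := family_lincomb dfun_cos (sc (w01 w)) (sc (w02 w)) (sc (w03 w))).
  assert (L1 := family_lincomb (sc (- w01 w)) dfun_cos (sc (w12 w)) (sc (w13 w))).
  assert (L2 := family_lincomb (sc (- w02 w)) (sc (- w12 w)) dfun_cos (sc (w23 w))).
  assert (L3 := family_lincomb (sc (- w03 w)) (sc (- w13 w)) (sc (- w23 w)) dfun_cos).
  apply (family_pow _ i) in L; apply (family_pow _ j) in L1.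
  apply (family_pow _ k) in L2; apply (family_pow _ l) in L3.
  refine (is_family_ext _ _ _ (family_mul _ _ (family_mul _ _ L L1) (family_mul _ _ L2 L3))).
  intros th [[[x0 x1] x2] x3]; unfold rot, mval, skew_app; simpl.
  f_equal; f_equal; f_equal; ring.
Qed.

Lemma family_pval_rot (w : skew) (p : list (R * mono)) : is_family (fun th x => pval p (rot w th x)).
Proof.
  induction p as [|t p IH].
  - exists nil; reflexivity.
  - apply (family_plus (fun th x => fst t * mval (snd t) (rot w th x))); [|exact IH].
    apply family_mul; [apply (family_dfun (dfun_const (fst t)))|apply family_mval_rot].
Qed.

Lemma phaar_ext (p q : list (R * mono)) : (forall x, pval p x = pval q x) -> phaar p = phaar q.
Proof.
  intros e; rewrite <- !haarR_pval; f_equal; apply functional_extensionality; intros; apply e.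
Qed.

(* [phaar] kills derivatives along [w], so the mean of [pval p] rotated by [th] does not vary with [th]. *)
Lemma haarR_rot (w : skew) (p : list (R * mono)) (th : R) : complex_structure w -> 0 <= th ->
  haarR (fun g => pval p (rot w th (coords g))) = haarR (fun g => pval p (coords g)).
Proof.
  intros Hw th0.
  destruct (family_pval_rot w p) as [F HF].
  set (q := fun t => map (fun s : dfun * mono => (dval (fst s) t, snd s)) F).
  set (q' := fun t => map (fun s : dfun * mono => (dder (fst s) t, snd s)) F).
  assert (Hq : forall t x, pval (q t) x = pval p (rot w t x)).
  { intros t x; rewrite HF; unfold q, pval; now rewrite lsum_map. }
  assert (E : forall t, haarR (fun g => pval p (rot w t (coords g))) = phaar (q t)).
  { intros t; rewrite <- haarR_pval; f_equal; apply functional_extensionality; intros; now rewrite Hq. }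
  assert (R0 : forall x, rot w 0 x = x).
  { intros [[[x0 x1] x2] x3]; unfold rot, skew_app; rewrite cos_0, sin_0.
    f_equal; [f_equal; [f_equal|]|]; ring. }
  transitivity (phaar (q 0)).
  2:{ rewrite <- E; f_equal; apply functional_extensionality; intros; now rewrite R0. }
  rewrite E; symmetry.
  destruct (Rle_lt_or_eq_dec 0 th th0) as [lt|<-]; [|reflexivity].
  apply (eq_is_derive (V := R_NormedModule) (fun t => phaar (q t)) 0 th); [|exact lt].
  intros t _.
  (* By the group law, the derivative at [t] is the derivative at 0 of the polynomial already
     rotated by [t]. *)
  assert (D : phaar (q' t) = 0).
  { rewrite <- (phaar_pderiv w (q t)); apply phaar_ext; intros x.
    transitivity (Derive (fun s => pval p (rot w s x)) t).
    - symmetry; apply is_derive_unique.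
      apply (is_derive_ext (fun s => fval F s x)); [intros; now rewrite HF|].
      unfold q', pval; rewrite lsum_map.
      apply (is_derive_lsum (fun u s => dval (fst u) s * mval (snd u) x)); intros u; simpl.
      rewrite Rmult_comm.
      apply (is_derive_ext (fun s => mval (snd u) x * dval (fst u) s)); [intros; apply Rmult_comm|].
      apply (is_derive_scal (dval (fst u))), dvalP.
    - apply is_derive_unique.
      assert (H := is_derive_pval_rot w (q t) x).
      apply (is_derive_ext _ (fun s => pval p (rot w (t + s) x))) in H.
      2:{ intros s; rewrite Hq; simpl; now rewrite rot_add. }
      apply (is_derive_ext (fun s => pval p (rot w (t + (s - t)) x))).
      { intros s; simpl; repeat f_equal; ring. }
      replace 0 with (t - t) in H by ring.
      evar_last.
      + apply (is_derive_comp (fun s => pval p (rot w (t + s) x)) (fun s => s - t)).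
        * exact H.
        * auto_derive; [trivial|reflexivity].
      + unfold scal; simpl; unfold mult; simpl; ring. }
  unfold zero; simpl; rewrite <- D.
  unfold phaar, q'; rewrite lsum_map.
  apply (is_derive_ext (fun s => lsum (fun u : dfun * mono => dval (fst u) s * mhaar (snd u)) F)).
  { intros s; unfold q; now rewrite lsum_map. }
  apply (is_derive_lsum (fun u s => dval (fst u) s * mhaar (snd u))); intros u; simpl.
  rewrite Rmult_comm.
  apply (is_derive_ext (fun s => mhaar (snd u) * dval (fst u) s)); [intros; apply Rmult_comm|].
  apply (is_derive_scal (dval (fst u))), dvalP.
Qed.

(** * The group SU(2), its Hopf chart, and translations as rotations *)

Lemma is_su2_coords (g : su2) : is_su2 g <->
  fst (fst g) ^ 2 + snd (fst g) ^ 2 + fst (snd g) ^ 2 + snd (snd g) ^ 2 = 1.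
Proof.
  unfold is_su2, Cmod.
  rewrite !pow2_sqrt by (apply Rplus_le_le_0_compat; apply pow2_ge_0); split; intros; lra.
Qed.

Lemma su2_mul_su2 (g h : su2) : is_su2 g -> is_su2 h -> is_su2 (su2_mul g h).
Proof.
  rewrite !is_su2_coords; destruct g as [[a b] [c d]], h as [[a' b'] [c' d']]; simpl.
  intros H H'.
  transitivity ((a * (a * 1) + b * (b * 1) + c * (c * 1) + d * (d * 1)) *
    (a' * (a' * 1) + b' * (b' * 1) + c' * (c' * 1) + d' * (d' * 1))); [ring|].
  rewrite H, H'; ring.
Qed.

Lemma su2_one_su2 : is_su2 su2_one.
Proof. rewrite is_su2_coords; simpl; ring. Qed.

Lemma su2_mulA (g h k : su2) : su2_mul (su2_mul g h) k = su2_mul g (su2_mul h k).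
Proof.
  destruct g as [[a b] [c d]], h as [[a' b'] [c' d']], k as [[a'' b''] [c'' d'']].
  unfold su2_mul, Cmult, Cplus, Copp, Cconj; simpl; f_equal; f_equal; ring.
Qed.

Lemma su2_mul1g (g : su2) : su2_mul su2_one g = g.
Proof.
  destruct g as [[a b] [c d]].
  unfold su2_mul, su2_one, Cmult, Cplus, Copp, Cconj, RtoC; simpl; f_equal; f_equal; ring.
Qed.

(** The last clause keeps the angle in the upper half circle; in [hopf_surj], together with a
    nonnegative cosine, it confines [eta] to the first quadrant. *)
Lemma polar (x y r : R) : 0 <= r -> x ^ 2 + y ^ 2 = r ^ 2 ->
  exists t, 0 <= t <= 2 * PI /\ x = r * cos t /\ y = r * sin t /\ (0 <= y -> t <= PI) .
Proof.
  intros r0 E; pose proof PI_RGT_0 as pi0.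
  destruct (Rle_lt_or_eq_dec 0 r r0) as [rp|<-].
  2:{ exists 0; rewrite !Rmult_0_l; assert (x = 0) by nra; assert (y = 0) by nra.
      repeat split; intros; lra. }
  set (c := x / r).
  assert (xc : x = r * c) by (unfold c; field; lra).
  set (d := y / r).
  assert (yd : y = r * d) by (unfold d; field; lra).
  assert (cd : c ^ 2 + d ^ 2 = 1).
  { apply (Rmult_eq_reg_l (r ^ 2)); [|apply pow_nonzero; lra].
    transitivity ((r * c) ^ 2 + (r * d) ^ 2); [ring|]. rewrite <- xc, <- yd, E; ring. }
  assert (c1 : -1 <= c <= 1) by nra.
  pose proof (acos_bound c) as ab.
  assert (sc : sin (acos c) = Rabs d).
  { rewrite sin_acos by exact c1. rewrite <- sqrt_Rsqr_abs; f_equal; unfold Rsqr; nra. }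
  destruct (Rle_dec 0 d) as [d0|d0].
  - exists (acos c); rewrite cos_acos, sc, Rabs_right by lra; repeat split; lra.
  - exists (- acos c + 2 * PI).
    rewrite cos_plus, sin_plus, cos_2PI, sin_2PI, cos_neg, sin_neg, cos_acos, sc, Rabs_left by lra.
    repeat split; try lra. intros y0; exfalso; apply d0; rewrite yd in y0.
    apply (Rmult_le_reg_l r); lra.
Qed.

Lemma hopf_surj (g : su2) : is_su2 g -> exists eta xi1 xi2,
  0 <= eta <= PI / 2 /\ 0 <= xi1 <= 2 * PI /\ 0 <= xi2 <= 2 * PI /\ g = hopf eta xi1 xi2.
Proof.
  destruct g as [[a b] [c d]]; rewrite is_su2_coords; cbn [fst snd]; intros E.
  set (r := sqrt (a ^ 2 + b ^ 2)); set (s := sqrt (c ^ 2 + d ^ 2)).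
  assert (r2 : r ^ 2 = a ^ 2 + b ^ 2) by (apply pow2_sqrt; nra).
  assert (s2 : s ^ 2 = c ^ 2 + d ^ 2) by (apply pow2_sqrt; nra).
  assert (r0 : 0 <= r) by apply sqrt_pos. assert (s0 : 0 <= s) by apply sqrt_pos.
  pose proof PI_RGT_0.
  destruct (polar r s 1) as [eta [He [er [es hs]]]]; [lra|lra|].
  destruct (polar a b r) as [xi1 [H1 [ea [eb _]]]]; [lra|lra|].
  destruct (polar c d s) as [xi2 [H2 [ec [ed _]]]]; [lra|lra|].
  rewrite Rmult_1_l in er, es; specialize (hs s0).
  exists eta, xi1, xi2; repeat split; try lra.
  - apply Rnot_lt_le; intros lt.
    assert (cos eta < 0) by (apply cos_lt_0; lra); lra.
  - unfold hopf; rewrite <- er, <- es, <- ea, <- eb, <- ec, <- ed; reflexivity.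
Qed.

(** Only values on SU(2) are constrained, so the equation of the sphere may be used freely. On this
    class the integral is linear with no further integrability condition. *)
Definition is_poly (f : su2 -> R) : Prop :=
  exists p, forall g, is_su2 g -> f g = pval p (coords g).

Lemma haarR_ext (f f' : su2 -> R) : (forall g, is_su2 g -> f g = f' g) -> haarR f = haarR f'.
Proof.
  intros e; unfold haarR; apply (f_equal (fun F => / (2 * PI ^ 2) * RInt F 0 (PI / 2))).
  apply functional_extensionality; intros eta.
  apply (f_equal (fun F => RInt F 0 (2 * PI))), functional_extensionality; intros xi1.
  apply (f_equal (fun F => RInt F 0 (2 * PI))), functional_extensionality; intros xi2.
  now rewrite e by apply hopf_su2.
Qed.

Lemma poly_const (c : R) : is_poly (fun _ => c).
Proof.
  exists ((c, (0, 0, 0, 0)%nat) :: nil); intros g _.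
  unfold pval, coords; simpl; ring.
Qed.

Lemma poly_ext (f f' : su2 -> R) : (forall g, is_su2 g -> f g = f' g) -> is_poly f -> is_poly f'.
Proof. intros e [p Hp]; exists p; intros g Hg; now rewrite <- e, Hp. Qed.

Lemma poly_plus (f f' : su2 -> R) : is_poly f -> is_poly f' -> is_poly (fun g => f g + f' g).
Proof.
  intros [p Hp] [p' Hp']; exists (p ++ p'); intros g Hg.
  rewrite Hp, Hp' by exact Hg; unfold pval; now rewrite lsum_app.
Qed.

Definition pmul (p q : list (R * mono)) : list (R * mono) :=
  flat_map (fun t => map (fun s => (fst t * fst s, mono_mul (snd t) (snd s))) q) p.

Lemma pval_mul (p q : list (R * mono)) (x : R * R * R * R) : pval (pmul p q) x = pval p x * pval q x.
Proof.
  unfold pmul, pval; induction p as [|t p IH]; cbn [flat_map lsum]; [ring|].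
  rewrite lsum_app, IH, lsum_map, Rmult_plus_distr_r; f_equal.
  rewrite <- lsum_scal; apply lsum_ext; intros s; simpl; rewrite mval_mul; ring.
Qed.

Lemma poly_mult (f f' : su2 -> R) : is_poly f -> is_poly f' -> is_poly (fun g => f g * f' g).
Proof.
  intros [p Hp] [p' Hp']; exists (pmul p p'); intros g Hg.
  now rewrite Hp, Hp', pval_mul by exact Hg.
Qed.

Lemma poly_mono (m : mono) : is_poly (fun g => mval m (coords g)).
Proof. exists ((1, m) :: nil); intros g _; unfold pval; simpl; ring. Qed.

Lemma haarR_plus (f f' : su2 -> R) : is_poly f -> is_poly f' ->
  haarR (fun g => f g + f' g) = haarR f + haarR f'.
Proof.
  intros [p Hp] [p' Hp'].
  rewrite (haarR_ext _ (fun g => pval (p ++ p') (coords g))).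
  - rewrite (haarR_ext f _ Hp), (haarR_ext f' _ Hp'), !haarR_pval.
    unfold phaar; now rewrite lsum_app.
  - intros g Hg; rewrite Hp, Hp' by exact Hg; unfold pval; now rewrite lsum_app.
Qed.

Lemma haarR_scal (c : R) (f : su2 -> R) : is_poly f -> haarR (fun g => c * f g) = c * haarR f.
Proof.
  intros [p Hp].
  rewrite (haarR_ext _ (fun g => pval (map (fun t => (c * fst t, snd t)) p) (coords g))).
  - rewrite (haarR_ext f _ Hp), !haarR_pval.
    unfold phaar; rewrite lsum_map, <- lsum_scal; apply lsum_ext; intros; simpl; ring.
  - intros g Hg; rewrite Hp by exact Hg; unfold pval; rewrite lsum_map, <- lsum_scal.
    apply lsum_ext; intros; simpl; ring.
Qed.

Lemma haarR_one : haarR (fun _ => 1) = 1.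
Proof.
  rewrite (haarR_ext _ (fun g => pval ((1, (0, 0, 0, 0)%nat) :: nil) (coords g))).
  2:{ intros g _; unfold pval, coords; simpl; ring. }
  rewrite haarR_pval; unfold phaar, mhaar; simpl lsum.
  assert (q : 2 * quarter 1 1 = 1).
  { pose proof (RInt_pow_trig_deriv 0 2 0 (PI / 2)) as H.
    simpl INR in H; simpl pred in H; fold (quarter 1 1) in H.
    rewrite sin_PI2, sin_0 in H; simpl in H; lra. }
  assert (c : circ 0 0 = 2 * PI).
  { unfold circ; rewrite (RInt_ext _ (fun _ => 1)) by (intros; simpl; ring).
    rewrite RInt_const; unfold scal; simpl; unfold mult; simpl; ring. }
  rewrite c; simpl Nat.add.
  replace (quarter 1 1) with (1 / 2) by lra.
  pose proof PI_RGT_0; field; lra.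
Qed.

Lemma haarR_nonneg (f : su2 -> R) : is_poly f -> (forall g, is_su2 g -> 0 <= f g) -> 0 <= haarR f.
Proof.
  intros [p Hp] f0; rewrite (haarR_ext f _ Hp), haarR_pval.
  apply phaar_nonneg; intros g Hg; rewrite <- Hp by exact Hg; now apply f0.
Qed.

Lemma haarR_sqr_zero (f : su2 -> R) : is_poly f -> haarR (fun g => f g * f g) = 0 ->
  forall g, is_su2 g -> f g = 0.
Proof.
  intros [p Hp] I0 g Hg.
  assert (E : forall h, is_su2 h -> f h * f h = pval (pmul p p) (coords h)).
  { intros h Hh; now rewrite pval_mul, Hp by exact Hh. }
  rewrite (haarR_ext _ _ E), haarR_pval in I0.
  destruct (hopf_surj g Hg) as [eta [xi1 [xi2 [h0 [h1 [h2 ->]]]]]].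
  assert (Z := phaar_zero (pmul p p)).
  assert (N : forall h, is_su2 h -> 0 <= pval (pmul p p) (coords h)).
  { intros h Hh; rewrite <- E by exact Hh; nra. }
  specialize (Z N I0 eta xi1 xi2 h0 h1 h2); rewrite <- E in Z by apply hopf_su2; nra.
Qed.

(** Polar form [cos th + sin th * n] of a unit quaternion, with [n] a unit imaginary quaternion. *)
Lemma exp_coords (k : su2) : is_su2 k -> exists th n1 n2 n3, 0 <= th /\
  n1 ^ 2 + n2 ^ 2 + n3 ^ 2 = 1 /\
  k = ((cos th, sin th * n1), (sin th * n2, sin th * n3)).
Proof.
  destruct k as [[a b] [c d]]; rewrite is_su2_coords; cbn [fst snd]; intros E.
  set (r := sqrt (b ^ 2 + c ^ 2 + d ^ 2)).
  assert (r2 : r ^ 2 = b ^ 2 + c ^ 2 + d ^ 2) by (apply pow2_sqrt; nra).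
  assert (r0 : 0 <= r) by apply sqrt_pos.
  destruct (polar a r 1) as [th [H1 [ea [er _]]]]; [lra|lra|].
  rewrite Rmult_1_l in ea, er.
  destruct (Rle_lt_or_eq_dec 0 r r0) as [rp|r00].
  - exists th, (b / r), (c / r), (d / r); rewrite <- ea, <- er; repeat split; [lra| |].
    + apply (Rmult_eq_reg_l (r ^ 2)); [|apply pow_nonzero; lra].
      rewrite Rmult_1_r; rewrite r2 at 2; field; lra.
    + f_equal; f_equal; field; lra.
  (* Here [k] is real and any unit direction will do. *)
  - exists th, 1, 0, 0; rewrite <- ea, <- er, <- r00; repeat split; [lra|ring|].
    rewrite <- r00 in r2; f_equal; f_equal; nra.
Qed.

Lemma poly_rot (w : skew) (p : list (R * mono)) (th : R) :
  is_poly (fun g => pval p (rot w th (coords g))).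
Proof.
  destruct (family_pval_rot w p) as [F HF].
  exists (map (fun s : dfun * mono => (dval (fst s) th, snd s)) F); intros g _.
  rewrite HF; unfold pval; now rewrite lsum_map.
Qed.

(** Left and right multiplication by the imaginary quaternion with components [n1], [n2], [n3]; they
    square to minus the identity when it has norm one. *)
Definition skew_left (n1 n2 n3 : R) : skew :=
  {| w01 := - n1; w02 := - n2; w03 := - n3; w12 := n3; w13 := - n2; w23 := n1 |}.
Definition skew_right (n1 n2 n3 : R) : skew :=
  {| w01 := - n1; w02 := - n2; w03 := - n3; w12 := - n3; w13 := n2; w23 := - n1 |}.

Lemma left_mul_rot (k : su2) : is_su2 k -> exists w th, 0 <= th /\ complex_structure w /\
  forall g, coords (su2_mul k g) = rot w th (coords g).
Proof.
  intros Hk; destruct (exp_coords k Hk) as [th [n1 [n2 [n3 [th0 [n11 ->]]]]]].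
  exists (skew_left n1 n2 n3), th; split; [exact th0|split].
  - intros x0 x1 x2 x3; unfold skew_app, skew_left; simpl.
    assert (F : forall a, a * (n1 ^ 2 + n2 ^ 2 + n3 ^ 2) = a) by (intros; rewrite n11; ring).
    pose proof (F x0); pose proof (F x1); pose proof (F x2); pose proof (F x3).
    f_equal; [f_equal; [f_equal|]|]; lra.
  - intros [[a b] [c d]]; unfold coords, su2_mul, rot, skew_app, skew_left, Cmult, Cplus, Copp, Cconj; simpl.
    f_equal; [f_equal; [f_equal|]|]; ring.
Qed.

Lemma right_mul_rot (k : su2) : is_su2 k -> exists w th, 0 <= th /\ complex_structure w /\
  forall g, coords (su2_mul g k) = rot w th (coords g).
Proof.
  intros Hk; destruct (exp_coords k Hk) as [th [n1 [n2 [n3 [th0 [n11 ->]]]]]].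
  exists (skew_right n1 n2 n3), th; split; [exact th0|split].
  - intros x0 x1 x2 x3; unfold skew_app, skew_right; simpl.
    assert (F : forall a, a * (n1 ^ 2 + n2 ^ 2 + n3 ^ 2) = a) by (intros; rewrite n11; ring).
    pose proof (F x0); pose proof (F x1); pose proof (F x2); pose proof (F x3).
    f_equal; [f_equal; [f_equal|]|]; lra.
  - intros [[a b] [c d]]; unfold coords, su2_mul, rot, skew_app, skew_right, Cmult, Cplus, Copp, Cconj; simpl.
    f_equal; [f_equal; [f_equal|]|]; ring.
Qed.

Lemma haarR_left (k : su2) (f : su2 -> R) : is_su2 k -> is_poly f ->
  haarR (fun g => f (su2_mul k g)) = haarR f.
Proof.
  intros Hk [p Hp]; destruct (left_mul_rot k Hk) as [w [th [th0 [Hw E]]]].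
  rewrite (haarR_ext f _ Hp), <- (haarR_rot w p th Hw th0).
  apply haarR_ext; intros g Hg; now rewrite Hp, E by (now apply su2_mul_su2).
Qed.

Lemma haarR_right (k : su2) (f : su2 -> R) : is_su2 k -> is_poly f ->
  haarR (fun g => f (su2_mul g k)) = haarR f.
Proof.
  intros Hk [p Hp]; destruct (right_mul_rot k Hk) as [w [th [th0 [Hw E]]]].
  rewrite (haarR_ext f _ Hp), <- (haarR_rot w p th Hw th0).
  apply haarR_ext; intros g Hg; now rewrite Hp, E by (now apply su2_mul_su2).
Qed.

Lemma poly_left (k : su2) (f : su2 -> R) : is_su2 k -> is_poly f -> is_poly (fun g => f (su2_mul k g)).
Proof.
  intros Hk [p Hp]; destruct (left_mul_rot k Hk) as [w [th [_ [_ E]]]].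
  apply (poly_ext (fun g => pval p (rot w th (coords g)))); [|apply poly_rot].
  intros g Hg; now rewrite Hp, E by (now apply su2_mul_su2).
Qed.

(** * Polynomials of bounded degree *)

Definition mdeg (m : mono) : nat := let '(i, j, k, l) := m in (i + j + k + l)%nat.

Definition dpoly (d : nat) (f : su2 -> R) : Prop :=
  exists p, (forall t, In t p -> (mdeg (snd t) <= d)%nat) /\
    forall g, is_su2 g -> f g = pval p (coords g).

Lemma dpoly_poly (d : nat) (f : su2 -> R) : dpoly d f -> is_poly f.
Proof. intros [p [_ H]]; now exists p. Qed.

Lemma dpoly_ext (d : nat) (f f' : su2 -> R) :
  (forall g, is_su2 g -> f g = f' g) -> dpoly d f -> dpoly d f'.
Proof. intros e [p [Hd Hp]]; exists p; split; [exact Hd|]; intros g Hg; now rewrite <- e, Hp. Qed.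

Lemma dpoly_le (d d' : nat) (f : su2 -> R) : (d <= d')%nat -> dpoly d f -> dpoly d' f.
Proof. intros le [p [Hd Hp]]; exists p; split; [|exact Hp]; intros t Ht; specialize (Hd t Ht); lia. Qed.

Lemma dpoly_const (c : R) : dpoly 0 (fun _ => c).
Proof.
  exists ((c, (0, 0, 0, 0)%nat) :: nil); split.
  - intros t [<-|[]]; simpl; lia.
  - intros g _; unfold pval, coords; simpl; ring.
Qed.

Lemma dpoly_plus (d : nat) (f f' : su2 -> R) : dpoly d f -> dpoly d f' -> dpoly d (fun g => f g + f' g).
Proof.
  intros [p [Hd Hp]] [p' [Hd' Hp']]; exists (p ++ p'); split.
  - intros t Ht; apply in_app_iff in Ht; destruct Ht; auto.
  - intros g Hg; rewrite Hp, Hp' by exact Hg; unfold pval; now rewrite lsum_app.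
Qed.

Lemma dpoly_mult (d d' : nat) (f f' : su2 -> R) :
  dpoly d f -> dpoly d' f' -> dpoly (d + d') (fun g => f g * f' g).
Proof.
  intros [p [Hd Hp]] [p' [Hd' Hp']]; exists (pmul p p'); split.
  - intros t Ht; apply in_flat_map in Ht; destruct Ht as [s [Hs Ht]].
    apply in_map_iff in Ht; destruct Ht as [s' [<- Hs']].
    specialize (Hd s Hs); specialize (Hd' s' Hs').
    destruct s as [r [[[i j] k] l]], s' as [r' [[[i' j'] k'] l']]; simpl in *; lia.
  - intros g Hg; now rewrite Hp, Hp', pval_mul by exact Hg.
Qed.

Lemma dpoly_scal (d : nat) (c : R) (f : su2 -> R) : dpoly d f -> dpoly d (fun g => c * f g).
Proof. intros Hf; exact (dpoly_mult 0 d _ _ (dpoly_const c) Hf). Qed.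

Lemma dpoly_pow (d n : nat) (f : su2 -> R) : dpoly d f -> dpoly (n * d) (fun g => f g ^ n).
Proof.
  intros Hf; induction n as [|n IH]; [exact (dpoly_const 1)|].
  exact (dpoly_mult d (n * d) _ _ Hf IH).
Qed.

Lemma dpoly_lin (a0 a1 a2 a3 : R) : dpoly 1 (fun g =>
  a0 * fst (fst g) + a1 * snd (fst g) + a2 * fst (snd g) + a3 * snd (snd g)).
Proof.
  exists ((a0, (1, 0, 0, 0)%nat) :: (a1, (0, 1, 0, 0)%nat) :: (a2, (0, 0, 1, 0)%nat)
    :: (a3, (0, 0, 0, 1)%nat) :: nil); split.
  - intros t Ht; simpl in Ht; repeat (destruct Ht as [<-|Ht]; [simpl; lia|]); destruct Ht.
  - intros g _; unfold pval, coords; simpl; ring.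
Qed.

Lemma dpoly_mval (m : mono) (y0 y1 y2 y3 : su2 -> R) :
  dpoly 1 y0 -> dpoly 1 y1 -> dpoly 1 y2 -> dpoly 1 y3 ->
  dpoly (mdeg m) (fun g => mval m (y0 g, y1 g, y2 g, y3 g)).
Proof.
  destruct m as [[[i j] k] l]; intros H0 H1 H2 H3; unfold mdeg, mval.
  apply (dpoly_pow _ i) in H0; apply (dpoly_pow _ j) in H1.
  apply (dpoly_pow _ k) in H2; apply (dpoly_pow _ l) in H3.
  rewrite Nat.mul_1_r in H0, H1, H2, H3.
  replace (i + j + k + l)%nat with (i + j + (k + l))%nat by lia.
  exact (dpoly_mult _ _ _ _ (dpoly_mult _ _ _ _ H0 H1) (dpoly_mult _ _ _ _ H2 H3)).
Qed.

Lemma dpoly_pval (d : nat) (p : list (R * mono)) (y0 y1 y2 y3 : su2 -> R) :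
  (forall t, In t p -> (mdeg (snd t) <= d)%nat) ->
  dpoly 1 y0 -> dpoly 1 y1 -> dpoly 1 y2 -> dpoly 1 y3 ->
  dpoly d (fun g => pval p (y0 g, y1 g, y2 g, y3 g)).
Proof.
  intros Hp H0 H1 H2 H3; induction p as [|t p IH].
  - apply (dpoly_le 0); [lia|exact (dpoly_const _)].
  - apply (dpoly_plus d (fun g => fst t * mval (snd t) (y0 g, y1 g, y2 g, y3 g))).
    + apply dpoly_scal, (dpoly_le (mdeg (snd t))); [apply Hp; now left|now apply dpoly_mval].
    + apply IH; intros s Hs; apply Hp; now right.
Qed.

(** Right translation is linear in the coordinates, so the degree does not grow. Hence right
    translations act by matrices in a basis of the polynomials of bounded degree. *)
Lemma dpoly_right (d : nat) (k : su2) (f : su2 -> R) : is_su2 k -> dpoly d f ->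
  dpoly d (fun g => f (su2_mul g k)).
Proof.
  intros Hk [p [Hd Hp]]; destruct k as [[a b] [c e]].
  apply (dpoly_ext d (fun g => pval p (coords (su2_mul g ((a, b), (c, e)))))).
  { intros g Hg; symmetry; apply Hp; now apply su2_mul_su2. }
  unfold coords; apply (dpoly_pval d p _ _ _ _ Hd).
  - apply (dpoly_ext 1 _ _) with (2 := dpoly_lin a (- b) (- c) (- e)).
    intros [[x0 x1] [x2 x3]] _; simpl; ring.
  - apply (dpoly_ext 1 _ _) with (2 := dpoly_lin b a (- e) c).
    intros [[x0 x1] [x2 x3]] _; simpl; ring.
  - apply (dpoly_ext 1 _ _) with (2 := dpoly_lin c e a (- b)).
    intros [[x0 x1] [x2 x3]] _; simpl; ring.
  - apply (dpoly_ext 1 _ _) with (2 := dpoly_lin e (- c) b a).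
    intros [[x0 x1] [x2 x3]] _; simpl; ring.
Qed.

(** * Complex polynomials and the entries of the spin representations *)

Definition cdpoly (d : nat) (f : su2 -> C) : Prop :=
  dpoly d (fun g => fst (f g)) /\ dpoly d (fun g => snd (f g)).

Lemma cdpoly_le (d d' : nat) (f : su2 -> C) : (d <= d')%nat -> cdpoly d f -> cdpoly d' f.
Proof. intros le [H1 H2]; split; eapply dpoly_le; eauto. Qed.

Lemma cdpoly_const (z : C) : cdpoly 0 (fun _ => z).
Proof. split; apply dpoly_const. Qed.

Lemma cdpoly_plus (d : nat) (f f' : su2 -> C) :
  cdpoly d f -> cdpoly d f' -> cdpoly d (fun g => Cplus (f g) (f' g)).
Proof. intros [H1 H2] [H1' H2']; split; [exact (dpoly_plus d _ _ H1 H1')|exact (dpoly_plus d _ _ H2 H2')]. Qed.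

Lemma cdpoly_opp (d : nat) (f : su2 -> C) : cdpoly d f -> cdpoly d (fun g => Copp (f g)).
Proof.
  intros [H1 H2]; split; [apply (dpoly_scal d (-1)) in H1|apply (dpoly_scal d (-1)) in H2];
  eapply dpoly_ext; [|exact H1| |exact H2]; intros; simpl; ring.
Qed.

Lemma cdpoly_conj (d : nat) (f : su2 -> C) : cdpoly d f -> cdpoly d (fun g => Cconj (f g)).
Proof.
  intros [H1 H2]; split; [exact H1|apply (dpoly_scal d (-1)) in H2].
  eapply dpoly_ext; [|exact H2]; intros; simpl; ring.
Qed.

Lemma cdpoly_mult (d d' : nat) (f f' : su2 -> C) :
  cdpoly d f -> cdpoly d' f' -> cdpoly (d + d') (fun g => Cmult (f g) (f' g)).
Proof.
  intros [H1 H2] [H1' H2']; split.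
  - assert (A := dpoly_mult _ _ _ _ H1 H1').
    assert (B := dpoly_scal _ (-1) _ (dpoly_mult _ _ _ _ H2 H2')).
    eapply dpoly_ext; [|exact (dpoly_plus _ _ _ A B)]; intros; simpl; ring.
  - exact (dpoly_plus _ _ _ (dpoly_mult _ _ _ _ H1 H2') (dpoly_mult _ _ _ _ H2 H1')).
Qed.

Lemma cdpoly_pow (n : nat) (f : su2 -> C) : cdpoly 1 f -> cdpoly n (fun g => cpow (f g) n).
Proof.
  intros Hf; induction n as [|n IH]; [exact (cdpoly_const _)|].
  exact (cdpoly_mult 1 n _ _ Hf IH).
Qed.

Lemma cdpoly_csum (d n : nat) (f : nat -> su2 -> C) : (forall r, (r < n)%nat -> cdpoly d (f r)) ->
  cdpoly d (fun g => csum (fun r => f r g) n).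
Proof.
  intros Hf; unfold csum.
  assert (H : forall r, In r (seq 0 n) -> cdpoly d (f r)).
  { intros r Hr; apply Hf; apply in_seq in Hr; lia. }
  clear Hf; induction (seq 0 n) as [|r s IH]; simpl.
  - apply (cdpoly_le 0); [lia|exact (cdpoly_const _)].
  - apply (cdpoly_plus d (f r)); [apply H; now left|apply IH; intros; apply H; now right].
Qed.

Lemma cdpoly_entries : cdpoly 1 (fun g => fst g) /\ cdpoly 1 (fun g => snd g).
Proof.
  split; split.
  - apply (dpoly_ext 1 _ _) with (2 := dpoly_lin 1 0 0 0); intros; simpl; ring.
  - apply (dpoly_ext 1 _ _) with (2 := dpoly_lin 0 1 0 0); intros; simpl; ring.
  - apply (dpoly_ext 1 _ _) with (2 := dpoly_lin 0 0 1 0); intros; simpl; ring.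
  - apply (dpoly_ext 1 _ _) with (2 := dpoly_lin 0 0 0 1); intros; simpl; ring.
Qed.

Lemma cdpoly_wigD (N k l : nat) : (l <= N)%nat -> cdpoly N (wigD N k l).
Proof.
  intros lN; destruct cdpoly_entries as [Ha Hb].
  apply (cdpoly_mult 0 N _ _ (cdpoly_const _)).
  assert (E : polyrep N k l = fun g => csum (fun r =>
    if andb (Nat.leb r k) (Nat.leb (k - r) l) then
      Cmult (Cmult (Cmult (Cmult (RtoC (binom (N - l) r * binom l (k - r)))
        (cpow (fst g) (N - l - r))) (cpow (snd g) r))
        (cpow (Copp (Cconj (snd g))) (l - (k - r)))) (cpow (Cconj (fst g)) (k - r))
    else RtoC 0) (S (N - l))) by (apply functional_extensionality; intros [a b]; reflexivity).
  rewrite E; apply cdpoly_csum; intros r Hr.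
  destruct (andb (Nat.leb r k) (Nat.leb (k - r) l)) eqn:B.
  - apply andb_prop in B; destruct B as [B1 B2].
    apply Nat.leb_le in B1; apply Nat.leb_le in B2.
    (* Under the guard no subtraction is truncated, and the four exponents add up to [N]. *)
    apply (cdpoly_le (0 + (N - l - r) + r + (l - (k - r)) + (k - r))); [lia|].
    apply (cdpoly_mult _ _ _ (fun g => cpow (Cconj (fst g)) (k - r)));
      [|now apply cdpoly_pow, cdpoly_conj].
    apply (cdpoly_mult _ _ _ (fun g => cpow (Copp (Cconj (snd g))) (l - (k - r))));
      [|now apply cdpoly_pow, cdpoly_opp, cdpoly_conj].
    apply (cdpoly_mult _ _ _ (fun g => cpow (snd g) r)); [|now apply cdpoly_pow].
    apply (cdpoly_mult 0 _ (fun _ => _)); [exact (cdpoly_const _)|now apply cdpoly_pow].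
  - apply (cdpoly_le 0); [lia|exact (cdpoly_const _)].
Qed.

Lemma pval_cons (t : R * mono) (p : list (R * mono)) (x : R * R * R * R) :
  pval (t :: p) x = fst t * mval (snd t) x + pval p x.
Proof. reflexivity. Qed.

(** At most [2 * (d + 1) ^ 3] monomials satisfy this. The growth is cubic and not quartic in the
    degree, which is the source of [Lam ^ 3] in the bound on [N]. *)
Definition reduced (d : nat) (m : mono) : Prop := let '(i, j, k, l) := m in
  (i <= 1 /\ j <= d /\ k <= d /\ l <= d)%nat.

(* Reduction of the powers of [x0] by [x0 ^ 2 = 1 - x1 ^ 2 - x2 ^ 2 - x3 ^ 2]. *)
Lemma mono_reduce (n i j k l : nat) : (i <= n)%nat -> exists p,
  (forall t, In t p -> reduced (i + j + k + l) (snd t)) /\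
  forall g, is_su2 g -> mval (i, j, k, l) (coords g) = pval p (coords g).
Proof.
  revert i j k l; induction n as [n IH] using Wf_nat.lt_wf_ind; intros i j k l Hi.
  destruct i as [|[|i]]; [ | | ].
  - exists ((1, (0, j, k, l)%nat) :: nil); split.
    + intros t [<-|[]]; simpl; lia.
    + intros g _; unfold pval; simpl; ring.
  - exists ((1, (1, j, k, l)%nat) :: nil); split.
    + intros t [<-|[]]; simpl; lia.
    + intros g _; unfold pval; simpl; ring.
  - destruct (IH i ltac:(lia) i j k l (le_n _)) as [p [Hp Ep]].
    destruct (IH i ltac:(lia) i (j + 2)%nat k l (le_n _)) as [p1 [Hp1 Ep1]].
    destruct (IH i ltac:(lia) i j (k + 2)%nat l (le_n _)) as [p2 [Hp2 Ep2]].
    destruct (IH i ltac:(lia) i j k (l + 2)%nat (le_n _)) as [p3 [Hp3 Ep3]].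
    set (neg := map (fun t : R * mono => (- fst t, snd t))).
    exists (p ++ neg p1 ++ neg p2 ++ neg p3); split.
    + assert (N : forall q t, In t (neg q) -> exists s, In s q /\ snd t = snd s).
      { intros q t Ht; apply in_map_iff in Ht; destruct Ht as [s [<- Hs]]; now exists s. }
      intros [r m] Ht; rewrite !in_app_iff in Ht; simpl snd.
      destruct Ht as [Ht|[Ht|[Ht|Ht]]].
      * specialize (Hp _ Ht); destruct m as [[[i' j'] k'] l']; unfold reduced in *; cbn [fst snd] in *; lia.
      * apply N in Ht; destruct Ht as [s [Hs e]]; specialize (Hp1 s Hs).
        rewrite <- e in Hp1; destruct m as [[[i' j'] k'] l']; unfold reduced in *; cbn [fst snd] in *; lia.
      * apply N in Ht; destruct Ht as [s [Hs e]]; specialize (Hp2 s Hs).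
        rewrite <- e in Hp2; destruct m as [[[i' j'] k'] l']; unfold reduced in *; cbn [fst snd] in *; lia.
      * apply N in Ht; destruct Ht as [s [Hs e]]; specialize (Hp3 s Hs).
        rewrite <- e in Hp3; destruct m as [[[i' j'] k'] l']; unfold reduced in *; cbn [fst snd] in *; lia.
    + intros g Hg.
      assert (N : forall q, pval (neg q) (coords g) = - pval q (coords g)).
      { intros q; unfold pval, neg; rewrite lsum_map.
        rewrite (lsum_ext _ (fun t => -1 * (fst t * mval (snd t) (coords g)))) by (intros; simpl; ring).
        rewrite lsum_scal; ring. }
      unfold pval at 1; rewrite !lsum_app.
      fold (pval p (coords g)); fold (pval (neg p1) (coords g));
      fold (pval (neg p2) (coords g)); fold (pval (neg p3) (coords g)).
      rewrite !N, <- Ep, <- Ep1, <- Ep2, <- Ep3 by exact Hg.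
      apply is_su2_coords in Hg; destruct g as [[x0 x1] [x2 x3]]; simpl in Hg |- *.
      rewrite !pow_add; simpl.
      transitivity (x0 ^ i * x1 ^ j * (x2 ^ k * x3 ^ l) * (x0 * (x0 * 1))); [ring|].
      replace (x0 * (x0 * 1)) with (1 - x1 * (x1 * 1) - x2 * (x2 * 1) - x3 * (x3 * 1)) by lra.
      ring.
Qed.

Lemma dpoly_reduce (d : nat) (f : su2 -> R) : dpoly d f -> exists p,
  (forall t, In t p -> reduced d (snd t)) /\
  forall g, is_su2 g -> f g = pval p (coords g).
Proof.
  intros [p [Hd Hp]].
  assert (H : exists q, (forall t, In t q -> reduced d (snd t)) /\
     forall g, is_su2 g -> pval p (coords g) = pval q (coords g)).
  { clear f Hp; induction p as [|[r [[[i j] k] l]] p IH].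
    - exists nil; split; [intros t []|reflexivity].
    - destruct IH as [q [Hq Eq]]; [intros; apply Hd; now right|].
      destruct (mono_reduce i i j k l (le_n _)) as [q' [Hq' Eq']].
      assert (D := Hd _ (or_introl eq_refl)); simpl in D.
      exists (map (fun t => (r * fst t, snd t)) q' ++ q); split.
      + intros t Ht; apply in_app_iff in Ht; destruct Ht as [Ht|Ht]; [|now apply Hq].
        apply in_map_iff in Ht; destruct Ht as [s [<- Hs]]; specialize (Hq' s Hs); simpl.
        destruct (snd s) as [[[i' j'] k'] l']; unfold reduced in *; cbn [fst snd] in *; lia.
      + intros g Hg; rewrite pval_cons; simpl fst; simpl snd; rewrite Eq' by exact Hg.
        rewrite Eq by exact Hg; unfold pval; rewrite lsum_app, lsum_map, <- lsum_scal.
        f_equal; apply lsum_ext; intros; simpl; ring. }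
  destruct H as [q [Hq Eq]]; exists q; split; [exact Hq|].
  intros g Hg; now rewrite Hp, Eq.
Qed.

From mathcomp Require all_boot all_order all_algebra ring zify lra boolp reals Rstruct complex.

Module AmplitudeBound.
Import all_boot all_order all_algebra.
Import ring zify lra boolp reals Rstruct complex.
Set Implicit Arguments. Unset Strict Implicit. Unset Printing Implicit Defensive.
Import Order.TTheory GRing.Theory Num.Theory.
Local Close Scope R_scope.

(** * Euler circuits *)

Section Involutions.
Variables (T : finType) (m t : T -> T).
Hypothesis (mK : involutive m) (tK : involutive t).
Hypothesis (mF : forall x, m x != x) (tF : forall x, t x != x).

(** One step along a circuit, with [t] for the corners and [m] for the lines: cross the corner, then
    follow the line. *)
Definition turn (x : T) : T := m (t x).

Lemma turn_inj : injective turn.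
Proof. exact: inj_comp (inv_inj mK) (inv_inj tK). Qed.

(** A path from [a] to [t a] could be shortened at both ends, until it exhibits a fixed point of [t]
    or of [m]. *)
Lemma iter_turn_neq i a : iter i turn a != t a.
Proof.
elim/ltn_ind: i a => -[|[|i]] IH a; first by rewrite eq_sym tF.
  exact: mF.
apply/eqP => e; have e' : iter i.+1 turn a = t (turn a).
  have : m (t (iter i.+1 turn a)) = t a by rewrite -[RHS]e.
  by move=> /(congr1 m); rewrite mK => /(congr1 t); rewrite tK.
by move: e'; rewrite iterSr => /eqP; apply/negP; apply: IH.
Qed.

Lemma iter_turn_disjoint i j a : iter i turn a != t (iter j turn a).
Proof.
case: (leqP i j) => [ij|/ltnW ij].
  rewrite -(subnK ij) iterD; apply/eqP => e.
  by have := iter_turn_neq (j - i) (iter i turn a); rewrite {2}e tK eqxx.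
by rewrite -(subnK ij) iterD; apply: iter_turn_neq.
Qed.

(** The orbit of [s0] and its image under [t], the circuit run backwards, are together closed under
    both involutions. *)
Lemma turn_cover s0 : (forall P : pred T, P s0 -> (forall x, P x -> P (m x) && P (t x)) -> forall x, P x) ->
  forall s, fconnect turn s0 s || fconnect turn s0 (t s).
Proof.
move=> cl; apply: cl => [|x /orP [h|h]]; first by rewrite connect0.
- rewrite tK h orbT andbT; apply/orP; right.
  have : fconnect turn s0 (finv turn x).
    exact: connect_trans h (fconnect_finv _ _).
  suff -> : finv turn x = t (m x) by [].
  by apply: turn_inj; rewrite (f_finv turn_inj) /turn tK mK.
- rewrite h /=; apply/andP; split => //; apply/orP; left.
  by apply: connect_trans h _; rewrite /turn; have := fconnect1 turn (t x); rewrite /turn tK.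
Qed.

(** The orbit and its [t]-image are disjoint by [iter_turn_disjoint], equipotent, and cover
    everything. *)
Lemma turn_order s0 : (forall s, fconnect turn s0 s || fconnect turn s0 (t s)) ->
  (2 * order turn s0)%N = #|T|.
Proof.
move=> cov; have -> : order turn s0 = #|fconnect turn s0| by [].
rewrite mul2n -addnn -{2}(card_image (inv_inj tK) (fconnect turn s0)).
rewrite -cardUI; rewrite [X in _ + X]eq_card0 ?addn0.
  apply: eq_card => s; rewrite !inE; apply/idP.
  have /orP [h|h] := cov s; first by apply/orP; left.
  by apply/orP; right; rewrite -[s]tK; apply: image_f.
move=> s; rewrite !inE; apply/negP => /andP [/iter_findex h /imageP [s' /iter_findex h' e]].
by have := iter_turn_disjoint (findex turn s0 s) (findex turn s0 s') s0; rewrite h h' e eqxx.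
Qed.

End Involutions.

Section Pairing.

(* The pairing [02|13] is left out: these slots share no variable at a pillow vertex. *)
Definition partner (b : bool) (a : 'I_4) : 'I_4 :=
  if b then rev_ord a else inord (if odd a then a.-1 else a.+1).

Lemma partnerE b (a : 'I_4) : partner b a = (if b then 3 - a else if odd a then a.-1 else a.+1) :> nat.
Proof.
rewrite /partner; case: b => //=.
by rewrite inordK //; case: a => [[|[|[|[|]]]]].
Qed.

Lemma partnerK b : involutive (partner b).
Proof.
by move=> a; apply: val_inj; rewrite /= !partnerE; case: b; case: a => [[|[|[|[|]]]]].
Qed.

Lemma partner_neq b a : partner b a != a.
Proof. by rewrite -val_eqE /= partnerE; case: b; case: a => [[|[|[|[|]]]]]. Qed.

(** The other pairing sends [a] into the pair not containing it, hence to [a'] or to the old partner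
    of [a']. This is how a flip joins two circuits. *)
Lemma partner_flip b (a a' : 'I_4) : a' != a -> a' != partner b a ->
  partner (~~ b) a = a' \/ partner (~~ b) a = partner b a'.
Proof.
move=> h h'; suff : (partner (~~ b) a == a') || (partner (~~ b) a == partner b a').
  by case/orP => /eqP; auto.
move: h h'; rewrite -!val_eqE /= !partnerE.
by case: b; case: a => [[|[|[|[|?]]]] ?] //; case: a' => [[|[|[|[|?]]]] ?].
Qed.

End Pairing.

Section EulerCircuit.
Variables (n : nat) (mate : 'I_n * 'I_4 -> 'I_n * 'I_4).
Notation S := ('I_n * 'I_4)%type.
Hypothesis mateK : involutive mate.
Hypothesis mateF : forall s, mate s != s.
Hypothesis mate_connected : forall P : pred 'I_n, (exists v, P v) ->
  (forall v a, P v -> P (mate (v, a)).1) -> forall v, P v.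

Implicit Types (c : {ffun 'I_n -> bool}) (s : S).

Definition opposite c s : S := (s.1, partner (c s.1) s.2).

Lemma oppositeK c : involutive (opposite c).
Proof. by case=> v a; rewrite /opposite /= partnerK. Qed.

Lemma oppositeF c s : opposite c s != s.
Proof. by case: s => v a; rewrite xpair_eqE eqxx partner_neq. Qed.

Definition link c : rel S := fun s s' => (s' == mate s) || (s' == opposite c s).

Lemma link_sym c : symmetric (link c).
Proof.
move=> s s'; rewrite /link [s' == mate s]eq_sym (inv_eq mateK).
by rewrite [s' == opposite c s]eq_sym (inv_eq (oppositeK c)).
Qed.

Lemma connect_link_sym c : connect_sym (link c).
Proof. by apply: sym_connect_sym; apply: link_sym. Qed.

Lemma connect_mate c s : connect (link c) s (mate s).
Proof. by apply: connect1; rewrite /link eqxx. Qed.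

Lemma connect_opposite c s : connect (link c) s (opposite c s).
Proof. by apply: connect1; rewrite /link eqxx orbT. Qed.

Definition flip c v := [ffun w => if w == v then ~~ c w else c w].

Lemma opposite_flip c v s : s.1 != v -> opposite (flip c v) s = opposite c s.
Proof. by move=> sv; rewrite /opposite ffunE (negPf sv). Qed.

(* If a circuit passes only once through [v], then it remains a path after the corner
   [{(v, a), opposite c (v, a)}] is removed. *)
Lemma flip_detour c v a b : connect (link c) (v, a) (v, b) = false ->
  connect (link (flip c v)) (opposite c (v, a)) (v, a).
Proof.
move=> nb; pose f := turn mate (opposite c); set x := (v, a).
have fI : injective f by apply: turn_inj mateK (oppositeK c).
have xf i : connect (link c) x (iter i f x).
  elim: i => //= i IH; apply: connect_trans IH _.
  exact: connect_trans (connect_opposite _ _) (connect_mate _ _).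
(* A second passage through [v] would put all four of its slots, in particular [b], on the circuit
   of [(v, a)]. *)
have off i : 0 < i < order f x -> (iter i f x).1 != v.
  move=> /andP [i0 io]; apply/eqP => e.
  case E : (iter i f x) e => [v' a'] /= e; subst v'.
  have a'a : a' != a.
    apply/eqP => e; subst a'.
    have := @nth_uniq _ x (traject f x (order f x)) i 0.
    rewrite !size_traject io order_gt0 => /(_ isT isT (orbit_uniq f x)).
    by rewrite !nth_traject ?order_gt0 //= E eqxx => /esym /eqP i00; rewrite i00 in i0.
  have a'p : a' != partner (c v) a.
    apply/eqP => e; subst a'.
    by have := iter_turn_neq mateK (oppositeK c) mateF (oppositeF c) i x; rewrite E eqxx.
  have ba : b != a by apply/eqP => e; rewrite e connect0 in nb.
  have bp : b != partner (c v) a.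
    by apply/eqP => e; move: nb; rewrite e (connect_opposite c x).
  have ba' : b != a' by apply/eqP => e; move: nb; rewrite e -E xf.
  have bpa' : b != partner (c v) a'.
    apply/eqP => e; suff : connect (link c) x (v, b) by rewrite nb.
    by rewrite e; apply: connect_trans (xf i) _; rewrite E; apply: (connect_opposite c (v, a')).
  move: a'a a'p ba bp ba' bpa'; rewrite -!val_eqE /= !partnerE.
  by case: (c v); case: (a) => [[|[|[|[|?]]]] ?] //; case: a' {E} => [[|[|[|[|?]]]] ?] //;
     case: (b) => [[|[|[|[|?]]]] ?].
have key i : i < order f x -> connect (link (flip c v)) (opposite c x) (iter i.+1 f x).
  elim: i => [|i IH] io; first exact: connect_mate.
  apply: connect_trans (IH (ltnW io)) _; rewrite [iter i.+2 _ _]iterS.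
  set y := iter i.+1 f x; rewrite /f /turn -(@opposite_flip c v y); last by apply: off.
  exact: connect_trans (connect_opposite _ _) (connect_mate _ _).
have ox : 0 < order f x by rewrite order_gt0.
have := key (order f x).-1; rewrite prednK // leqnn => /(_ isT).
by rewrite iter_order.
Qed.

(** The pairing [c] maximizes the circuit through [s0]. If no vertex is split between circuits, the
    vertices met are closed under lines and connectedness gives all of them. At a split vertex, a
    flip would enlarge the circuit. *)
Lemma euler_pairing (s0 : S) : exists c, forall s, connect (link c) s0 s.
Proof.
pose cls c := [set s | connect (link c) s0 s].
have [c _ cmax] := @arg_maxnP _ [ffun=> false] xpredT (fun c => #|cls c|) isT.
exists c; suff /setP H : cls c = setT by move=> s; have := H s; rewrite !inE.
have [/existsP [v /existsP [a /existsP [b /andP [va vb]]]]|mixed] := boolP [exists v, [exists a, [exists b,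
    (connect (link c) s0 (v, a)) && ~~ connect (link c) s0 (v, b)]]]; last first.
  have full v a b : connect (link c) s0 (v, a) -> connect (link c) s0 (v, b).
    move=> va; apply: contraR mixed => vb.
    by apply/existsP; exists v; apply/existsP; exists a; apply/existsP; exists b; rewrite va vb.
  pose P v := [exists a, connect (link c) s0 (v, a)].
  have PT : forall v, P v.
    apply: mate_connected => [|v a /existsP [b vb]].
      by exists s0.1; apply/existsP; exists s0.2; rewrite -surjective_pairing connect0.
    apply/existsP; exists (mate (v, a)).2; rewrite -surjective_pairing.
    exact: connect_trans (full _ _ a vb) (connect_mate _ _).
  by apply/setP => -[v a]; rewrite !inE; have /existsP [b /full] := PT v; apply.
have nb : connect (link c) (v, a) (v, b) = false.
  by apply: contraNF vb; apply: connect_trans.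
have npb : ~~ connect (link c) s0 (v, partner (c v) b).
  apply: contra vb => h; apply: connect_trans h _.
  by rewrite connect_link_sym; apply: (connect_opposite c (v, b)).
have det := flip_detour nb.
(* The circuit has a single corner at [v], so this is the only corner that rerouting must
   replace. *)
have inv a' : connect (link c) s0 (v, a') -> (a' == a) || (a' == partner (c v) a).
  move=> va'; apply/negPn/negP; rewrite negb_or => /andP [h h'].
  have hb : b != a by apply: contraNneq vb => ->.
  have hb' : b != partner (c v) a.
    by apply: contraNneq vb => ->; apply: connect_trans va (connect_opposite c (v, a)).
  have ha : a' != b by apply: contraNneq vb => <-.
  have ha' : a' != partner (c v) b by apply: contraNneq npb => <-.
  move: h h' hb hb' ha ha'; rewrite -!val_eqE /= !partnerE; clear.
  by case: (c v); case: a => [[|[|[|[|?]]]] ?] //; case: a' => [[|[|[|[|?]]]] ?] //;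
     case: b => [[|[|[|[|?]]]] ?].
have sub p s : connect (link c) s0 s -> connect (link (flip c v)) s0 s -> path (link c) s p ->
    connect (link (flip c v)) s0 (last s p).
  elim: p s => //= y p IH s cs fs /andP [sy]; apply: IH.
    by apply: connect_trans cs _; apply: connect1.
  apply: connect_trans fs _; case/orP: sy => /eqP ->; first exact: connect_mate.
  have [sv|sv] := eqVneq s.1 v; last by rewrite -(opposite_flip c sv); apply: connect_opposite.
  case: s sv cs => v' a' /= -> /inv /orP [] /eqP ->.
    by rewrite connect_link_sym; apply: det.
  by have := det; rewrite /opposite /= partnerK.
(* Rerouting keeps every slot reached before, and the new partner of [(v, a)] is gained. *)
have lt : #|cls c| < #|cls (flip c v)|.
  apply: proper_card; apply/properP; split.
    apply/subsetP => s; rewrite !inE => /connectP [p ps ->].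
    by apply: sub ps => //; apply: connect0.
  exists (opposite (flip c v) (v, a)).
    rewrite inE; apply: connect_trans (connect_opposite _ _).
    have /connectP [p ps e] := va; rewrite e; by apply: sub ps => //; apply: connect0.
  rewrite inE /opposite /= ffunE eqxx.
  have ba : b != a by apply: contraNneq vb => ->.
  have bp : b != partner (c v) a.
    by apply: contraNneq vb => ->; apply: connect_trans va (connect_opposite c (v, a)).
  by have [->|->] := partner_flip ba bp.
by have := leq_trans lt (cmax (flip c v) isT); rewrite ltnn.
Qed.

(** The component of [s0] as an orbit of [turn]: half of the [4 * n] slots are entered, the others
    are their opposites, so the period is [2 * n]. *)
Lemma euler_circuit (s0 : S) : exists c,
  let f := turn mate (opposite c) in
  [/\ iter (2 * n) f s0 = s0, forall s, (exists2 i, i < 2 * n & s = iter i f s0) \/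
    (exists2 i, i < 2 * n & s = opposite c (iter i f s0)) &
  forall i j, i < 2 * n -> j < 2 * n -> iter i f s0 = iter j f s0 -> i = j].
Proof.
have [c Hc] := euler_pairing s0; exists c => f.
have cov : forall s, fconnect f s0 s || fconnect f s0 (opposite c s).
  apply: turn_cover mateK (oppositeK c) _ _ => P P0 Pcl s.
  have /connectP [p ps ->] := Hc s.
  elim: p s0 P0 ps {Hc} => //= y p IH x Px /andP [xy]; apply: IH.
  by have /andP [Pm Po] := Pcl _ Px; case/orP: xy => /eqP ->.
have o2 : order f s0 = 2 * n.
  have := turn_order mateK (oppositeK c) mateF (oppositeF c) cov.
  by rewrite card_prod !card_ord -/f; lia.
have fI : injective f by apply: turn_inj mateK (oppositeK c).
split.
- by rewrite -o2 iter_order.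
- move=> s; have /orP [h|h] := cov s.
    by left; exists (findex f s0 s); rewrite ?iter_findex // -o2 findex_max.
  by right; exists (findex f s0 (opposite c s)); rewrite ?iter_findex ?oppositeK // -o2 findex_max.
- move=> i j i2 j2 e; have := @nth_uniq _ s0 (traject f s0 (order f s0)) i j.
  rewrite !size_traject o2 i2 j2 => /(_ isT isT).
  by rewrite -{1}o2 => /(_ (orbit_uniq f s0)); rewrite !nth_traject // e eqxx => /esym /eqP.
Qed.

End EulerCircuit.

Local Open Scope ring_scope.

(** * Bounds on words of operators *)

Section Norm.
Variable F : numClosedFieldType.

Definition nrm2 (J : finType) (u : J -> F) : F := \sum_j `|u j| ^+ 2.

Lemma nrm2_ge0 (J : finType) (u : J -> F) : 0 <= nrm2 u.
Proof. by apply: sumr_ge0 => j _; rewrite exprn_ge0. Qed.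

Lemma eq_nrm2 (J : finType) (u v : J -> F) : u =1 v -> nrm2 u = nrm2 v.
Proof. by move=> e; apply: eq_bigr => j _; rewrite e. Qed.

Lemma nrm2E (J : finType) (u : J -> F) : nrm2 u = \sum_j u j * (u j)^*.
Proof. by apply: eq_bigr => j _; rewrite normCK. Qed.

(** For the bilinear pairing: expand the nonnegative squared norm of [nrm2 v * u - s * conj v],
    where [s] is the sum to be bounded. *)
Lemma cauchy_schwarz (J : finType) (u v : J -> F) :
  `|\sum_j u j * v j| ^+ 2 <= nrm2 u * nrm2 v.
Proof.
have [v0|v0] := eqVneq (nrm2 v) 0.
  have vj j : v j = 0.
    move/eqP: v0; rewrite psumr_eq0 => [/allP /(_ j)|i _]; last by rewrite exprn_ge0.
    by rewrite mem_index_enum sqrf_eq0 normr_eq0 => /(_ isT) /eqP.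
  rewrite big1 ?normr0 ?expr0n ?mulr_ge0 ?nrm2_ge0 //.
  by move=> j _; rewrite vj mulr0.
have vp : 0 < nrm2 v by rewrite lt_neqAle eq_sym v0 nrm2_ge0.
pose s := \sum_j u j * v j.
have : 0 <= nrm2 (fun j => nrm2 v * u j - s * (v j)^*) by exact: nrm2_ge0.
have -> : nrm2 (fun j => nrm2 v * u j - s * (v j)^*) =
    nrm2 v * (nrm2 v * nrm2 u - `|s| ^+ 2).
  have nv : (nrm2 v)^* = nrm2 v by apply: geC0_conj; apply: nrm2_ge0.
  have -> : nrm2 (fun j => nrm2 v * u j - s * (v j)^*) =
    \sum_j (nrm2 v * nrm2 v * (u j * (u j)^*) - nrm2 v * s^* * (u j * v j)
       - nrm2 v * s * (u j * v j)^* + s * s^* * (v j * (v j)^*)).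
    rewrite nrm2E; apply: eq_bigr => j _.
    rewrite !rmorphB !rmorphM /= nv conjCK; ring.
  rewrite !big_split /= !sumrN -!big_distrr /= -rmorph_sum /= -!nrm2E -/s.
  rewrite normCK; ring.
by rewrite pmulr_rge0 // subr_ge0 mulrC.
Qed.

End Norm.

(** * Words of labelled operators in which every vertex occurs twice *)

Section Chord.
Variables (F : numClosedFieldType) (V X J : finType).
Implicit Types (u : J -> F) (x : {ffun V -> X}).

Definition kapp (K : J -> J -> F) (u : J -> F) : J -> F := fun i => \sum_j K i j * u j.

Definition letter : Type := (V * (X -> J -> J -> F))%type.
Implicit Types (w : seq letter).

Definition capply w x u : J -> F := foldr (fun l => kapp (l.2 (x l.1))) u w.

Definition upd x v c : {ffun V -> X} := [ffun v' => if v' == v then c else x v'].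

Lemma updE x v c v' : upd x v c v' = if v' == v then c else x v'.
Proof. by rewrite ffunE. Qed.

(** Operators act from the right end of the word. The first one at a vertex leaves its label open,
    as an argument through [x]; the second one sums over it at once. Thus [state] depends only on
    the labels of the open vertices. *)
Fixpoint state w u x : J -> F :=
  if w is l :: w' then
    if l.1 \in map fst w' then fun i => \sum_c kapp (l.2 c) (state w' u (upd x l.1 c)) i
    else kapp (l.2 (x l.1)) (state w' u x)
  else u.

Definition occ w v := count_mem v (map fst w).

Lemma kapp_sum (I : Type) (r : seq I) (P : pred I) (K : J -> J -> F) (f : I -> J -> F) i :
  kapp K (fun j => \sum_(k <- r | P k) f k j) i = \sum_(k <- r | P k) kapp K (f k) i.
Proof. by rewrite /kapp exchange_big; apply: eq_bigr => j _; rewrite big_distrr. Qed.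

Lemma eq_kapp (K : J -> J -> F) u u' : u =1 u' -> kapp K u =1 kapp K u'.
Proof. by move=> e i; apply: eq_bigr => j _; rewrite e. Qed.

(** Exchanging [x v] with [c] is an involution on the pairs [(x, c)]; after it the summand no longer
    depends on [c]. *)
Lemma sum_upd v (G : {ffun V -> X} -> F) :
  \sum_x \sum_c G (upd x v c) = #|X|%:R * \sum_x G x.
Proof.
rewrite pair_big /=.
pose h (z : {ffun V -> X} * X) := (upd z.1 v z.2, z.1 v).
have hK : involutive h.
  move=> [x c]; rewrite /h /= !updE eqxx; congr (_, _).
  by apply/ffunP => v'; rewrite !updE; case: eqP => // ->.
rewrite (reindex h) /=; last by apply: onW_bij; exists h.
have E z : G (upd (upd z.1 v z.2) v (z.1 v)) = G z.1.
  congr (G _); have := hK z; case: z => x c /=; rewrite /h /= => -[].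
  by [].
under eq_bigr do rewrite E.
rewrite -(pair_big xpredT xpredT (fun x (_ : X) => G x)) /= big_distrr /=.
by apply: eq_bigr => x _; rewrite sumr_const mulr_natl.
Qed.

Lemma state_upd w u x v c : v \notin map fst w -> state w u (upd x v c) =1 state w u x.
Proof.
elim: w x => //= l w IH x; rewrite inE negb_or => /andP [vl vw] i.
have e c' : upd (upd x v c) l.1 c' = upd (upd x l.1 c') v c.
  by apply/ffunP => v'; rewrite !updE; case: (v' =P l.1) => // ->; rewrite eq_sym (negPf vl).
case: ifP => _.
  by apply: eq_bigr => c' _; rewrite e; apply: eq_kapp; apply: IH.
rewrite updE eq_sym (negPf vl); apply: eq_kapp; exact: IH.
Qed.

(** The labels not yet summed by [state] are those of vertices with fewer than two occurrences in
    [w]. *)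
Definition agree w x x' := [forall v, (occ w v < 2) ==> (x' v == x v)]%N.

Lemma stateE w u x i : (forall v, occ w v <= 2)%N ->
  state w u x i = \sum_(x' | agree w x x') capply w x' u i.
Proof.
elim: w x i => [|l w IH] x i le2 /=.
  rewrite (big_pred1 x) // => x'; apply/forallP/eqP => [H|-> v]; last by rewrite eqxx implybT.
  by apply/ffunP => v; have /eqP := H v.
have le2' v : (occ w v <= 2)%N by have := le2 v; rewrite /occ /=; lia.
case: ifPn => lw.
  rewrite (partition_big (fun x' : {ffun V -> X} => x' l.1) xpredT) //=.
  apply: eq_bigr => c _.
  rewrite (eq_kapp _ (IH _ ^~ le2')) kapp_sum; apply: eq_big => [x'|x'].
    apply/forallP/andP => [H|[/forallP H /eqP xc] v].
      have xc : x' l.1 == c.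
        have := H l.1; have := le2 l.1; rewrite /occ /= eqxx add1n ltnS => -> /=.
        by rewrite updE eqxx.
      split=> //; apply/forallP => v; have [->|vl] := eqVneq v l.1.
        have := lw; rewrite -has_pred1 has_count => cw.
        by rewrite /occ /= eqxx add1n ltnNge ltnS cw.
      by have := H v; rewrite /occ /= [l.1 == v]eq_sym (negPf vl) updE (negPf vl).
    have [->|vl] := eqVneq v l.1.
      by rewrite updE eqxx xc eqxx implybT.
    by have := H v; rewrite /occ /= [l.1 == v]eq_sym (negPf vl) updE (negPf vl).
  move=> /forallP H; suff -> : x' l.1 = c by [].
  have := H l.1; have := le2 l.1; rewrite /occ /= eqxx add1n ltnS => -> /=.
  by rewrite updE eqxx => /eqP.
rewrite (eq_kapp _ (IH _ ^~ le2')) kapp_sum; apply: eq_big => [x'|x' /forallP H].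
  apply/forallP/forallP => H v; have := H v; rewrite /occ /=;
  case: (l.1 =P v) => // e; subst v; move: lw; rewrite -has_pred1 has_count -leqNgt leqn0 => /eqP ->;
  by rewrite ?addn0.
have := H l.1; move: lw; rewrite /occ -has_pred1 has_count -leqNgt leqn0 => /eqP ->.
by move=> /eqP ->.
Qed.

Variable N : F.
(** The operators [B c] stacked in a column, then set side by side in a row: in both cases the
    squared operator norm is at most [N]. *)
Definition opening_bound (B : X -> J -> J -> F) :=
  forall u, \sum_c nrm2 (kapp (B c) u) <= N * nrm2 u.
Definition closing_bound (B : X -> J -> J -> F) :=
  forall f : X -> J -> F, nrm2 (fun i => \sum_c kapp (B c) (f c) i) <= N * \sum_c nrm2 (f c).

Fixpoint closings w : nat := if w is l :: w' then (l.1 \in map fst w') + closings w' else 0.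

(** The sum over all [x] also runs over labels on which [state] does not depend. Passing between
    this redundant sum and a genuine sum over one label costs [#|X|] by [sum_upd]: a power on the
    left for every opening and one on the right for every closing. *)
Lemma state_bound w u : 0 <= N ->
  (forall v B, List.In (v, B) w -> opening_bound B /\ closing_bound B) ->
  #|X|%:R ^+ (size w - closings w) * \sum_x nrm2 (state w u x) <=
  N ^+ size w * #|X|%:R ^+ (closings w) * (#|{ffun V -> X}|%:R * nrm2 u).
Proof.
move=> N0; elim: w => [_|[v B] w IH Hw] /=.
  by rewrite !expr0 !mul1r sumr_const mulr_natl.
have {}IH := IH (fun v B i => Hw v B (or_intror i)).
have [ob cb] := Hw v B (or_introl erefl).
set S := \sum_x _ in IH; set q : F := #|X|%:R in IH *.
have q0 : 0 <= q by apply: ler0n.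
have clw : (closings w <= size w)%N.
  by elim: (w) => //= l w' IHw; case: (_ \in _) => /=; rewrite ?add0n ?add1n ?ltnS // ltnW.
have [vw|vw] := boolP (v \in map fst w).
  rewrite add1n subSS [N ^+ _]exprS [q ^+ (closings w).+1]exprS.
  have le : \sum_x nrm2 (fun i => \sum_c kapp (B c) (state w u (upd x v c)) i) <= N * (q * S).
    rewrite /S /q -(sum_upd v) big_distrr /=; apply: ler_sum => x _; exact: cb.
  apply: (le_trans (ler_wpM2l (exprn_ge0 _ q0) le)).
  rewrite (_ : q ^+ _ * _ = N * q * (q ^+ (size w - closings w) * S)); last by ring.
  rewrite (_ : N * _ * _ * _ = N * q * (N ^+ size w * q ^+ closings w * (#|{ffun V -> X}|%:R * nrm2 u)));
    last by ring.
  by apply: ler_wpM2l => //; rewrite mulr_ge0.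
rewrite add0n subSn // [N ^+ _]exprS [q ^+ _.+1]exprSr.
have le : q * \sum_(x : {ffun V -> X}) nrm2 (kapp (B (x v)) (state w u x)) <= N * S.
  rewrite /q -(sum_upd v) /S big_distrr /=; apply: ler_sum => x _.
  apply: le_trans (ob _); rewrite le_eqVlt; apply/orP; left; apply/eqP.
  apply: eq_bigr => c _; apply: eq_nrm2 => i; rewrite updE eqxx; apply: eq_kapp.
  exact: state_upd.
rewrite -mulrA; apply: (le_trans (ler_wpM2l (exprn_ge0 _ q0) le)).
rewrite mulrCA -!mulrA; apply: ler_wpM2l => //; move: IH; by rewrite -!mulrA.
Qed.

(* Weighting the sum over the labels of not yet visited vertices uniformly, the first visit of a
   vertex costs [N / #|X|] and the second one [N * #|X|]. *)
Lemma chord_bound w u : 0 <= N -> (0 < #|X|)%N -> (forall v, occ w v = 2)%N ->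
  (forall v B, List.In (v, B) w -> opening_bound B /\ closing_bound B) ->
  nrm2 (fun i => \sum_x capply w x u i) <= N ^+ (2 * #|V|) * nrm2 u.
Proof.
move=> N0 X0 w2 Hw.
have szw : size w = (2 * #|V|)%N.
  have -> : size w = \sum_(v : V) occ w v.
    rewrite -(size_map fst); rewrite /occ; elim: (map fst w) => [|v s IH] /=; first by rewrite big1.
    rewrite big_split /= -IH -add1n; congr (_ + _)%N.
    by rewrite (bigD1 v) //= eqxx big1 // => v' /negPf; rewrite eq_sym => ->.
  by under eq_bigr do rewrite w2; rewrite sum_nat_const mulnC.
have clw : closings w = #|V|.
  have : (closings w + size (undup (map fst w)) = size w)%N.
    elim: (w) => //= l w' <-; case: ifP => _ /=; lia.
  have -> : size (undup (map fst w)) = #|V|.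
    rewrite -(card_uniqP (undup_uniq _)); apply: eq_card => v.
    by rewrite mem_undup -has_pred1 has_count -/(occ w v) w2.
  lia.
have [x0 _] : exists x0 : {ffun V -> X}, true.
  by case/card_gt0P: X0 => c _; exists [ffun=> c].
have st x : state w u x =1 fun i => \sum_x' capply w x' u i.
  move=> i; rewrite stateE => [|v]; last by rewrite w2.
  by apply: eq_bigl => x'; apply/forallP => v; rewrite w2.
have := state_bound u N0 Hw.
under eq_bigr do rewrite (eq_nrm2 (st _)).
rewrite sumr_const -[nrm2 _ *+ _]mulr_natl clw szw (_ : 2 * #|V| - #|V| = #|V|)%N; last by lia.
set n := nrm2 _; set q : F := #|X|%:R; set Q := (#|{ffun V -> X}|%:R : F).
have qp : 0 < q by rewrite ltr0n.
have Qp : 0 < Q by rewrite ltr0n; apply/card_gt0P; exists x0.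
move=> H; rewrite -(ler_pM2r (mulr_gt0 (exprn_gt0 #|V| qp) Qp)).
rewrite (_ : n * _ = q ^+ #|V| * (Q * n)); last by ring.
by apply: le_trans H _; rewrite le_eqVlt; apply/orP; left; apply/eqP; ring.
Qed.
End Chord.

Section Adjoint.
Variables (F : numClosedFieldType) (X J : finType).

Definition adjoint (B : X -> J -> J -> F) (c : X) (i j : J) : F := (B c j i)^*.

(** Duality: [nrm2 y] is the pairing of [f] with the family of adjoints applied to [y].
    Cauchy-Schwarz and division by [nrm2 y] give the claim. *)
Lemma closing_bound_adjoint (N : F) (B : X -> J -> J -> F) : 0 <= N ->
  opening_bound N (adjoint B) -> closing_bound N B.
Proof.
move=> N0 ob f; set y := fun i => \sum_c kapp (B c) (f c) i.
have [->|y0] := eqVneq (nrm2 y) 0.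
  by rewrite mulr_ge0 // sumr_ge0 // => c _; apply: nrm2_ge0.
have yp : 0 < nrm2 y by rewrite lt_neqAle eq_sym y0 nrm2_ge0.
have e : nrm2 y = \sum_(z : X * J) f z.1 z.2 * (kapp (adjoint B z.1) y z.2)^*.
  rewrite -(pair_bigA _ (fun c j => f c j * (kapp (adjoint B c) y j)^*)) /= nrm2E.
  rewrite [RHS](eq_bigr (fun c => \sum_i \sum_j B c i j * f c j * (y i)^*)); last first.
    move=> c _; rewrite [RHS]exchange_big /=; apply: eq_bigr => j _.
    rewrite rmorph_sum /= big_distrr /=; apply: eq_bigr => i _.
    by rewrite rmorphM /adjoint /= conjCK; ring.
  rewrite exchange_big /=; apply: eq_bigr => i _.
  rewrite {1}/y big_distrl /=; apply: eq_bigr => c _.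
  by rewrite /kapp big_distrl.
have := cauchy_schwarz (fun z : X * J => f z.1 z.2) (fun z => (kapp (adjoint B z.1) y z.2)^*).
rewrite -e ger0_norm ?nrm2_ge0 //.
have -> : nrm2 (fun z : X * J => f z.1 z.2) = \sum_c nrm2 (f c).
  by rewrite /nrm2 pair_big.
have -> : nrm2 (fun z : X * J => (kapp (adjoint B z.1) y z.2)^*) =
    \sum_c nrm2 (kapp (adjoint B c) y).
  rewrite /nrm2 pair_big /=; apply: eq_bigr => z _.
  by rewrite norm_conjC.
move=> H; rewrite -(ler_pM2r yp) -expr2.
apply: le_trans H _; rewrite [N * _]mulrC -mulrA.
by apply: ler_wpM2l (ob y); rewrite sumr_ge0 // => c _; apply: nrm2_ge0.
Qed.

End Adjoint.

(** * Orthonormal families of coefficient tensors *)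

Section Orthonormal.
Variables (F : numClosedFieldType) (T : finType).

Definition dot (u v : T -> F) : F := \sum_t u t * (v t)^*.

Definition orthonormal (d : nat) (E : 'I_d -> T -> F) : Prop :=
  forall a b, dot (E a) (E b) = (a == b)%:R.

Lemma dotC (u v : T -> F) : (dot u v)^* = dot v u.
Proof. by rewrite rmorph_sum; apply: eq_bigr => t _; rewrite rmorphM /= conjCK mulrC. Qed.

Lemma dot_nrm2 (u : T -> F) : dot u u = nrm2 u.
Proof. by rewrite nrm2E. Qed.

Lemma dot_suml (I : Type) (r : seq I) (c : I -> F) (f : I -> T -> F) (v : T -> F) :
  dot (fun t => \sum_(i <- r) c i * f i t) v = \sum_(i <- r) c i * dot (f i) v.
Proof.
rewrite /dot; under eq_bigr do rewrite big_distrl.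
rewrite exchange_big; apply: eq_bigr => i _; rewrite big_distrr.
by apply: eq_bigr => t _ /=; rewrite mulrA.
Qed.

Lemma dotDl (u u' v : T -> F) : dot (fun t => u t + u' t) v = dot u v + dot u' v.
Proof. by rewrite -big_split; apply: eq_bigr => t _ /=; rewrite mulrDl. Qed.

Lemma dotZl (c : F) (u v : T -> F) : dot (fun t => c * u t) v = c * dot u v.
Proof. by rewrite big_distrr; apply: eq_bigr => t _ /=; rewrite mulrA. Qed.

Lemma eq_dot (u u' v v' : T -> F) : u =1 u' -> v =1 v' -> dot u v = dot u' v'.
Proof. by move=> e e'; apply: eq_bigr => t _; rewrite e e'. Qed.

Lemma orthonormal_card (d : nat) (E : 'I_d -> T -> F) : orthonormal E -> (d <= #|T|)%N.
Proof.
move=> oE; pose A := \matrix_(a < d, t < #|T|) E a (enum_val t).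
pose B := \matrix_(t < #|T|, a < d) (E a (enum_val t))^*.
apply: (@mulmx1_min _ _ _ A B); apply/matrixP => a b; rewrite !mxE -oE.
rewrite /dot (reindex _ (onW_bij _ (@enum_val_bij T))) /=.
by apply: eq_bigr => t _; rewrite !mxE.
Qed.

Section Family.
Variables (d : nat) (E : 'I_d -> T -> F).
Hypothesis oE : orthonormal E.

Lemma dot_orthonormal_sum (c : 'I_d -> F) b : dot (fun t => \sum_a c a * E a t) (E b) = c b.
Proof.
rewrite dot_suml (bigD1 b) //= oE eqxx mulr1 big1 ?addr0 // => a /negPf ab.
by rewrite oE ab mulr0.
Qed.

Lemma nrm2_orthonormal_sum (c : 'I_d -> F) : nrm2 (fun t => \sum_a c a * E a t) = nrm2 c.
Proof.
rewrite -dot_nrm2 dot_suml nrm2E; apply: eq_bigr => a _; congr (_ * _).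
by rewrite -dotC dot_orthonormal_sum.
Qed.

Lemma bessel (u : T -> F) : \sum_a `|dot u (E a)| ^+ 2 <= nrm2 u.
Proof.
pose c a := dot u (E a).
have := nrm2_ge0 (fun t => u t + (-1) * \sum_a c a * E a t).
rewrite -dot_nrm2 dotDl dotZl.
rewrite -[dot u _]dotC -[dot (fun t => \sum_a _) _]dotC !dotDl !dotZl !rmorphD !rmorphM /= !dotC.
rewrite !dot_nrm2 nrm2_orthonormal_sum dot_suml.
have -> : \sum_a c a * dot (E a) u = nrm2 c.
  by rewrite nrm2E; apply: eq_bigr => a _; rewrite -dotC.
have -> : dot u (fun t => \sum_a c a * E a t) = nrm2 c.
  rewrite -dotC dot_suml; rewrite rmorph_sum nrm2E; apply: eq_bigr => a _.
  by rewrite rmorphM /= [(dot _ u)^*]dotC mulrC.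
rewrite (_ : _ + _ = nrm2 u - nrm2 c) ?subr_ge0 //.
by rewrite rmorphN rmorph1; ring.
Qed.

End Family.

(** Take an orthonormal family in [W] of maximal size, which exists since sizes are at most [#|T|].
    The normalized residual of a vector of [W] not spanned by it would extend the family. *)
Lemma orthonormal_basis_of (W : (T -> F) -> Prop) :
  (forall u v, W u -> W v -> W (fun t => u t + v t)) ->
  (forall c u, W u -> W (fun t => c * u t)) ->
  exists (d : nat) (E : 'I_d -> T -> F), [/\ orthonormal E, forall a, W (E a) &
    forall u, W u -> u =1 fun t => \sum_a dot u (E a) * E a t].
Proof.
move=> WD WZ.
pose Q k := `[< exists E : 'I_k -> T -> F, orthonormal E /\ forall a, W (E a) >].
have Q0 : exists k, Q k by exists 0%N; apply/asboolP; exists (fun _ _ => 0); split=> [[]|[]].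
have Qb k : Q k -> (k <= #|T|)%N by move=> /asboolP [E [/orthonormal_card]].
case: (ex_maxnP Q0 Qb) => d /asboolP [E [oE WE]] dmax.
exists d, E; split => // u Wu.
pose r t := u t + \sum_a (- dot u (E a)) * E a t.
have Wr : W r.
  rewrite /r; elim: (index_enum _) => [|a s IH].
    by have -> : (fun t => u t + \sum_(a <- [::]) - dot u (E a) * E a t) = u
      by apply: funext => t; rewrite big_nil addr0.
  have -> : (fun t => u t + \sum_(k <- a :: s) - dot u (E k) * E k t) =
    fun t => (- dot u (E a) * E a t) + (u t + \sum_(k <- s) - dot u (E k) * E k t).
    by apply: funext => t; rewrite big_cons addrCA.
  by apply: WD => //; apply: WZ.
have rE a : dot r (E a) = 0.
  by rewrite dotDl (dot_orthonormal_sum oE) subrr.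
have r0 : nrm2 r = 0.
  apply/eqP/contraT => nr.
  have rp : 0 < nrm2 r by rewrite lt_neqAle eq_sym nr nrm2_ge0.
  pose z := (sqrtC (nrm2 r))^-1.
  have zp : 0 <= z by rewrite invr_ge0 sqrtC_ge0 ltW.
  have zz : z * z^* * nrm2 r = 1.
    by rewrite geC0_conj // -invfM -expr2 sqrtCK mulVf.
  suff /dmax : Q d.+1 by rewrite ltnn.
  apply/asboolP.
  exists (fun i : 'I_d.+1 => if unlift ord_max i is Some j then E j else fun t => z * r t).
  split=> [i j|i]; last by case: unliftP => [j|] _; [exact: WE|exact: WZ].
  case: (unliftP ord_max i) => [i' ->|->]; case: (unliftP ord_max j) => [j' ->|->].
  - by rewrite oE (inj_eq lift_inj).
  - by rewrite -dotC dotZl rE mulr0 rmorph0 eq_sym (negPf (neq_lift _ _)).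
  - by rewrite dotZl rE mulr0 (negPf (neq_lift _ _)).
  - by rewrite dotZl -dotC dotZl rmorphM /= dotC dot_nrm2 mulrA zz eqxx.
move=> t; have : `|r t| ^+ 2 = 0.
  move/eqP: r0; rewrite psumr_eq0 => [/allP /(_ t)|i _]; last by rewrite exprn_ge0.
  by rewrite mem_index_enum => /(_ isT) /eqP.
move=> /eqP; rewrite sqrf_eq0 normr_eq0 /r addr_eq0 => /eqP ->.
by rewrite -sumrN; apply: eq_bigr => a _; rewrite mulNr opprK.
Qed.

End Orthonormal.

(** * Gauge fixing *)

Section GaugeFixing.
Variables (F : numClosedFieldType) (I : finType) (H : Type).
(* [p h] is the vector of values at [h] of an orthonormal basis, [U h] its right translation by [h]
   and [e] its value at the identity. *)
Variables (p : H -> I -> F) (U : H -> I -> I -> F) (e : I -> F) (h0 : H).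
Hypothesis Uunit : forall h i l, \sum_k U h i k * (U h l k)^* = (i == l)%:R.
Hypothesis pU : forall h i, p h i = \sum_k U h i k * e k.
(** The Haar mean is seen only through two consequences of the orthonormality of the basis: a
    quadratic expression in [p h] that is constant in [h], or bounded uniformly in [h], has a
    coefficient trace with the same value or bound. *)
Hypothesis mean_eq : forall (S : finType) (X Y : S -> I -> F) (c : F),
  (forall h, \sum_s (\sum_j X s j * p h j) * (\sum_j Y s j * p h j)^* = c) ->
  \sum_s \sum_j X s j * (Y s j)^* = c.
Hypothesis mean_le : forall (S : finType) (X : S -> I -> F) (c : F),
  (forall h, \sum_s `|\sum_j X s j * p h j| ^+ 2 <= c) ->
  \sum_s \sum_j `|X s j| ^+ 2 <= c.

Variables (d : nat) (E : 'I_d -> I -> I -> I -> F).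
Hypothesis oE : forall a b, \sum_i \sum_j \sum_k E a i j k * (E b i j k)^* = (a == b)%:R.
Hypothesis EU : forall h a i' j' k',
  \sum_i \sum_j \sum_k E a i j k * (U h i i' * U h j j' * U h k k') = E a i' j' k'.

Definition gauge_fixed (h : H) (a : 'I_d) (z : I * I) : F := \sum_j E a z.1 j z.2 * p h j.

Lemma rotate_dot h (X Y : I -> F) :
  \sum_k (\sum_i X i * U h i k) * (\sum_i Y i * U h i k)^* = \sum_i X i * (Y i)^*.
Proof.
under eq_bigr do rewrite big_distrl /=.
rewrite exchange_big /=; apply: eq_bigr => i _.
under eq_bigr do rewrite rmorph_sum big_distrr /=.
rewrite exchange_big /=.
rewrite [LHS](eq_bigr (fun l => X i * (Y l)^* * (\sum_k U h i k * (U h l k)^*))); last first.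
  by move=> l _; rewrite big_distrr /=; apply: eq_bigr => k _; rewrite rmorphM /=; ring.
rewrite (bigD1 i) //= [X in _ + X]big1 ?addr0 ?Uunit ?eqxx ?mulr1 // => l /negPf li.
by rewrite Uunit eq_sym li mulr0.
Qed.

(** Translating all three legs by [h] fixes the tensor, and turns evaluation of the middle leg at
    [h] into evaluation at the identity. *)
Lemma gauge_fixed_rotate h a i' k' :
  \sum_k (\sum_i gauge_fixed h a (i, k) * U h i i') * U h k k' = \sum_j E a i' j k' * e j.
Proof.
transitivity (\sum_j' (\sum_i \sum_j \sum_k E a i j k * (U h i i' * U h j j' * U h k k')) * e j').
  under [RHS]eq_bigr do rewrite big_distrl /=.
  rewrite [RHS]exchange_big /=.
  under eq_bigr do rewrite big_distrl /=.
  rewrite exchange_big /=; apply: eq_bigr => i _.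
  under [RHS]eq_bigr do rewrite big_distrl /=.
  rewrite [RHS]exchange_big /= /gauge_fixed /=.
  under eq_bigr do rewrite !big_distrl /=.
  rewrite exchange_big /=; apply: eq_bigr => j _.
  under [RHS]eq_bigr do rewrite big_distrl /=.
  rewrite [RHS]exchange_big /=; apply: eq_bigr => k _.
  rewrite pU !big_distrr !big_distrl /=; apply: eq_bigr => j' _; ring.
by apply: eq_bigr => j _; rewrite EU.
Qed.

(** The translations of the outer legs are unitary, so the scalar products do not depend on [h].
    They equal their mean over [h], which is the scalar product of the full tensors. An invariant
    tensor is thus determined by two of its legs. *)
Lemma gauge_fixed_orthonormal h : orthonormal (gauge_fixed h).
Proof.
have D g a b : dot (gauge_fixed g a) (gauge_fixed g b) =
    dot (fun z : I * I => \sum_j E a z.1 j z.2 * e j) (fun z => \sum_j E b z.1 j z.2 * e j).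
  rewrite /dot -(pair_bigA _ (fun i k => gauge_fixed g a (i, k) * (gauge_fixed g b (i, k))^*)) /=.
  rewrite -(pair_bigA _ (fun i k => (\sum_j E a i j k * e j) * (\sum_j E b i j k * e j)^*)) /=.
  under [RHS]eq_bigr do under eq_bigr do rewrite -!(gauge_fixed_rotate g).
  under [RHS]eq_bigr do rewrite rotate_dot.
  rewrite [RHS]exchange_big /= [LHS]exchange_big /=; apply: eq_bigr => k _.
  by rewrite rotate_dot.
move=> a b; rewrite -oE.
have := @mean_eq (I * I)%type (fun z j => E a z.1 j z.2) (fun z j => E b z.1 j z.2) _ (fun g =>
  etrans (D g a b) (esym (D h a b))).
move=> <-; rewrite -(pair_bigA _ (fun i k => \sum_j E a i j k * (E b i j k)^*)) /=.
by apply: eq_bigr => i _; rewrite exchange_big.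
Qed.

Lemma invariant_card : (d <= #|I| * #|I|)%N.
Proof. by rewrite -card_prod; apply: orthonormal_card (gauge_fixed_orthonormal h0). Qed.

(** By [mean_le] the leg [j] may be evaluated at a fixed [h]. For each [i] the sum over [a] is then
    a Bessel sum for the vector [q], supported on first index [i], and is at most [nrm2 w]; the
    values of [i] give the factor [#|I|]. *)
Lemma invariant_partial_trace (w : I -> F) :
  \sum_a \sum_i \sum_j `|\sum_k E a i j k * w k| ^+ 2 <= #|I|%:R * nrm2 w.
Proof.
rewrite pair_bigA /=.
apply: (@mean_le ('I_d * I)%type (fun z j => \sum_k E z.1 z.2 j k * w k)) => h.
rewrite -(pair_bigA _ (fun a i => `|\sum_j (\sum_k E a i j k * w k) * p h j| ^+ 2)) /=.
rewrite exchange_big /= mulr_natl -sumr_const; apply: ler_sum => i _.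
pose q (z : I * I) := (z.1 == i)%:R * (w z.2)^*.
have -> : nrm2 w = nrm2 q.
  rewrite /nrm2 -(pair_bigA _ (fun l k => `|(l == i)%:R * (w k)^*| ^+ 2)) /=.
  rewrite [RHS](bigD1 i) //= eqxx [X in _ = _ + X]big1 ?addr0.
    by apply: eq_bigr => k _; rewrite mul1r norm_conjC.
  by move=> l /negPf ->; rewrite big1 // => k _; rewrite mul0r normr0 expr0n.
apply: le_trans (bessel (gauge_fixed_orthonormal h) q); rewrite le_eqVlt; apply/orP; left.
apply/eqP/eq_bigr => a _; rewrite -norm_conjC dotC; congr (`|_| ^+ 2).
rewrite /dot -(pair_bigA _ (fun l k => gauge_fixed h a (l, k) * ((l == i)%:R * (w k)^*)^*)) /=.
rewrite [RHS](bigD1 i) //= eqxx [X in _ = _ + X]big1 ?addr0; last first.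
  by move=> l /negPf ->; rewrite big1 // => k _; rewrite mul0r rmorph0 mulr0.
under eq_bigr do rewrite big_distrl /=.
rewrite exchange_big /=; apply: eq_bigr => k _.
rewrite mul1r conjCK /gauge_fixed big_distrl /=; apply: eq_bigr => j _; ring.
Qed.

End GaugeFixing.

(** * Corner operators *)

Section Projector.
Variables (F : numClosedFieldType) (J : finType) (d : nat) (E : 'I_d -> J -> F).
Hypothesis oE : orthonormal E.

Definition proj (i j : J) : F := \sum_a E a i * (E a j)^*.

Lemma proj_conj i j : (proj i j)^* = proj j i.
Proof. by rewrite rmorph_sum; apply: eq_bigr => a _; rewrite rmorphM /= conjCK mulrC. Qed.

Lemma kapp_proj u i : kapp proj u i = \sum_a dot u (E a) * E a i.
Proof.
rewrite /kapp; under eq_bigr do rewrite big_distrl /=.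
rewrite exchange_big /=; apply: eq_bigr => a _; rewrite big_distrl /=.
by apply: eq_bigr => j _; ring.
Qed.

Lemma nrm2_proj u : nrm2 (kapp proj u) = \sum_a `|dot u (E a)| ^+ 2.
Proof. by rewrite (eq_nrm2 (kapp_proj u)) nrm2_orthonormal_sum. Qed.

Lemma nrm2_proj_le u : nrm2 (kapp proj u) <= nrm2 u.
Proof. by rewrite nrm2_proj bessel. Qed.

Lemma proj_idem u : kapp proj (kapp proj u) =1 kapp proj u.
Proof.
move=> i; rewrite [RHS]kapp_proj kapp_proj; apply: eq_bigr => a _; congr (_ * _).
by rewrite (eq_dot (kapp_proj u) (frefl (E a))) dot_orthonormal_sum.
Qed.

Lemma proj_trace : \sum_i proj i i = d%:R.
Proof.
rewrite exchange_big /= (eq_bigr (fun=> 1)) => [|a _]; last by rewrite -[LHS]/(dot _ _) oE eqxx.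
by rewrite sumr_const card_ord.
Qed.

End Projector.

Section Corner.
Variables (F : numClosedFieldType) (I : finType) (i0 : I).
Notation J := (I * I * I)%type.
Notation X := {ffun 'I_6 -> I}.

Definition jget (z : J) (k : nat) : I := match k with 0 => z.1.1 | 1 => z.1.2 | _ => z.2 end.

(* The two places (slot, position in the triple) where the variable [g] of a vertex occurs. *)
Definition places (tetra : bool) (g : nat) : (nat * nat) * (nat * nat) :=
  match g with
  | 0 => ((0, 0), (3, 2))
  | 1 => if tetra then ((0, 1), (2, 1)) else ((0, 1), (3, 1))
  | 2 => ((0, 2), (1, 0))
  | 3 => if tetra then ((1, 1), (3, 1)) else ((1, 1), (2, 1))
  | 4 => ((1, 2), (2, 0))
  | _ => ((2, 2), (3, 0))
  end%N.

Definition read (a c : nat) (z z' : J) (o : nat * nat) : option I :=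
  if o.1 == a then Some (jget z o.2) else if o.1 == c then Some (jget z' o.2) else None.

Definition o6 (k : nat) : 'I_6 := inord k.

(* A label [x] gives a value to every variable shared by the corner [{a, c}] with the opposite
   corner; the remaining labels are pinned to [i0], so that the sum over labels is not redundant. *)
Definition admissible (tetra : bool) (a c : nat) (x : X) (z z' : J) (g : nat) : bool :=
  match read a c z z' (places tetra g).1, read a c z z' (places tetra g).2 with
  | Some i, Some j => (i == j) && (x (o6 g) == i0)
  | Some i, None => i == x (o6 g)
  | None, Some j => j == x (o6 g)
  | None, None => x (o6 g) == i0
  end.

Definition corner (tetra : bool) (a c : nat) (x : X) (z z' : J) : F :=
  \prod_(g < 6) (admissible tetra a c x z z' g)%:R.

Lemma corner_sym tetra a c x z z' : a != c -> corner tetra a c x z z' = corner tetra c a x z' z.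
Proof.
move=> ac; apply: eq_bigr => g _; rewrite /admissible.
have R o : read a c z z' o = read c a z' z o.
  by rewrite /read; case: (o.1 =P a) => // ->; rewrite (negPf ac).
by rewrite !R.
Qed.

Lemma corner_real tetra a c x z z' : (corner tetra a c x z z')^* = corner tetra a c x z z'.
Proof. by rewrite rmorph_prod; apply: eq_bigr => g _; rewrite rmorph_nat. Qed.

Lemma cornerE tetra a c x z z' : corner tetra a c x z z' =
  (all (fun k => admissible tetra a c x z z' k) (iota 0 6))%:R.
Proof.
rewrite /corner -big_all (big_morph (fun b : bool => b%:R : F) (id1 := 1) (op1 := *%R)) //; last first.
  by move=> b b'; rewrite -natrM mulnb.
by rewrite -(big_mkord xpredT (fun k => (admissible tetra a c x z z' k)%:R)).
Qed.

Section Shape.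
Variables (tetra : bool) (a c : nat) (Y ZA ZC : finType).
Variables (pA : ZA -> Y -> J) (pC : ZC -> Y -> J) (A : X -> ZA) (C : X -> ZC) (ok : pred X).
Hypothesis cornerP : forall x z z',
  corner tetra a c x z z' = (ok x)%:R * \sum_y ((z == pA (A x) y) && (z' == pC (C x) y))%:R.
Hypothesis okI : forall x x', ok x -> ok x' -> A x = A x' -> C x = C x' -> x = x'.
Hypothesis pC_bij : bijective (fun q : ZC * Y => pC q.1 q.2).
Variables (L : J -> J -> F) (N : F).
Hypothesis partial_trace : forall w : Y -> F,
  \sum_q nrm2 (fun z => \sum_y L z (pA q y) * w y) <= N * nrm2 w.

(** For a given label the corner moves the slice of [v] at [C x] to the slice at [A x]. Labels embed
    into pairs of slices by [okI]. Summing over [A] is a partial trace of [L], and summing over [C]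
    restores [nrm2 v] because [pC] is bijective. *)
Lemma corner_shape_bound v :
  \sum_x nrm2 (kapp L (kapp (corner tetra a c x) v)) <= N * nrm2 v.
Proof.
have K x : kapp L (kapp (corner tetra a c x) v) =1
    fun z => (ok x)%:R * \sum_y L z (pA (A x) y) * v (pC (C x) y).
  move=> z; rewrite [RHS]big_distrr /=.
  transitivity (\sum_z' \sum_z'' \sum_y (ok x)%:R *
     ((L z z' * v z'') * ((z' == pA (A x) y)%:R * (z'' == pC (C x) y)%:R))).
    apply: eq_bigr => z' _; rewrite [LHS]big_distrr /=; apply: eq_bigr => z'' _; rewrite cornerP.
    rewrite !(big_distrl, big_distrr) /=; apply: eq_bigr => y _.
    by rewrite -mulnb natrM; ring.
  under [LHS]eq_bigr do rewrite exchange_big /=.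
  rewrite exchange_big /=; apply: eq_bigr => y _.
  rewrite (bigD1 (pA (A x) y)) //= [X in _ + X]big1 ?addr0 => [|z' /negPf ->]; last first.
    by rewrite big1 // => z'' _; rewrite !(mul0r, mulr0).
  rewrite (bigD1 (pC (C x) y)) //= [X in _ + X]big1 ?addr0 => [|z'' /negPf ->]; last first.
    by rewrite !(mul0r, mulr0).
  by rewrite !eqxx !mulr1.
pose G (q : ZA * ZC) := nrm2 (fun z => \sum_y L z (pA q.1 y) * v (pC q.2 y)).
have G0 q : 0 <= G q by apply: nrm2_ge0.
apply: (@le_trans _ _ (\sum_q G q)).
  rewrite (eq_bigr (fun x => if ok x then G (A x, C x) else 0)); last first.
    move=> x _; rewrite (eq_nrm2 (K x)) /G; case: (ok x).
      by apply: eq_nrm2 => z; rewrite mul1r.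
    by rewrite /nrm2 big1 // => z _; rewrite mul0r normr0 expr0n.
  rewrite -big_mkcond /=.
  pose h x := (A x, C x).
  have hI : {in ok &, injective h} by move=> x x' okx okx' [eA eC]; apply: okI.
  rewrite (eq_bigl (fun x => x \in [set x | ok x])); last by move=> x; rewrite inE.
  have -> : \sum_(x in [set x | ok x]) G (A x, C x) = \sum_(q in h @: [set x | ok x]) G q.
    by rewrite big_imset //= => x x'; rewrite !inE; exact: hI.
  rewrite big_mkcond /=; apply: ler_sum => q _; case: ifP => // _.
rewrite -(pair_bigA _ (fun z q => G (z, q))) /= exchange_big /=.
have -> : nrm2 v = \sum_q nrm2 (fun y => v (pC q y)).
  rewrite /nrm2 pair_bigA /= (reindex (fun q : ZC * Y => pC q.1 q.2)) //=.
  by apply: onW_bij.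
rewrite big_distrr /=; apply: ler_sum => q _; exact: (partial_trace (fun y => v (pC q y))).
Qed.
End Shape.

Lemma sum_indicator (Y : finType) (T : eqType) (T' : eqType) (f : Y -> T) (g : Y -> T') (h : T -> Y)
  (z : T) (z' : T') : cancel f h ->
  \sum_y ((z == f y) && (z' == g y))%:R = ((z == f (h z)) && (z' == g (h z)))%:R :> F.
Proof.
move=> fK; rewrite (bigD1 (h z)) //= big1 ?addr0 // => y hy.
by case: (z =P f y) => //= e; rewrite e fK eqxx in hy.
Qed.

Definition put (k : nat) (q : I * I) (y : I) : J :=
  match k with 0 => (y, q.1, q.2) | 1 => (q.1, y, q.2) | _ => (q.1, q.2, y) end.

Lemma put_bij k : bijective (fun q : (I * I) * I => put k q.1 q.2).
Proof.
case: k => [|[|k]]; rewrite /put.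
- by exists (fun z : J => ((z.1.2, z.2), z.1.1)) => [[[p q] y]|[[p q] y]].
- by exists (fun z : J => ((z.1.1, z.2), z.1.2)) => [[[p q] y]|[[p q] y]].
- by exists (fun z : J => (z.1, z.2)) => [[[p q] y]|[[p q] y]].
Qed.

Lemma jget_put k q y : jget (put k q y) k = y.
Proof. by case: k => [|[|k]]. Qed.

Definition put2 (k : nat) (q : I) (y : I * I) : J :=
  match k with 0 => (q, y.1, y.2) | 1 => (y.1, q, y.2) | _ => (y.1, y.2, q) end.

Definition get2 (k : nat) (z : J) : I * I :=
  match k with 0 => (z.1.2, z.2) | 1 => (z.1.1, z.2) | _ => z.1 end.

Lemma get2_put2 k q y : get2 k (put2 k q y) = y.
Proof. by case: k => [|[|k]] //; case: y. Qed.

(** Ordered pairs of distinct slots with a common variable: at a pillow vertex, slots at distance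
    two have none. *)
Definition allowed (tetra : bool) (a c : nat) : bool := (a != c) && (tetra || ((a + 2) %% 4 != c)%N).

Lemma o6_ext (x x' : X) : (forall k, (k < 6)%N -> x (o6 k) = x' (o6 k)) -> x = x'.
Proof. by move=> e; apply/ffunP => g; rewrite -[g]inord_val; apply: e. Qed.

Section Bound.
Variables (L : J -> J -> F) (N : F).
Hypothesis partial_trace : forall k (w : I -> F),
  \sum_q nrm2 (fun z => \sum_y L z (put k q y) * w y) <= N * nrm2 w.
Hypothesis contraction : forall u, nrm2 (kapp L u) <= nrm2 u.
Hypothesis cardN : N = #|I|%:R.

(** With two legs contracted at once, each value of the remaining leg costs at most [nrm2 w] since
    [L] is a contraction, and there are [N] values. *)
Lemma partial_trace2 k (w : I * I -> F) :
  \sum_q nrm2 (fun z => \sum_y L z (put2 k q y) * w y) <= N * nrm2 w.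
Proof.
rewrite cardN mulr_natl -sumr_const; apply: ler_sum => q _.
pose u (z : J) := (z == put2 k q (get2 k z))%:R * w (get2 k z).
have S (G : J -> F) : (forall z, z != put2 k q (get2 k z) -> G z = 0) ->
    \sum_z G z = \sum_y G (put2 k q y).
  move=> G0; rewrite (bigID (fun z => z == put2 k q (get2 k z))) /= addrC big1 ?add0r //.
  rewrite (reindex_onto (put2 k q) (get2 k)) => [|z /eqP <- //].
  by apply: eq_bigl => y; rewrite !get2_put2 !eqxx.
have -> : nrm2 w = nrm2 u.
  rewrite /nrm2 S => [|z /negPf]; last by rewrite /u => ->; rewrite mul0r normr0 expr0n.
  by apply: eq_bigr => y _; rewrite /u !get2_put2 eqxx mul1r.
apply: le_trans (contraction u); rewrite le_eqVlt; apply/orP; left; apply/eqP/eq_nrm2 => z.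
rewrite /kapp S => [|z' /negPf]; last by rewrite /u => ->; rewrite mul0r mulr0.
by apply: eq_bigr => y _; rewrite /u !get2_put2 eqxx mul1r.
Qed.

(** Slots with one common variable, at place [k] of [a] and [l] of [c]. The pinned labels [g0] and
    [g1] belong to this variable and to the one shared by the two other slots; [p], [q] and [r], [s]
    are the remaining legs of [a] and of [c]. *)
Lemma share1_bound tetra a c k l g0 g1 p q r s v :
  (forall x z z', all (admissible tetra a c x z z') (iota 0 6) =
    ((x (o6 g0) == i0) && (x (o6 g1) == i0) &&
     ((z == put k (x (o6 p), x (o6 q)) (jget z k)) &&
      (z' == put l (x (o6 r), x (o6 s)) (jget z k))))) ->
  perm_eq [:: g0; g1; p; q; r; s] (iota 0 6) ->
  \sum_x nrm2 (kapp L (kapp (corner tetra a c x) v)) <= N * nrm2 v.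
Proof.
move=> cP /perm_mem gP.
apply: (@corner_shape_bound tetra a c _ _ _ (put k) (put l)
  (fun x => (x (o6 p), x (o6 q))) (fun x => (x (o6 r), x (o6 s)))
  (fun x => (x (o6 g0) == i0) && (x (o6 g1) == i0))).
- move=> x z z'; rewrite cornerE cP (@sum_indicator _ _ _ (put k _) (put l _) (jget ^~ k)).
    by rewrite -natrM mulnb.
  by move=> y; apply: jget_put.
- move=> x x' /andP [/eqP e0 /eqP e1] /andP [/eqP e0' /eqP e1'] [ep eq] [er es].
  apply: o6_ext => j j6; have := gP j; rewrite mem_iota j6 !inE.
  by do 5?[case/orP]; move/eqP->; congruence.
- exact: put_bij.
- exact: partial_trace.
Qed.

Lemma share2_bound tetra a c k l g0 g1 g2 g3 p q v :
  (forall x z z', all (admissible tetra a c x z z') (iota 0 6) =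
    ((x (o6 g0) == i0) && (x (o6 g1) == i0) && (x (o6 g2) == i0) && (x (o6 g3) == i0) &&
     ((z == put2 k (x (o6 p)) (get2 k z)) &&
      (z' == put2 l (x (o6 q)) ((get2 k z).2, (get2 k z).1))))) ->
  perm_eq [:: g0; g1; g2; g3; p; q] (iota 0 6) ->
  \sum_x nrm2 (kapp L (kapp (corner tetra a c x) v)) <= N * nrm2 v.
Proof.
move=> cP /perm_mem gP.
apply: (@corner_shape_bound tetra a c _ _ _ (put2 k) (fun q y => put2 l q (y.2, y.1))
  (fun x => x (o6 p)) (fun x => x (o6 q))
  (fun x => (x (o6 g0) == i0) && (x (o6 g1) == i0) && (x (o6 g2) == i0) && (x (o6 g3) == i0))).
- move=> x z z'.
  rewrite cornerE cP (@sum_indicator _ _ _ (put2 k _) (fun y => put2 l _ (y.2, y.1)) (get2 k)).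
    by rewrite -natrM mulnb.
  by move=> y; apply: get2_put2.
- move=> x x' /andP [/andP [/andP [/eqP e0 /eqP e1] /eqP e2] /eqP e3].
  move=> /andP [/andP [/andP [/eqP e0' /eqP e1'] /eqP e2'] /eqP e3'] ep eq.
  apply: o6_ext => j j6; have := gP j; rewrite mem_iota j6 !inE.
  by do 5?[case/orP]; move/eqP->; congruence.
- case: l {cP} => [|[|l]]; rewrite /put2 /=.
  + by exists (fun z : J => (z.1.1, (z.2, z.1.2))) => [[q' [y y']]|[[q' y] y']].
  + by exists (fun z : J => (z.1.2, (z.2, z.1.1))) => [[q' [y y']]|[[q' y] y']].
  + by exists (fun z : J => (z.2, (z.1.2, z.1.1))) => [[q' [y y']]|[[q' y] y']].
- exact: partial_trace2.
Qed.

Ltac corner_cases := move=> x [[? ?] ?] [[? ?] ?]; rewrite /= /admissible /read /= !xpair_eqE;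
  apply/idP/idP;
  repeat match goal with
  | |- is_true (?b && ?c) -> _ => case/andP
  | |- is_true (?i == ?j) -> _ => let e := fresh "e" in move/eqP => e
  | |- is_true true -> _ => move=> _
  end; subst; repeat match goal with H : _ = _ |- _ => rewrite ?H ?eqxx //=; clear H end.

Lemma corner_bound tetra a c v : (a < 4)%N -> (c < 4)%N -> allowed tetra a c ->
  \sum_x nrm2 (kapp L (kapp (corner tetra a c x) v)) <= N * nrm2 v.
Proof.
case: tetra; case: a => [|[|[|[|//]]]] _; case: c => [|[|[|[|//]]]] _ //= _.
(* One case for each allowed ordered pair: twelve for a tetrahedral vertex and eight for a pillow.
   The numbers are the two places, the pinned labels and the free labels, read off [slot_vars]. *)
- by apply: (@share1_bound _ _ _ 2 0 2 5 0 1 3 4) => //; corner_cases.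
- by apply: (@share1_bound _ _ _ 1 1 1 3 0 2 4 5) => //; corner_cases.
- by apply: (@share1_bound _ _ _ 0 2 0 4 1 2 5 3) => //; corner_cases.
- by apply: (@share1_bound _ _ _ 0 2 2 5 3 4 0 1) => //; corner_cases.
- by apply: (@share1_bound _ _ _ 2 0 4 0 2 3 1 5) => //; corner_cases.
- by apply: (@share1_bound _ _ _ 1 1 3 1 2 4 5 0) => //; corner_cases.
- by apply: (@share1_bound _ _ _ 1 1 1 3 4 5 0 2) => //; corner_cases.
- by apply: (@share1_bound _ _ _ 0 2 4 0 1 5 2 3) => //; corner_cases.
- by apply: (@share1_bound _ _ _ 2 0 5 2 4 1 3 0) => //; corner_cases.
- by apply: (@share1_bound _ _ _ 2 0 0 4 5 3 1 2) => //; corner_cases.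
- by apply: (@share1_bound _ _ _ 1 1 3 1 5 0 2 4) => //; corner_cases.
- by apply: (@share1_bound _ _ _ 0 2 5 2 3 0 4 1) => //; corner_cases.
- by apply: (@share1_bound _ _ _ 2 0 2 5 0 1 3 4) => //; corner_cases.
- by apply: (@share2_bound _ _ _ 2 0 0 1 3 4 2 5) => //; corner_cases.
- by apply: (@share1_bound _ _ _ 0 2 2 5 3 4 0 1) => //; corner_cases.
- by apply: (@share2_bound _ _ _ 0 2 3 4 0 1 2 5) => //; corner_cases.
- by apply: (@share2_bound _ _ _ 2 0 4 3 0 1 5 2) => //; corner_cases.
- by apply: (@share1_bound _ _ _ 2 0 5 2 4 3 1 0) => //; corner_cases.
- by apply: (@share2_bound _ _ _ 0 2 1 0 3 4 5 2) => //; corner_cases.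
- by apply: (@share1_bound _ _ _ 0 2 5 2 1 0 4 3) => //; corner_cases.
Qed.
End Bound.
End Corner.

(** * Traces along a circuit *)

Section Trace.
Variables (F : numClosedFieldType) (J : finType).
Implicit Types (K : J -> J -> F) (M : nat -> J -> J -> F).

Definition kcomp K K' : J -> J -> F := fun i k => \sum_j K i j * K' j k.

Lemma kapp_kcomp K K' u : kapp (kcomp K K') u =1 kapp K (kapp K' u).
Proof.
move=> i; rewrite /kapp /kcomp; under eq_bigr do rewrite big_distrl /=.
rewrite exchange_big /=; apply: eq_bigr => j _; rewrite big_distrr /=.
by apply: eq_bigr => k _; rewrite mulrA.
Qed.

Fixpoint kprod M (m : nat) : J -> J -> F :=
  if m is m'.+1 then kcomp (kprod M m') (M m') else fun i k => (i == k)%:R.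

Lemma kapp_kprod M m u : kapp (kprod M m) u =1 foldr (fun i => kapp (M i)) u (iota 0 m).
Proof.
elim: m u => [|m IH] u i.
  rewrite /= /kapp (bigD1 i) //= eqxx mul1r big1 ?addr0 // => j /negPf.
  by rewrite eq_sym => ->; rewrite mul0r.
by rewrite -addn1 iotaD foldr_cat addn1 /= kapp_kcomp IH.
Qed.

Definition ffun_rcons m (f : {ffun 'I_m -> J}) (j : J) : {ffun 'I_m.+1 -> J} :=
  [ffun i => if unlift ord_max i is Some i' then f i' else j].

Lemma big_ffun_rcons m (G : {ffun 'I_m.+1 -> J} -> F) :
  \sum_f G f = \sum_(f : {ffun 'I_m -> J}) \sum_j G (ffun_rcons f j).
Proof.
rewrite pair_bigA /=.
rewrite (reindex (fun q : {ffun 'I_m -> J} * J => ffun_rcons q.1 q.2)) //=.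
exists (fun f => ([ffun i => f (lift ord_max i)], f ord_max)) => [[f j] _|f _] /=.
  by rewrite ffunE unlift_none; congr (_, _); apply/ffunP => i; rewrite !ffunE liftK.
by apply/ffunP => i; rewrite !ffunE; case: unliftP => [i' ->|->]; rewrite ?ffunE.
Qed.

(** The weight [G] on the two ends carries the induction: the last factor is absorbed into it. With
    [G] the last factor of a cycle, it yields the trace in [sum_cycle]. *)
Lemma sum_path M m (G : J -> J -> F) :
  \sum_(f : {ffun 'I_m.+1 -> J})
     (\prod_(i < m) M i (f (inord i)) (f (inord i.+1))) * G (f (inord 0)) (f (inord m)) =
  \sum_i \sum_k kprod M m i k * G i k.
Proof.
elim: m G => [|m IH] G.
  transitivity (\sum_i G i i).
    rewrite (reindex (fun i : J => [ffun _ : 'I_1 => i])) /=.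
      by apply: eq_bigr => i _; rewrite big_ord0 mul1r !ffunE.
    exists (fun f : {ffun 'I_1 -> J} => f ord0) => [i _|f _]; first by rewrite ffunE.
    by apply/ffunP => i; rewrite ffunE (ord1 i).
  apply: eq_bigr => i _; rewrite (bigD1 i) //= eqxx mul1r big1 ?addr0 // => k /negPf.
  by rewrite eq_sym => ->; rewrite mul0r.
rewrite big_ffun_rcons.
have e (f : {ffun 'I_m.+1 -> J}) j i : (i <= m)%N -> ffun_rcons f j (inord i) = f (inord i).
  move=> im; rewrite ffunE.
  have -> : inord i = lift ord_max (inord i : 'I_m.+1) :> 'I_m.+2.
    by apply: val_inj; rewrite /= /bump !inordK ?ltnS ?(leqW im) // ltnNge im.
  by rewrite liftK.
have e' (f : {ffun 'I_m.+1 -> J}) j : ffun_rcons f j (inord m.+1) = j.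
  have -> : inord m.+1 = ord_max :> 'I_m.+2 by apply: val_inj; rewrite /= inordK.
  by rewrite ffunE unlift_none.
transitivity (\sum_(f : {ffun 'I_m.+1 -> J})
   (\prod_(i < m) M i (f (inord i)) (f (inord i.+1))) *
    (\sum_j M m (f (inord m)) j * G (f (inord 0)) j)).
  apply: eq_bigr => f _; rewrite big_distrr /=; apply: eq_bigr => j _.
  rewrite big_ord_recr /= !e' (e _ _ _ (leqnn m)) (e _ _ 0%N) // -mulrA; congr (_ * _).
  by apply: eq_bigr => i _; rewrite !e // ltnW.
rewrite (IH (fun a b => \sum_j M m b j * G a j)); apply: eq_bigr => i _.
under eq_bigr do rewrite big_distrr /=.
rewrite exchange_big /=; apply: eq_bigr => k _; rewrite /kcomp big_distrl /=.
by apply: eq_bigr => j _; rewrite mulrA.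
Qed.

Lemma sum_cycle M m : (0 < m)%N ->
  \sum_(f : {ffun 'I_m -> J}) \prod_(i < m) M i (f i) (f (ordS i)) = \sum_j kprod M m j j.
Proof.
case: m => // m _.
have := sum_path M m (fun a b => M m b a); rewrite /= /kcomp => <-.
apply: eq_bigr => f _; rewrite big_ord_recr /=; congr (_ * _).
  apply: eq_bigr => i _; congr (M _ (f _) (f _)); apply: val_inj => /=.
    by rewrite inordK // ltnW // ltnS.
  by rewrite inordK ?modn_small // !ltnS.
congr (M _ (f _) (f _)); apply: val_inj => /=; first by rewrite inordK.
by rewrite inordK // modnn.
Qed.

End Trace.

(** * Projectors on lines and their orientation *)

Section Lines.
Variables (F : numClosedFieldType) (I : finType) (d : nat).
Notation J := (I * I * I)%type.
Implicit Types E : 'I_d -> J -> F.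

Definition traceable (N : F) E := forall k (w : I -> F),
  \sum_q \sum_a `|\sum_y E a (put k q y) * w y| ^+ 2 <= N * nrm2 w.

(** A contracted leg of the projector leaves a combination of the orthonormal [E a], whose norm is
    that of its coefficients. *)
Lemma traceable_proj N E : orthonormal E -> traceable N E -> forall k (w : I -> F),
  \sum_q nrm2 (fun z => \sum_y proj E z (put k q y) * w y) <= N * nrm2 w.
Proof.
move=> oE tE k w; have -> : nrm2 w = nrm2 (fun y => (w y)^*).
  by apply: eq_bigr => y _; rewrite norm_conjC.
apply: le_trans (tE k _); apply: ler_sum => q _.
rewrite le_eqVlt; apply/orP; left; apply/eqP.
transitivity (nrm2 (fun z => \sum_a (\sum_y E a (put k q y) * (w y)^*)^* * E a z)).
  apply: eq_nrm2 => z; rewrite /proj; under eq_bigr do rewrite big_distrl /=.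
  rewrite exchange_big /=; apply: eq_bigr => a _; rewrite rmorph_sum big_distrl /=.
  by apply: eq_bigr => y _; rewrite rmorphM /= conjCK; ring.
by rewrite nrm2_orthonormal_sum //; apply: eq_bigr => a _; rewrite norm_conjC.
Qed.

(** The kernel is hermitian but in general not symmetric. A line run against its orientation acts by
    the transpose, which is the projector on the conjugate basis. *)
Definition orient E (b : bool) : 'I_d -> J -> F := fun a z => if b then E a z else (E a z)^*.

Lemma orient_orthonormal E b : orthonormal E -> orthonormal (orient E b).
Proof.
case: b => // oE a a'; rewrite -[RHS]conjC_nat -oE rmorph_sum /=.
by apply: eq_bigr => z _; rewrite rmorphM.
Qed.

Lemma orient_traceable N E b : traceable N E -> traceable N (orient E b).
Proof.
case: b => // tE k w; have -> : nrm2 w = nrm2 (fun y => (w y)^*).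
  by apply: eq_bigr => y _; rewrite norm_conjC.
apply: le_trans (tE k _); rewrite le_eqVlt; apply/orP; left; apply/eqP.
apply: eq_bigr => q _; apply: eq_bigr => a _; rewrite -norm_conjC rmorph_sum /=.
by congr (`|_| ^+ 2); apply: eq_bigr => y _; rewrite rmorphM /= conjCK.
Qed.

Lemma proj_orientN E z z' : proj (orient E false) z z' = proj E z' z.
Proof. by apply: eq_bigr => a _; rewrite /= conjCK mulrC. Qed.

End Lines.

Lemma prod_shift (F : comNzRingType) m (G : nat -> F) : G m = G 0%N ->
  \prod_(i < m) G i = \prod_(i < m) G i.+1.
Proof.
case: m => [_|m e]; first by rewrite !big_ord0.
by rewrite big_ord_recl [RHS]big_ord_recr /= e mulrC.
Qed.

(** * Gluing the two corners of a vertex *)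

Section VertexSum.
Variables (F : numClosedFieldType) (I : finType) (i0 : I).
Notation J := (I * I * I)%type.
Notation X := {ffun 'I_6 -> I}.

Lemma admissible_const tetra a c (x : X) (z z' : J) g :
  admissible i0 tetra a c x z z' g = admissible i0 tetra a c [ffun=> x (o6 g)] z z' g.
Proof. by rewrite /admissible !ffunE. Qed.

Lemma sum_pinned (b : bool) : \sum_t (b && (t == i0))%:R * (t == i0)%:R = b%:R :> F.
Proof.
rewrite (bigD1 i0) //= eqxx andbT mulr1 big1 ?addr0 // => t /negPf ->.
by rewrite mulr0.
Qed.

Lemma sum_pinned' (b : bool) : \sum_t (t == i0)%:R * (b && (t == i0))%:R = b%:R :> F.
Proof. by rewrite -[RHS]sum_pinned; apply: eq_bigr => t _; rewrite mulrC. Qed.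

Lemma sum_eq_eq (i j : I) : \sum_t (i == t)%:R * (j == t)%:R = (i == j)%:R :> F.
Proof.
rewrite (bigD1 i) //= eqxx mul1r big1 ?addr0 => [|t /negPf]; first by rewrite eq_sym.
by rewrite eq_sym => ->; rewrite mul0r.
Qed.

(** A variable with one place in each corner is glued by the sum over its label. A variable with
    both places in one corner is matched there, and its label, pinned in both corners, is counted
    once. *)
Lemma vertex_sum tetra (p : bool) (z : nat -> J) :
  \sum_y corner F i0 tetra 0 (if p then 3 else 1) y (z 0%N) (z (if p then 3 else 1)%N) *
     corner F i0 tetra (if p then 1 else 2) (if p then 2 else 3) y
       (z (if p then 1 else 2)%N) (z (if p then 2 else 3)%N) =
  \prod_(g < 6) (jget (z (places tetra g).1.1) (places tetra g).1.2 ==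
                 jget (z (places tetra g).2.1) (places tetra g).2.2)%:R.
Proof.
pose H (g : 'I_6) t : F :=
  (admissible i0 tetra 0 (if p then 3 else 1) [ffun=> t] (z 0%N) (z (if p then 3 else 1)%N) g)%:R *
  (admissible i0 tetra (if p then 1 else 2) (if p then 2 else 3) [ffun=> t]
     (z (if p then 1 else 2)%N) (z (if p then 2 else 3)%N) g)%:R.
transitivity (\sum_(y : X) \prod_(g < 6) H g (y g)).
  apply: eq_bigr => y _; rewrite /corner -big_split /=; apply: eq_bigr => g _.
  by rewrite /H !(admissible_const _ _ _ y) /o6 inord_val.
rewrite -bigA_distr_bigA /=; apply: eq_bigr => g _; rewrite /H /admissible.
under eq_bigr do rewrite !ffunE.
case: g => [[|[|[|[|[|[|?]]]]]] ?] //; case: tetra {H}; case: p => /=;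
  rewrite ?sum_pinned ?sum_pinned' ?sum_eq_eq //; by rewrite eq_sym.
Qed.
End VertexSum.

(** * The contraction of a graph as a trace along its circuit *)

Section Assembly.
Variables (F : numClosedFieldType) (n : nat) (tetra : 'I_n -> bool).
Notation S := ('I_n * 'I_4)%type.
Variable mate : S -> S.
Hypothesis mateK : involutive mate.
Hypothesis mateF : forall s, mate s != s.
Hypothesis mate_connected : forall P : pred 'I_n, (exists v, P v) ->
  (forall v a, P v -> P (mate (v, a)).1) -> forall v, P v.
Variable o : rel S.
Hypothesis oN : forall s, o (mate s) s = ~~ o s (mate s).

Variables (I : finType) (i0 : I) (d : nat).
Notation J := (I * I * I)%type.
Variable E : 'I_d -> J -> F.
Hypothesis oE : orthonormal E.
Hypothesis tE : traceable #|I|%:R E.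
Hypothesis dI : (d <= #|I| * #|I|)%N.
Hypothesis n0 : (0 < n)%N.

Notation X := {ffun 'I_6 -> I}.

Definition slot_at (mu : {ffun S -> J}) (v : 'I_n) (p : nat * nat) : I := jget (mu (v, inord p.1)) p.2.

(** The amplitude after all integrations: a tensor index at every slot triple, a projector on every
    line, and for every vertex variable an identification of the indices at its two places. *)
Definition contraction : F :=
  \sum_(mu : {ffun S -> J}) (\prod_(s | o s (mate s)) proj E (mu s) (mu (mate s))) *
    \prod_v \prod_(g < 6) (slot_at mu v (places (tetra v) g).1 ==
                            slot_at mu v (places (tetra v) g).2)%:R.

Let s0 : S := (Ordinal n0, ord0).

Section Circuit.
Variable c : {ffun 'I_n -> bool}.
Let f := turn mate (opposite c).
Hypothesis f_period : iter (2 * n) f s0 = s0.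
Hypothesis f_cover : forall s, (exists2 i, (i < 2 * n)%N & s = iter i f s0) \/
    (exists2 i, (i < 2 * n)%N & s = opposite c (iter i f s0)).
Hypothesis f_inj : forall i j, (i < 2 * n)%N -> (j < 2 * n)%N -> iter i f s0 = iter j f s0 -> i = j.

Definition inslot (i : nat) : S := iter i f s0.
Definition outslot (i : nat) : S := opposite c (inslot i).

Lemma mate_outslot i : mate (outslot i) = inslot i.+1.
Proof. by []. Qed.

Lemma inslot_neq_outslot i j : inslot i != outslot j.
Proof. exact: iter_turn_disjoint mateK (oppositeK c) mateF (oppositeF c) i j s0. Qed.

Lemma big_slots (R : Type) (idx : R) (op : Monoid.com_law idx) (G : S -> R) :
  \big[op/idx]_s G s = \big[op/idx]_(i < 2 * n) op (G (inslot i)) (G (outslot i)).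
Proof.
rewrite big_split /=.
pose isin s := [exists i : 'I_(2 * n), s == inslot i].
rewrite (bigID isin) /=; congr (op _ _).
  rewrite (reindex (fun i : 'I_(2 * n) => inslot i)) /=; last first.
    pose i1 : 'I_(2 * n) := Ordinal (ltn_addr (n + 0) n0 : 0 < 2 * n)%N.
    exists (fun s => odflt i1 [pick i : 'I_(2 * n) | s == inslot i]) => [i _|s /existsP [i /eqP ->]].
      case: pickP => [j /eqP /f_inj e|/(_ i)]; last by rewrite eqxx.
      by apply: val_inj; rewrite /= e.
    by case: pickP => [j /eqP //|/(_ i)]; rewrite eqxx.
  by apply: eq_bigl => i; apply/existsP; exists i.
rewrite (reindex (fun i : 'I_(2 * n) => outslot i)) /=; last first.
  pose i1 : 'I_(2 * n) := Ordinal (ltn_addr (n + 0) n0 : 0 < 2 * n)%N.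
  exists (fun s => odflt i1 [pick i : 'I_(2 * n) | s == outslot i]) => [i _|s ns].
    case: pickP => [j /eqP /(inv_inj (oppositeK c)) /f_inj e|/(_ i)]; last by rewrite eqxx.
    by apply: val_inj; rewrite /= e.
  have [[i i2 e]|[i i2 e]] := f_cover s.
    by case/existsP: ns; exists (Ordinal i2); rewrite e.
  by case: pickP => [j /eqP //|/(_ (Ordinal i2))]; rewrite /= e eqxx.
apply: eq_bigl => i; apply/existsP => -[j /eqP e].
by have := inslot_neq_outslot j i; rewrite e eqxx.
Qed.

(** The line from the previous corner into the [i]-th one, read in the direction of the circuit. *)
Definition entering (i : nat) : J -> J -> F := proj (orient E (o (mate (inslot i)) (inslot i))).

Lemma entering_conj i z z' : (entering i z z')^* = entering i z' z.
Proof. exact: proj_conj. Qed.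

Lemma prod_lines (mu : {ffun S -> J}) :
  \prod_(s | o s (mate s)) proj E (mu s) (mu (mate s)) =
  \prod_(i < 2 * n) entering i.+1 (mu (outslot i)) (mu (inslot i.+1)).
Proof.
pose G s := if o s (mate s) then proj E (mu s) (mu (mate s)) else 1.
rewrite big_mkcond /= big_slots /=.
transitivity (\prod_(i < 2 * n) G (inslot i) * \prod_(i < 2 * n) G (outslot i)).
  by rewrite -big_split.
(* The cyclic shift brings together the two ends of a line, [outslot i] and [inslot i.+1]; exactly
   one of them carries the kernel. *)
have -> : \prod_(i < 2 * n) G (inslot i) = \prod_(i < 2 * n) G (inslot i.+1).
  by apply: (@prod_shift _ (2 * n) (fun i => G (inslot i))); rewrite /inslot f_period.
rewrite -big_split /=; apply: eq_bigr => i _.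
rewrite /entering -mate_outslot /G mateK oN; case: (o _ _) => /=; first by rewrite mul1r.
by rewrite mulr1 proj_orientN.
Qed.

Lemma opposite_inslot s :
  [exists i : 'I_(2 * n), opposite c s == inslot i] = ~~ [exists i : 'I_(2 * n), s == inslot i].
Proof.
have [[j j2 e]|[j j2 e]] := f_cover s.
  have -> : [exists i : 'I_(2 * n), s == inslot i] by apply/existsP; exists (Ordinal j2); rewrite e.
  apply/existsP => -[i /eqP e']; have := inslot_neq_outslot i j.
  by rewrite -e' /outslot /inslot -e eqxx.
have -> : [exists i : 'I_(2 * n), opposite c s == inslot i].
  by apply/existsP; exists (Ordinal j2); rewrite e oppositeK.
symmetry; apply/negPn/existsP => -[i /eqP e']; have := inslot_neq_outslot i j.
by rewrite -e' /outslot /inslot -e eqxx.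
Qed.

(** Each corner has exactly one slot through which the circuit enters. As [G] takes the same value
    on both slots of a corner, the product is over the two corners of every vertex, in whatever
    direction they are crossed. *)
Lemma prod_corners (G : S -> F) : (forall s, G (opposite c s) = G s) ->
  \prod_(i < 2 * n) G (inslot i) =
  \prod_v (G (v, inord 0) * G (v, inord (if c v then 1 else 2))).
Proof.
move=> Gsym.
pose isin s := [exists i : 'I_(2 * n), s == inslot i].
pose H s := if isin s then G s else 1.
have isinN s : isin (opposite c s) = ~~ isin s by apply: opposite_inslot.
transitivity (\prod_s H s).
  rewrite big_slots /=; apply: eq_bigr => i _; rewrite /H isinN.
  have -> : isin (inslot i) by apply/existsP; exists i.
  by rewrite mulr1.
rewrite [LHS](eq_bigr (fun s => H (s.1, s.2))) => [|[v a] //].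
rewrite -(pair_bigA _ (fun v a => H (v, a))) /=; apply: eq_bigr => v _.
have HH a : H (v, a) * H (v, partner (c v) a) = G (v, a).
  have := isinN (v, a); have := Gsym (v, a); rewrite /opposite /H /= => -> ->.
  by case: (isin _); rewrite ?mulr1 ?mul1r.
rewrite -!HH (eq_bigr (fun a : 'I_4 => H (v, inord a))) => [|a _]; last by rewrite inord_val.
rewrite -(big_mkord xpredT (fun k => H (v, inord k))) /index_iota /= !big_cons big_nil mulr1.
have P a b : (a < 4)%N -> (b < 4)%N ->
    (if c v then 3 - a else if odd a then a.-1 else a.+1)%N = b -> partner (c v) (inord a) = inord b.
  by move=> a4 b4 e; apply: val_inj; rewrite /= partnerE !inordK.
case: (c v) P => P.
  rewrite (P 0%N 3%N isT isT erefl) (P 1%N 2%N isT isT erefl).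
  by move: (H (v, inord 0)) (H (v, inord 1)) (H (v, inord 2)) (H (v, inord 3)) => *; ring.
rewrite (P 0%N 1%N isT isT erefl) (P 2%N 3%N isT isT erefl).
by move: (H (v, inord 0)) (H (v, inord 1)) (H (v, inord 2)) (H (v, inord 3)) => *; ring.
Qed.

Definition in_corner (i : nat) (y : X) : J -> J -> F :=
  corner F i0 (tetra (inslot i).1) (inslot i).2 (outslot i).2 y.

Lemma prod_places (mu : {ffun S -> J}) :
  \prod_v \prod_(g < 6) (slot_at mu v (places (tetra v) g).1 ==
                          slot_at mu v (places (tetra v) g).2)%:R =
  \sum_(x : {ffun 'I_n -> X}) \prod_(i < 2 * n)
     in_corner i (x (inslot i).1) (mu (inslot i)) (mu (outslot i)).
Proof.
pose G (x : {ffun 'I_n -> X}) (s : S) := corner F i0 (tetra s.1) s.2 (opposite c s).2 (x s.1)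
  (mu s) (mu (opposite c s)).
have Gsym x s : G x (opposite c s) = G x s.
  rewrite /G oppositeK corner_sym //.
  by case: s => v a; rewrite /= partner_neq.
under [RHS]eq_bigr => x _ do rewrite (prod_corners (Gsym x)).
pose L v (y : X) := corner F i0 (tetra v) 0 (if c v then 3 else 1) y (mu (v, inord 0))
    (mu (v, inord (if c v then 3 else 1))) *
  corner F i0 (tetra v) (if c v then 1 else 2) (if c v then 2 else 3) y
    (mu (v, inord (if c v then 1 else 2))) (mu (v, inord (if c v then 2 else 3))).
rewrite [RHS](eq_bigr (fun x : {ffun 'I_n -> X} => \prod_v L v (x v))); last first.
  move=> x _; apply: eq_bigr => v _; rewrite /G /L /opposite /=.
  have P a : partner (c v) a = inord (if c v then 3 - a else if odd a then a.-1 else a.+1)%N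
    by rewrite -partnerE inord_val.
  by rewrite !P; case: (c v); rewrite !inordK.
rewrite -bigA_distr_bigA /=; apply: eq_bigr => v _.
by rewrite -(vertex_sum F i0 (tetra v) (c v) (fun k => mu (v, inord k))).
Qed.

Lemma sum_slots (G : {ffun 'I_(2 * n) -> J} -> {ffun 'I_(2 * n) -> J} -> F) :
  \sum_(mu : {ffun S -> J}) G [ffun i : 'I_(2 * n) => mu (inslot i)] [ffun i : 'I_(2 * n) => mu (outslot i)] =
  \sum_b \sum_g G b g.
Proof.
rewrite pair_bigA /= [RHS](reindex (fun mu : {ffun S -> J} =>
  ([ffun i : 'I_(2 * n) => mu (inslot i)], [ffun i : 'I_(2 * n) => mu (outslot i)]))) //=.
exists (fun q : {ffun 'I_(2 * n) -> J} * {ffun 'I_(2 * n) -> J} => [ffun s =>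
  if [pick i : 'I_(2 * n) | s == inslot i] is Some i then q.1 i
  else if [pick i : 'I_(2 * n) | s == outslot i] is Some i then q.2 i else (i0, i0, i0)]).
  move=> mu _; apply/ffunP => s; rewrite !ffunE.
  case: pickP => [i /eqP ->|ni] /=; first by rewrite ffunE.
  case: pickP => [i /eqP ->|no] /=; first by rewrite ffunE.
  have [[i i2 e]|[i i2 e]] := f_cover s.
    by have := ni (Ordinal i2); rewrite /= e eqxx.
  by have := no (Ordinal i2); rewrite /= e eqxx.
move=> [b g] _; congr (_, _); apply/ffunP => i; rewrite !ffunE /=.
  case: pickP => [j /eqP /f_inj e|/(_ i)]; last by rewrite eqxx.
  by congr (b _); apply: val_inj; rewrite /= e.
case: pickP => [j /eqP e|_]; first by have := inslot_neq_outslot j i; rewrite e eqxx.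
case: pickP => [j /eqP /(inv_inj (oppositeK c)) /f_inj e|/(_ i)]; last by rewrite eqxx.
by congr (g _); apply: val_inj; rewrite /= e.
Qed.

Definition step (x : {ffun 'I_n -> X}) (i : nat) : J -> J -> F :=
  kcomp (in_corner i (x (inslot i).1)) (entering i.+1).

Lemma inslot_ordS (i : 'I_(2 * n)) : inslot (ordS i) = inslot i.+1.
Proof.
have -> : ordS i = (i.+1 %% (2 * n))%N :> nat by [].
have := ltn_ord i; rewrite leq_eqVlt => /orP [/eqP e|lt]; last by rewrite modn_small.
by rewrite e modnn /inslot f_period.
Qed.

(** For fixed labels, the index at an outslot composes a corner with the next line, and the indices
    at the inslots run along a closed path. *)
Lemma contraction_trace :
  contraction = \sum_(x : {ffun 'I_n -> X}) \sum_j kprod (step x) (2 * n) j j.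
Proof.
rewrite /contraction.
transitivity (\sum_(x : {ffun 'I_n -> X}) \sum_(mu : {ffun S -> J}) \prod_(i < 2 * n)
   (in_corner i (x (inslot i).1) (mu (inslot i)) (mu (outslot i)) *
    entering i.+1 (mu (outslot i)) (mu (inslot (ordS i))))).
  rewrite exchange_big /=; apply: eq_bigr => mu _.
  rewrite prod_lines prod_places big_distrr /=; apply: eq_bigr => x _.
  rewrite big_split /= mulrC; congr (_ * _).
  apply: eq_bigr => i _; congr (entering _ _ (mu _)); symmetry; exact: inslot_ordS.
apply: eq_bigr => x _; rewrite -sum_cycle ?muln_gt0 ?n0 //.
have := sum_slots (fun b g => \prod_(i < 2 * n)
  (in_corner i (x (inslot i).1) (b i) (g i) * entering i.+1 (g i) (b (ordS i)))).
under eq_bigr do under eq_bigr do rewrite !ffunE.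
move=> ->; apply: eq_bigr => b _.
rewrite -(bigA_distr_bigA (fun (i : 'I_(2 * n)) j =>
  in_corner i (x (inslot i).1) (b i) j * entering i.+1 j (b (ordS i)))) /=.
by apply: eq_bigr.
Qed.

(** Idempotence allows every line projector to be doubled, so each corner stands between two
    projectors: the left one serves the opening bound, the right one the bound on the adjoint. *)
Definition in_letter (i : nat) : letter F 'I_n X J :=
  ((inslot i).1, fun y => kcomp (entering i) (kcomp (in_corner i y) (entering i.+1))).

Definition word : seq (letter F 'I_n X J) := map in_letter (iota 0 (2 * n)).

Lemma entering_orthonormal i : orthonormal (orient E (o (mate (inslot i)) (inslot i))).
Proof. exact: orient_orthonormal. Qed.

Lemma entering_idem i u : kapp (entering i) (kapp (entering i) u) =1 kapp (entering i) u.
Proof. by apply: proj_idem; apply: entering_orthonormal. Qed.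

Lemma entering_period : entering (2 * n) = entering 0.
Proof. by rewrite /entering /inslot f_period. Qed.

Lemma capply_word x u : kapp (entering 0) u =1 u ->
  capply word x u =1 kapp (entering 0) (foldr (fun i => kapp (step x i)) u (iota 0 (2 * n))).
Proof.
move=> u0; rewrite /word.
have H r k : (k + r = 2 * n)%N -> capply (map in_letter (iota k r)) x u =1
    kapp (entering k) (foldr (fun i => kapp (step x i)) u (iota k r)).
  elim: r k => [|r IH] k e j; first by rewrite /= -(u0 j) -entering_period -e addn0.
  rewrite /= kapp_kcomp; apply: eq_kapp => {}j; rewrite !kapp_kcomp; apply: eq_kapp => {}j.
  rewrite (eq_kapp _ (IH k.+1 _)) ?addSnnS //; exact: entering_idem.
exact: H.
Qed.

(** Each corner uses two of the four slots of [v]; the count is doubled to be read off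
    [big_slots]. *)
Lemma occ_word v : occ word v = 2%N.
Proof.
have h : (occ word v * 2 = 4)%N.
  have -> : occ word v = (\sum_(i < 2 * n) ((inslot i).1 == v))%N.
    rewrite /occ /word -map_comp; rewrite -(big_mkord xpredT (fun i => ((inslot i).1 == v : nat))).
    rewrite /index_iota subn0; elim: (iota _ _) => [|i s IH] /=; first by rewrite big_nil.
    by rewrite big_cons IH.
  have := big_slots addn (fun s => ((s.1 == v) : nat)); rewrite /= big_split /= addnn -muln2 => <-.
  rewrite -(pair_bigA _ (fun w (_ : 'I_4) => ((w == v) : nat))) /= (bigD1 v) //= eqxx.
  rewrite sum_nat_const card_ord big1 ?addn0 // => w /negPf ->.
  by rewrite big1.
by move: h; lia.
Qed.

Lemma word_bounds v B : List.In (v, B) word -> opening_bound #|I|%:R B /\ closing_bound #|I|%:R B.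
Proof.
rewrite /word; elim: (iota _ _) => //= i s IH [[_ <-]|/IH //] {IH}.
set tv := tetra (inslot i).1.
have N0 : 0 <= #|I|%:R :> F by apply: ler0n.
have ac : allowed tv (inslot i).2 (outslot i).2 /\ allowed tv (outslot i).2 (inslot i).2.
  rewrite /outslot /opposite /=; case: (inslot i).2 => a a4.
  by split; rewrite /allowed partnerE /=; case: (c _); case: tv; case: a a4 => [|[|[|[|?]]]].
have op (i' j' : nat) (a a' : 'I_4) : allowed tv a a' -> forall u,
    \sum_y nrm2 (kapp (entering i') (kapp (corner F i0 tv a a' y) (kapp (entering j') u))) <=
    #|I|%:R * nrm2 u.
  move=> al u; have tr k w := traceable_proj (entering_orthonormal i') (orient_traceable _ tE) k w.
  have con v' : nrm2 (kapp (entering i') v') <= nrm2 v'.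
    by apply: nrm2_proj_le; apply: entering_orthonormal.
  apply: le_trans (@corner_bound _ _ i0 _ _ tr con erefl tv _ _ _ (ltn_ord a) (ltn_ord a') al) _.
  by apply: ler_wpM2l => //; apply: nrm2_proj_le; apply: entering_orthonormal.
split.
  move=> u; apply: le_trans (op i i.+1 _ _ ac.1 u); rewrite le_eqVlt; apply/orP; left; apply/eqP.
  apply: eq_bigr => y _; apply: eq_nrm2 => j.
  by rewrite kapp_kcomp; apply: eq_kapp => {}j; rewrite kapp_kcomp.
(* The adjoint letter is the same corner crossed in the other direction, with the two projectors
   exchanged. *)
apply: closing_bound_adjoint => // u.
apply: le_trans (op i.+1 i _ _ ac.2 u); rewrite le_eqVlt; apply/orP; left; apply/eqP.
apply: eq_bigr => y _; apply: eq_nrm2 => j; rewrite -!kapp_kcomp; apply: eq_bigr => k _.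
congr (_ * _); rewrite /adjoint /kcomp rmorph_sum /=.
transitivity (\sum_j0 \sum_j1 entering i.+1 j j1 * corner F i0 tv (outslot i).2 (inslot i).2 y j1 j0 * entering i j0 k).
  apply: eq_bigr => j0 _; rewrite rmorphM [X in _ * X]rmorph_sum /= mulrC big_distrl /=.
  apply: eq_bigr => j1 _; rewrite rmorphM /= !entering_conj /in_corner corner_real corner_sym; last first.
    by have /andP [] := ac.1.
  by rewrite -/tv; ring.
by apply: eq_bigr => j0 _; rewrite big_distrl.
Qed.

(** The trace is taken with the columns of the projector closing the circuit in place of the
    standard basis: their squared norms add up to the rank [d], not to [#|J|]. *)
Definition column (j : J) : J -> F := fun i => entering 0 i j.

Lemma kapp_indicator K (j : J) : kapp K (fun k => (k == j)%:R) =1 (fun i => K i j) :> (J -> F).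
Proof.
move=> i; rewrite /kapp (bigD1 j) //= eqxx mulr1 big1 ?addr0 // => k /negPf ->.
by rewrite mulr0.
Qed.

Lemma kapp_column j : kapp (entering 0) (column j) =1 column j.
Proof.
move=> i; rewrite -[RHS](kapp_indicator (entering 0) j i) -[RHS]entering_idem.
by apply: eq_kapp => k; rewrite kapp_indicator.
Qed.

Lemma nrm2_column j : nrm2 (column j) = entering 0 j j.
Proof.
rewrite -[RHS](kapp_column j j) nrm2E; apply: eq_bigr => k _.
by rewrite mulrC /column entering_conj.
Qed.

Lemma kprod_column x j : kprod (step x) (2 * n) j j = kapp (kprod (step x) (2 * n)) (column j) j.
Proof.
rewrite -[LHS](kapp_indicator (kprod (step x) (2 * n))).
have [m em] : exists m, (2 * n = m.+1)%N by exists (2 * n).-1; rewrite prednK // muln_gt0 n0.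
have := entering_period; rewrite em /= => per.
rewrite !kapp_kcomp; apply: eq_kapp => i; rewrite !kapp_kcomp; apply: eq_kapp => {}i.
by rewrite per kapp_column kapp_indicator.
Qed.

Lemma trace_columns x : \sum_j kprod (step x) (2 * n) j j =
  \sum_j \sum_k (column j k)^* * capply word x (column j) k.
Proof.
pose T := kapp (kprod (step x) (2 * n)).
have cE j : capply word x (column j) =1 kapp (entering 0) (T (column j)).
  move=> k; rewrite (capply_word x (kapp_column j)); apply: eq_kapp => {}k.
  by rewrite /T kapp_kprod.
transitivity (\sum_j kapp (entering 0) (T (column j)) j); last first.
  apply: eq_bigr => j _; rewrite -entering_idem; apply: eq_bigr => k _.
  by rewrite cE /column entering_conj.
rewrite [RHS]exchange_big /=; apply: eq_bigr => k _; rewrite kprod_column.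
transitivity (kapp (kprod (step x) (2 * n)) (fun i => \sum_j entering 0 j k * column j i) k).
  apply: eq_kapp => i; rewrite -[LHS](kapp_column k i); apply: eq_bigr => j _.
  by rewrite mulrC.
rewrite kapp_sum; apply: eq_bigr => j _; rewrite /T /kapp big_distrr /=.
by apply: eq_bigr => i _; rewrite mulrCA.
Qed.

(** Each column is paired with the label sum of the word applied to it, a vector longer by a factor
    at most [N ^ n] by [chord_bound]. The columns contribute [d <= N ^ 2] in total. *)
Lemma circuit_bound : `|contraction| <= #|I|%:R ^+ (n + 2).
Proof.
set N : F := #|I|%:R.
have N0 : 0 <= N by apply: ler0n.
rewrite contraction_trace; under eq_bigr do rewrite trace_columns.
rewrite exchange_big /=.
have -> : \sum_j \sum_x \sum_k (column j k)^* * capply word x (column j) k =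
    \sum_j \sum_k (column j k)^* * \sum_x capply word x (column j) k.
  apply: eq_bigr => j _; rewrite exchange_big /=; apply: eq_bigr => k _.
  by rewrite big_distrr.
apply: le_trans (ler_norm_sum _ _ _) _.
apply: (@le_trans _ _ (\sum_j N ^+ n * nrm2 (column j))).
  apply: ler_sum => j _.
  rewrite -(@ler_pXn2r _ 2) ?nnegrE ?normr_ge0 ?mulr_ge0 ?exprn_ge0 ?nrm2_ge0 //.
  apply: le_trans (cauchy_schwarz _ _) _.
  have -> : nrm2 (fun k => (column j k)^*) = nrm2 (column j).
    by apply: eq_bigr => k _; rewrite norm_conjC.
  rewrite (_ : _ ^+ 2 = nrm2 (column j) * (N ^+ (2 * n) * nrm2 (column j))); last first.
    by rewrite mulnC exprM; ring.
  apply: ler_wpM2l; first exact: nrm2_ge0.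
  have -> : (2 * n = 2 * #|'I_n|)%N by rewrite card_ord.
  apply: chord_bound => //.
  - by apply/card_gt0P; exists [ffun=> i0].
  - exact: occ_word.
  - exact: word_bounds.
rewrite -big_distrr /= exprD; apply: ler_wpM2l; first exact: exprn_ge0.
under eq_bigr do rewrite nrm2_column.
by rewrite proj_trace ?expr2 -?natrM ?ler_nat //; apply: entering_orthonormal.
Qed.

End Circuit.

Lemma contraction_bound : `|contraction| <= #|I|%:R ^+ (n + 2).
Proof.
have [c [per cov inj]] := euler_circuit mateK mateF mate_connected s0.
exact: circuit_bound per cov inj.
Qed.

End Assembly.

(** * Orthonormal bases of polynomials *)

(** The facts on the integral are restated with the ring structure of [R], whose operations are
    convertible to those of the real numbers used so far. *)
Lemma haarR_add (f f' : su2 -> R) : is_poly f -> is_poly f' ->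
  haarR (fun g => f g + f' g) = haarR f + haarR f'.
Proof. exact: haarR_plus. Qed.

Lemma haarR_mul (c : R) (f : su2 -> R) : is_poly f -> haarR (fun g => c * f g) = c * haarR f.
Proof. exact: haarR_scal. Qed.

Lemma poly_add (f f' : su2 -> R) : is_poly f -> is_poly f' -> is_poly (fun g => f g + f' g).
Proof. exact: poly_plus. Qed.

Lemma poly_mul (f f' : su2 -> R) : is_poly f -> is_poly f' -> is_poly (fun g => f g * f' g).
Proof. exact: poly_mult. Qed.

Lemma poly_scal (c : R) (f : su2 -> R) : is_poly f -> is_poly (fun g => c * f g).
Proof. by apply: poly_mul; apply: poly_const. Qed.

Lemma eq_haarR (f f' : su2 -> R) : (forall g, f g = f' g) -> haarR f = haarR f'.
Proof. by move=> e; apply: haarR_ext. Qed.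

Lemma poly_sum (I : Type) (r : seq I) (P : pred I) (f : I -> su2 -> R) : (forall i, is_poly (f i)) ->
  is_poly (fun g => \sum_(i <- r | P i) f i g).
Proof.
move=> pf; elim: r => [|i r IH].
  by apply: (poly_ext (fun=> 0)) (poly_const 0) => g _; rewrite big_nil.
apply: (poly_ext (fun g => (if P i then f i g else 0) + \sum_(j <- r | P j) f j g)).
  by move=> g _; rewrite big_cons; case: (P i); rewrite ?add0r.
by apply: poly_add => //; case: (P i) => //; apply: poly_const.
Qed.

Lemma haarR_sum (I : Type) (r : seq I) (P : pred I) (f : I -> su2 -> R) : (forall i, is_poly (f i)) ->
  haarR (fun g => \sum_(i <- r | P i) f i g) = \sum_(i <- r | P i) haarR (f i).
Proof.
move=> pf; elim: r => [|i r IH].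
  under eq_haarR do rewrite big_nil.
  rewrite big_nil.
  have := @haarR_mul 0 (fun=> 1) (poly_const 1).
  by under eq_haarR do rewrite mul0r; rewrite mul0r.
under eq_haarR do rewrite big_cons.
rewrite big_cons; case: (P i); last exact: IH.
by rewrite haarR_add ?IH //; apply: poly_sum.
Qed.

Lemma haarR_ge0 (f : su2 -> R) : is_poly f -> (forall g, is_su2 g -> 0 <= f g) -> 0 <= haarR f.
Proof. by move=> pf f0; apply/RleP; apply: haarR_nonneg => // g /f0 /RleP. Qed.

Lemma haarR_le (f f' : su2 -> R) : is_poly f -> is_poly f' ->
  (forall g, is_su2 g -> f g <= f' g) -> haarR f <= haarR f'.
Proof.
move=> pf pf' le; rewrite -subr_ge0.
have -> : haarR f' - haarR f = haarR (fun g => f' g + (-1) * f g).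
  by rewrite haarR_add ?haarR_mul ?mulN1r //; apply: poly_scal.
apply: haarR_ge0 => [|g /le]; first by apply: poly_add => //; apply: poly_scal.
by rewrite mulN1r subr_ge0.
Qed.

Section OrthonormalBasis.
Variables (T : finType) (m : T -> su2 -> R) (W : (su2 -> R) -> Prop).
Hypothesis Wpoly : forall f, W f -> is_poly f.
Hypothesis mpoly : forall t, is_poly (m t).
Hypothesis Wspan : forall f, W f ->
  exists c : T -> R, forall g, is_su2 g -> f g = \sum_t c t * m t g.
Hypothesis WD : forall f f', W f -> W f' -> W (fun g => f g + f' g).
Hypothesis WZ : forall c f, W f -> W (fun g => c * f g).

Definition orthonormal_in (k : nat) (p : 'I_k -> su2 -> R) : Prop :=
  (forall i, W (p i)) /\ forall i j, haarR (fun g => p i g * p j g) = (i == j)%:R.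

(** With [c] the coordinates in the spanning family [m] and [G] its Gram matrix, orthonormality
    reads [A G A^T = 1], which bounds the rank. The family [m] may be linearly dependent. *)
Lemma orthonormal_in_card (k : nat) (p : 'I_k -> su2 -> R) : orthonormal_in p -> (k <= #|T|)%N.
Proof.
move=> [Wp op].
have [c Hc] := choice (fun i => Wspan (Wp i)).
pose A := \matrix_(i < k, t < #|T|) c i (enum_val t).
pose G := \matrix_(s < #|T|, t < #|T|) haarR (fun g => m (enum_val s) g * m (enum_val t) g).
have AGA : A *m (G *m A^T) = 1%:M.
  apply/matrixP => i j; rewrite !mxE -op.
  rewrite (haarR_ext _ (fun g => \sum_(s < #|T|) \sum_(t < #|T|)
     (c i (enum_val s) * c j (enum_val t)) * (m (enum_val s) g * m (enum_val t) g))).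
    have pm s t : is_poly (fun g => m (enum_val s) g * m (enum_val t) g) by apply: poly_mul.
    rewrite haarR_sum => [|s]; last by apply: poly_sum => t; apply: poly_scal.
    apply: eq_bigr => s _; rewrite haarR_sum => [|t]; last exact: poly_scal.
    rewrite !mxE big_distrr; apply: eq_bigr => t _ /=.
    by rewrite haarR_mul // !mxE -mulrA [c j _ * _]mulrC.
  move=> g Hg; rewrite !Hc // [in LHS](reindex _ (onW_bij _ (@enum_val_bij T))) /=.
  rewrite [X in _ * X](reindex _ (onW_bij _ (@enum_val_bij T))) /= big_distrl.
  apply: eq_bigr => s _ /=; rewrite big_distrr; apply: eq_bigr => t _ /=.
  by rewrite mulrACA.
exact: mulmx1_min AGA.
Qed.

(** A maximal orthonormal family again; that a residual of norm zero vanishes on the group is the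
    definiteness [haarR_sqr_zero]. *)
Lemma orthonormal_basis : exists (N : nat) (p : 'I_N -> su2 -> R), [/\ (N <= #|T|)%N,
  orthonormal_in p & forall f, W f -> forall g, is_su2 g ->
    f g = \sum_i haarR (fun h => f h * p i h) * p i g].
Proof.
pose Q k := `[< exists p : 'I_k -> su2 -> R, orthonormal_in p >].
have Q0 : exists k, Q k.
  by exists 0%N; apply/asboolP; exists (fun _ _ => 0); split=> [[]|[]].
have Qb k : Q k -> (k <= #|T|)%N by move=> /asboolP [p /orthonormal_in_card].
case: (ex_maxnP Q0 Qb) => N QN Nmax.
have [p op] := asboolP _ QN.
exists N, p; split => //; first exact: Qb.
move=> f Wf g Hg; have [Wp pp] := op.
have pfp i : is_poly (fun h => f h * p i h) by apply: poly_mul; apply: Wpoly.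
pose a i := haarR (fun h => f h * p i h).
pose r h := f h + \sum_i (- a i) * p i h.
have Wr : W r.
  rewrite /r; elim: (index_enum _) => [|i s IH].
    by have -> : (fun h => f h + \sum_(i <- [::]) - a i * p i h) = f
      by apply: funext => h; rewrite big_nil addr0.
  have -> : (fun h => f h + \sum_(k <- i :: s) - a k * p k h) =
    fun h => (- a i * p i h) + (f h + \sum_(k <- s) - a k * p k h).
    by apply: funext => h; rewrite big_cons addrCA.
  by apply: WD => //; apply: WZ.
have rp j : haarR (fun h => r h * p j h) = 0.
  rewrite (haarR_ext _ (fun h => f h * p j h + \sum_i (- a i) * (p i h * p j h))); last first.
    by move=> h _; rewrite mulrDl big_distrl; congr (_ + _); apply: eq_bigr => i _; rewrite mulrA.
  have pij i : is_poly (fun h => p i h * p j h) by apply: poly_mul; apply: Wpoly.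
  rewrite haarR_add //; last by apply: poly_sum => i; apply: poly_scal.
  rewrite haarR_sum => [|i]; last exact: poly_scal.
  under eq_bigr do rewrite haarR_mul // pp.
  rewrite (bigD1 j) //= eqxx mulr1 big1 ?addr0 ?subrr // => i /negPf ->.
  by rewrite mulr0.
have rr : haarR (fun h => r h * r h) = 0.
  apply: contrapT => rr0.
  have prr : is_poly (fun h => r h * r h) by apply: poly_mul; apply: Wpoly.
  have rr1 : 0 < haarR (fun h => r h * r h).
    rewrite lt_neqAle eq_sym; apply/andP; split; first exact/eqP.
    by apply: haarR_ge0 => // h _; rewrite -expr2 sqr_ge0.
  pose z := (Num.sqrt (haarR (fun h => r h * r h)))^-1.
  have zz : z * z * haarR (fun h => r h * r h) = 1.
    by rewrite -invfM -expr2 sqr_sqrtr ?mulVf ?lt0r_neq0 // ltW.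
  suff /Nmax : Q N.+1 by rewrite ltnn.
  apply/asboolP.
  exists (fun i : 'I_N.+1 => if unlift ord_max i is Some j then p j else fun h => z * r h).
  split=> [i|i j]; first by case: unliftP => [j|] _; [exact: Wp|exact: WZ].
  have pr k : is_poly (fun h => r h * p k h) by apply: poly_mul; apply: Wpoly.
  case: (unliftP ord_max i) => [i' ->|->]; case: (unliftP ord_max j) => [j' ->|->].
  - by rewrite pp (inj_eq lift_inj).
  - under eq_haarR do rewrite mulrCA [_ * r _]mulrC.
    by rewrite haarR_mul // rp mulr0 eq_sym (negPf (neq_lift _ _)).
  - under eq_haarR do rewrite -mulrA.
    by rewrite haarR_mul // rp mulr0 (negPf (neq_lift _ _)).
  - under eq_haarR do rewrite mulrACA.
    by rewrite haarR_mul // zz eqxx.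
have := haarR_sqr_zero r (Wpoly Wr) rr g Hg.
rewrite /r => /eqP; rewrite addr_eq0 => /eqP ->.
by rewrite -sumrN; apply: eq_bigr => i _; rewrite mulNr opprK.
Qed.
End OrthonormalBasis.

(** * Complex numbers and means of complex functions *)

Local Open Scope complex_scope.

Notation CC := (complex R).

Definition toC (z : C) : CC := z.1 +i* z.2.
Definition ofC (z : CC) : C := (complex.Re z, complex.Im z).

Lemma toCK : cancel toC ofC. Proof. by case. Qed.
Lemma ofCK : cancel ofC toC. Proof. by case. Qed.

Lemma toC_plus z w : toC (Cplus z w) = toC z + toC w. Proof. by case: z; case: w. Qed.
Lemma toC_mult z w : toC (Cmult z w) = toC z * toC w. Proof. by case: z; case: w. Qed.
Lemma toC_conj z : toC (Cconj z) = Num.conj (toC z). Proof. by case: z. Qed.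
Lemma toC_norm z : `|toC z| = (Cmod z)%:C.
Proof. by rewrite normc_def; congr (_%:C); rewrite /Cmod RsqrtE !RpowE. Qed.

Lemma conj_real (x : R) : Num.conj (x%:C) = x%:C :> CC.
Proof. exact: conjc_real. Qed.

Lemma Re_sum (I : Type) (r : seq I) (f : I -> CC) :
  complex.Re (\sum_(i <- r) f i) = \sum_(i <- r) complex.Re (f i).
Proof. by apply: big_morph => // -[? ?] [? ?]. Qed.

Lemma Im_sum (I : Type) (r : seq I) (f : I -> CC) :
  complex.Im (\sum_(i <- r) f i) = \sum_(i <- r) complex.Im (f i).
Proof. by apply: big_morph => // -[? ?] [? ?]. Qed.

Lemma Re_scale (z : CC) (x : R) : complex.Re (z * x%:C) = complex.Re z * x.
Proof. by case: z => a b /=; rewrite mulr0 subr0. Qed.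

Lemma Im_scale (z : CC) (x : R) : complex.Im (z * x%:C) = complex.Im z * x.
Proof. by case: z => a b /=; rewrite mulr0 add0r. Qed.

Lemma complex_eq (z w : CC) : complex.Re z = complex.Re w -> complex.Im z = complex.Im w -> z = w.
Proof. by case: z; case: w => a b a' b' /= -> ->. Qed.

Definition mean (f : su2 -> CC) : CC :=
  haarR (fun g => complex.Re (f g)) +i* haarR (fun g => complex.Im (f g)).

Lemma toC_haar (f : su2 -> C) : toC (haar f) = mean (fun g => toC (f g)).
Proof. by []. Qed.

Lemma mean_ext (f f' : su2 -> CC) : (forall g, is_su2 g -> f g = f' g) -> mean f = mean f'.
Proof. by move=> e; apply: complex_eq; apply: haarR_ext => g Hg; rewrite e. Qed.

Section Expansion.
Variables (I : Type) (s : seq I) (c : I -> CC) (r : I -> su2 -> R) (f : su2 -> CC).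
Hypothesis rp : forall i, is_poly (r i).
Hypothesis fE : forall g, is_su2 g -> f g = \sum_(i <- s) c i * (r i g)%:C.

Lemma Re_poly : is_poly (fun g => complex.Re (f g)).
Proof.
apply: (poly_ext (fun g => \sum_(i <- s) complex.Re (c i) * r i g)).
  by move=> g /fE ->; rewrite Re_sum; apply: eq_bigr => i _; rewrite Re_scale.
by apply: poly_sum => i; apply: poly_scal.
Qed.

(** Coefficients are complex but the functions [r i] are real, so only integrals of real polynomials
    occur. *)
Lemma mean_expand : mean f = \sum_(i <- s) c i * (haarR (r i))%:C.
Proof.
apply: complex_eq.
  rewrite Re_sum /= (haarR_ext _ (fun g => \sum_(i <- s) complex.Re (c i) * r i g)); last first.
    by move=> g /fE ->; rewrite Re_sum; apply: eq_bigr => i _; rewrite Re_scale.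
  rewrite haarR_sum => [|i]; last exact: poly_scal.
  by apply: eq_bigr => i _; rewrite haarR_mul // Re_scale.
rewrite Im_sum /= (haarR_ext _ (fun g => \sum_(i <- s) complex.Im (c i) * r i g)); last first.
  by move=> g /fE ->; rewrite Im_sum; apply: eq_bigr => i _; rewrite Im_scale.
rewrite haarR_sum => [|i]; last exact: poly_scal.
by apply: eq_bigr => i _; rewrite haarR_mul // Im_scale.
Qed.

End Expansion.

Lemma haarR_cst (c : R) : haarR (fun=> c) = c.
Proof.
have := haarR_mul c (poly_const 1); rewrite [haarR (fun=> 1)]haarR_one => e.
by rewrite -[RHS]mulr1 -e; apply: eq_haarR => g; rewrite mulr1.
Qed.

Lemma mean_cst (c : CC) : mean (fun=> c) = c.
Proof. by apply: complex_eq; apply: haarR_cst. Qed.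

Lemma mean_le (f : su2 -> CC) (c : CC) : is_poly (fun g => complex.Re (f g)) ->
  (forall g, is_su2 g -> f g <= c) -> mean f <= c.
Proof.
move=> fp fc; rewrite lecE; apply/andP; split.
  (* In the order of the complex numbers both sides have the same imaginary part, so that of [f] is
     constant on the group. *)
  rewrite -{1}(haarR_cst (complex.Im c)); apply/eqP/haarR_ext => g /fc.
  by rewrite lecE => /andP [/eqP].
rewrite -(haarR_cst (complex.Re c)); apply: haarR_le => //; first exact: poly_const.
by move=> g /fc; rewrite lecE => /andP [].
Qed.

Section DegreeBasis.
Variable D : nat.
Notation T := ('I_2 * 'I_D.+1 * 'I_D.+1 * 'I_D.+1)%type.

Definition mono_of (t : T) : mono :=
  let '(i, j, k, l) := t in (nat_of_ord i, nat_of_ord j, nat_of_ord k, nat_of_ord l).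

Lemma dpoly_span (f : su2 -> R) : dpoly D f ->
  exists c : T -> R, forall g, is_su2 g -> f g = \sum_t c t * mval (mono_of t) (coords g).
Proof.
case/dpoly_reduce => p [Hp Ep].
suff [c Hc] : exists c : T -> R, forall x, pval p x = \sum_t c t * mval (mono_of t) x.
  by exists c => g Hg; rewrite Ep.
elim: p Hp {Ep} => [|[r m] p IH] Hp.
  by exists (fun=> 0) => x; rewrite big1 // => t _; rewrite mul0r.
have [t Ht|c Hc] := IH; first by apply: Hp; right.
have {Hp} := Hp (r, m) (or_introl erefl).
case: m => [[[i j] k] l] /= [/ssrnat.leP i1 [/ssrnat.leP jD [/ssrnat.leP kD /ssrnat.leP lD]]].
pose t0 : T := (inord i, inord j, inord k, inord l).
exists (fun t => (t == t0)%:R * r + c t) => x; rewrite pval_cons Hc /=.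
under [RHS]eq_bigr do rewrite mulrDl.
rewrite big_split; congr (_ + _); rewrite [RHS](bigD1 t0) //= eqxx mul1r.
rewrite [X in _ = _ + X]big1 ?addr0 => [|t /negPf ->]; last by rewrite !mul0r.
by rewrite /mono_of /t0 !inordK.
Qed.

Lemma degree_basis : exists (N : nat) (p : 'I_N -> su2 -> R), [/\ (N <= 2 * D.+1 ^ 3)%N,
  forall i, dpoly D (p i), forall i j, haarR (fun g => p i g * p j g) = (i == j)%:R &
  forall f, dpoly D f -> forall g, is_su2 g -> f g = \sum_i haarR (fun h => f h * p i h) * p i g].
Proof.
have [|t|f /dpoly_span //|f f'|c f|N [p [cN [Wp op] span]]] :=
  @orthonormal_basis T (fun t g => mval (mono_of t) (coords g)) (dpoly D).
- exact: dpoly_poly.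
- exact: poly_mono.
- exact: dpoly_plus.
- exact: dpoly_scal.
exists N, p; split => //.
by apply: leq_trans cN _; rewrite !card_prod !card_ord !expnS expn0 muln1 !mulnA.
Qed.

End DegreeBasis.

(** * Coefficients of invariant functions *)

(** Fubini for finite sums of products of one-variable polynomials. The integrand is compared only
    at points of SU(2); the default of [nth] is one of them. *)
Lemma toC_haarN (m : nat) (I : finType) (c : I -> CC) (r : I -> nat -> su2 -> R) (F : list su2 -> C) :
  (forall i k, is_poly (r i k)) ->
  (forall l, size l = m -> (forall k, is_su2 (nth su2_one l k)) ->
     toC (F l) = \sum_i c i * (\prod_(k < m) r i k (nth su2_one l k))%:C) ->
  toC (haarN m F) = \sum_i c i * (\prod_(k < m) haarR (r i k))%:C.
Proof.
move=> rp; elim: m c r F rp => [|m IH] c r F rp FE.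
  rewrite /= FE //; last by case=> [|k]; apply: su2_one_su2.
  by apply: eq_bigr => i _; rewrite !big_ord0.
rewrite [haarN _ _]/= toC_haar.
rewrite (@mean_expand I (index_enum I) (fun i => c i * (\prod_(k < m) haarR (r i k.+1))%:C)
  (fun i => r i 0%N)) => [|i|g Hg].
- apply: eq_bigr => i _; rewrite big_ord_recl -mulrA -rmorphM /=; congr (_ * _%:C).
  by rewrite mulrC.
- exact: rp.
rewrite (IH (fun i => c i * (r i 0%N g)%:C) (fun i k => r i k.+1)) => [|i k|l sl Hl].
- by apply: eq_bigr => i _; rewrite -!mulrA [X in _ * X]mulrC.
- exact: rp.
rewrite FE /= ?sl //; last by case.
apply: eq_bigr => i _; rewrite big_ord_recl -mulrA -rmorphM /=; congr (_ * _%:C).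
Qed.

Lemma toC_haar3 (I : finType) (c : I -> CC) (r1 r2 r3 : I -> su2 -> R) (F : triple -> C) :
  (forall i, is_poly (r1 i)) -> (forall i, is_poly (r2 i)) -> (forall i, is_poly (r3 i)) ->
  (forall x, is_su2_3 x ->
     toC (F x) = \sum_i c i * (r1 i (t1 x) * r2 i (t2 x) * r3 i (t3 x))%:C) ->
  toC (haar3 F) = \sum_i c i * (haarR (r1 i) * haarR (r2 i) * haarR (r3 i))%:C.
Proof.
move=> p1 p2 p3 FE; rewrite /haar3.
rewrite (@toC_haarN 3 I c (fun i k => if k is k'.+1 then if k' is k''.+1 then r3 i else r2 i else r1 i)).
- by apply: eq_bigr => i _; rewrite !big_ord_recr big_ord0 /= mul1r.
- by move=> i [|[|k]].
case=> [|g1 [|g2 [|g3 []]]] //= _ Hl; rewrite FE; last first.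
  by split; [exact: (Hl 0%N)|split; [exact: (Hl 1%N)|exact: (Hl 2)]].
by apply: eq_bigr => i _; rewrite !big_ord_recr big_ord0 /= mul1r.
Qed.

Lemma sum_delta (A : pzSemiRingType) (T : finType) (G : T -> A) k :
  \sum_k' G k' * (k == k')%:R = G k.
Proof.
rewrite (bigD1 k) //= eqxx mulr1 [X in _ + X]big1 ?addr0 // => k' /negPf kk'.
by rewrite eq_sym kk' mulr0.
Qed.

Lemma prod3_sum (A : pzSemiRingType) (T : finType) (a b c : T -> A) :
  (\sum_i a i) * (\sum_i b i) * (\sum_i c i) = \sum_i \sum_j \sum_k a i * b j * c k.
Proof.
rewrite -mulrA big_distrl /=; apply: eq_bigr => i _; rewrite big_distrl big_distrr /=.
by apply: eq_bigr => j _; rewrite !big_distrr; apply: eq_bigr => k _ /=; rewrite mulrA.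
Qed.

Lemma put_weight (A : comNzRingType) (T : finType) (u : T -> T -> A) k i j y i' j' y' :
  let z := put k (i, j) y in let z' := put k (i', j') y' in
  u z.1.1 z'.1.1 * u z.1.2 z'.1.2 * u z.2 z'.2 = u i i' * u j j' * u y y'.
Proof. by case: k => [|[|k]] /=; ring. Qed.

Section Basis.
Variables (D N : nat) (p : 'I_N -> su2 -> R).
Hypothesis pD : forall i, dpoly D (p i).
Hypothesis pO : forall i j, haarR (fun g => p i g * p j g) = (i == j)%:R.
Hypothesis pspan : forall f, dpoly D f -> forall g, is_su2 g ->
  f g = \sum_i haarR (fun h => f h * p i h) * p i g.
Notation I := 'I_N.
Notation J := (I * I * I)%type.

Lemma pP i : is_poly (p i). Proof. exact: dpoly_poly (pD i). Qed.

Lemma ppP i j : is_poly (fun g => p i g * p j g).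
Proof. by apply: poly_mul; apply: pP. Qed.

Definition SU := {h : su2 | is_su2 h}.
Definition SU1 : SU := exist _ su2_one su2_one_su2.

Definition rho (h : SU) (i j : I) : R := haarR (fun g => p i (su2_mul g (sval h)) * p j g).

Lemma rhoE (h : SU) i g : is_su2 g -> p i (su2_mul g (sval h)) = \sum_j rho h i j * p j g.
Proof. by move=> Hg; apply: (pspan (dpoly_right _ _ _ (svalP h) (pD i))). Qed.

(** Right invariance of the Haar integral, read in the orthonormal basis [p]. *)
Lemma rho_orthogonal h i l : \sum_k rho h i k * rho h l k = (i == l)%:R.
Proof.
rewrite -pO -(haarR_right (sval h) _ (svalP h) (ppP i l)).
rewrite (haarR_ext _ (fun g => \sum_k \sum_k' (rho h i k * rho h l k') * (p k g * p k' g))); last first.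
  move=> g Hg; rewrite !rhoE // big_distrl; apply: eq_bigr => k _ /=.
  by rewrite big_distrr; apply: eq_bigr => k' _ /=; rewrite mulrACA.
rewrite haarR_sum => [|k]; last by apply: poly_sum => k'; apply: poly_scal; apply: ppP.
apply: eq_bigr => k _; rewrite haarR_sum => [|k']; last by apply: poly_scal; apply: ppP.
under eq_bigr => k' _ do rewrite (haarR_mul _ (ppP k k')) pO.
by rewrite (sum_delta (fun k' => rho h i k * rho h l k')).
Qed.

Local Opaque rho.

Definition U (h : SU) (i j : I) : CC := (rho h i j)%:C.
Definition pc (h : SU) (i : I) : CC := (p i (sval h))%:C.

Lemma U_unitary h i l : \sum_k U h i k * Num.conj (U h l k) = (i == l)%:R.
Proof.
under eq_bigr do rewrite conj_real -rmorphM.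
by rewrite -rmorph_sum rho_orthogonal rmorph_nat.
Qed.

Lemma pc_rotate h i : pc h i = \sum_k U h i k * (p k su2_one)%:C.
Proof.
rewrite /pc -{1}[sval h]su2_mul1g rhoE ?rmorph_sum; last exact: su2_one_su2.
by apply: eq_bigr => k _; rewrite rmorphM.
Qed.

Lemma quadratic_expand (S : finType) (X Y : S -> I -> CC) g :
  \sum_s (\sum_j X s j * (p j g)%:C) * Num.conj (\sum_j Y s j * (p j g)%:C) =
  \sum_(q : I * I) (\sum_s X s q.1 * Num.conj (Y s q.2)) * (p q.1 g * p q.2 g)%:C.
Proof.
under [RHS]eq_bigr do rewrite big_distrl /=.
rewrite [RHS]exchange_big /=; apply: eq_bigr => s _.
rewrite big_distrl -(pair_bigA _ (fun j k => X s j * Num.conj (Y s k) * (p j g * p k g)%:C)) /=.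
apply: eq_bigr => j _; rewrite rmorph_sum big_distrr /=; apply: eq_bigr => k _.
by rewrite rmorphM /= conj_real [(p j g * _)%:C]rmorphM mulrACA.
Qed.

(** Parseval's identity for the basis [p]; it supplies both mean hypotheses of the gauge fixing. *)
Lemma quadratic_mean (S : finType) (X Y : S -> I -> CC) :
  mean (fun g => \sum_s (\sum_j X s j * (p j g)%:C) * Num.conj (\sum_j Y s j * (p j g)%:C)) =
  \sum_s \sum_j X s j * Num.conj (Y s j).
Proof.
rewrite (@mean_expand _ _ _ _ _ (fun q => ppP q.1 q.2) (fun g _ => quadratic_expand X Y g)).
under eq_bigr do rewrite pO.
rewrite -(pair_bigA _ (fun j k => (\sum_s X s j * Num.conj (Y s k)) * (j == k)%:R%:C)) /=.
rewrite [RHS]exchange_big /=; apply: eq_bigr => j _.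
rewrite [LHS](bigD1 j) //= eqxx mulr1 [X in _ + X]big1 ?addr0 // => k /negPf kj.
by rewrite eq_sym kj mulr0.
Qed.

Lemma mean_eq_basis (S : finType) (X Y : S -> I -> CC) (c : CC) :
  (forall h, \sum_s (\sum_j X s j * pc h j) * Num.conj (\sum_j Y s j * pc h j) = c) ->
  \sum_s \sum_j X s j * Num.conj (Y s j) = c.
Proof.
move=> e; rewrite -quadratic_mean -[RHS]mean_cst; apply: mean_ext => g Hg.
exact: (e (exist _ g Hg)).
Qed.

Lemma mean_le_basis (S : finType) (X : S -> I -> CC) (c : CC) :
  (forall h, \sum_s `|\sum_j X s j * pc h j| ^+ 2 <= c) ->
  \sum_s \sum_j `|X s j| ^+ 2 <= c.
Proof.
move=> e.
have -> : \sum_s \sum_j `|X s j| ^+ 2 = \sum_s \sum_j X s j * Num.conj (X s j).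
  by apply: eq_bigr => s _; apply: eq_bigr => j _; rewrite normCK.
rewrite -quadratic_mean; apply: mean_le => [|g Hg].
  exact: (@Re_poly _ _ _ _ _ (fun q => ppP q.1 q.2) (fun g _ => quadratic_expand X X g)).
have := e (exist _ g Hg); rewrite /pc /=.
by under eq_bigr do rewrite normCK.
Qed.

Definition pj (z : J) (x : triple) : R := (p z.1.1 (t1 x) * p z.1.2 (t2 x) * p z.2 (t3 x))%R.
Definition fn (u : J -> CC) (x : triple) : CC := \sum_z u z * (pj z x)%:C.

Lemma conj_fn u x : Num.conj (fn u x) = \sum_z Num.conj (u z) * (pj z x)%:C.
Proof. by rewrite rmorph_sum; apply: eq_bigr => z _; rewrite rmorphM /= conj_real. Qed.

(** Products of basis functions are orthonormal in three variables, so scalar products of functions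
    become scalar products of coefficient tensors. *)
Lemma toC_haar3_dot (u v : J -> CC) (F : triple -> C) :
  (forall x, is_su2_3 x -> toC (F x) = Num.conj (fn u x) * fn v x) -> toC (haar3 F) = dot v u.
Proof.
move=> FE.
rewrite (@toC_haar3 (J * J)%type (fun q => Num.conj (u q.1) * v q.2)
  (fun q g => p q.1.1.1 g * p q.2.1.1 g) (fun q g => p q.1.1.2 g * p q.2.1.2 g)
  (fun q g => p q.1.2 g * p q.2.2 g)); try by move=> q; apply: ppP.
  under eq_bigr do rewrite !pO.
  rewrite -(pair_bigA _ (fun z z' => Num.conj (u z) * v z' *
     ((z.1.1 == z'.1.1)%:R * (z.1.2 == z'.1.2)%:R * (z.2 == z'.2)%:R)%:C)) /=.
  apply: eq_bigr => z _; rewrite (bigD1 z) //= !eqxx !mulr1 big1 ?addr0 1?mulrC //.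
  case: z => [[i j] k] [[i' j'] k'] /=; rewrite !xpair_eqE => h.
  rewrite -!natrM !mulnb [i == _]eq_sym [j == _]eq_sym [k == _]eq_sym (negPf h).
  by rewrite mulr0.
move=> x Hx; rewrite FE // conj_fn /fn big_distrl /=.
rewrite -(pair_bigA _ (fun z z' => Num.conj (u z) * v z' *
  (p z.1.1 (t1 x) * p z'.1.1 (t1 x) * (p z.1.2 (t2 x) * p z'.1.2 (t2 x)) *
   (p z.2 (t3 x) * p z'.2 (t3 x)))%:C)) /=.
apply: eq_bigr => z _; rewrite big_distrr /=; apply: eq_bigr => z' _.
rewrite mulrACA -rmorphM /= /pj.
by congr (_ * _%:C); rewrite mulrACA [X in X * _]mulrACA.
Qed.

Lemma fn_inj u v : (forall x, is_su2_3 x -> fn u x = fn v x) -> u =1 v.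
Proof.
move=> e z; pose w (z' : J) : CC := (z' == z)%:R.
have wE u' : dot u' w = u' z.
  rewrite /dot (bigD1 z) //= /w eqxx rmorph1 mulr1 big1 ?addr0 // => z' /negPf ->.
  by rewrite rmorph0 mulr0.
rewrite -wE -[RHS]wE -(@toC_haar3_dot w u (fun x => ofC (Num.conj (fn w x) * fn u x))).
  apply: (@toC_haar3_dot w v) => x Hx; by rewrite ofCK e.
by move=> x _; rewrite ofCK.
Qed.

Definition tmul (x : triple) (h : su2) : triple :=
  (su2_mul (t1 x) h, su2_mul (t2 x) h, su2_mul (t3 x) h).

Lemma tmul_su2 x h : is_su2_3 x -> is_su2 h -> is_su2_3 (tmul x h).
Proof. by move=> [H1 [H2 H3]] Hh; split; [|split]; apply: su2_mul_su2. Qed.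

Lemma pj_rotate (h : SU) z x : is_su2_3 x ->
  (pj z (tmul x (sval h)))%:C =
  \sum_(z' : J) (U h z.1.1 z'.1.1 * U h z.1.2 z'.1.2 * U h z.2 z'.2) * (pj z' x)%:C.
Proof.
move=> [H1 [H2 H3]]; rewrite /pj !rhoE //.
rewrite -(pair_bigA _ (fun (q : I * I) k => (U h z.1.1 q.1 * U h z.1.2 q.2 * U h z.2 k) *
   (p q.1 (t1 x) * p q.2 (t2 x) * p k (t3 x))%:C)) /=.
rewrite -(pair_bigA _ (fun i j => \sum_k (U h z.1.1 i * U h z.1.2 j * U h z.2 k) *
   (p i (t1 x) * p j (t2 x) * p k (t3 x))%:C)) /=.
rewrite prod3_sum rmorph_sum; apply: eq_bigr => i _.
rewrite rmorph_sum; apply: eq_bigr => j _; rewrite rmorph_sum; apply: eq_bigr => k _.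
by rewrite /U -!rmorphM /=; congr (_%:C); rewrite [RHS]mulrACA [X in _ = X * _]mulrACA.
Qed.

(** A translated function has coefficients transformed by [U h] on each leg, and coefficients are
    unique by [fn_inj]. *)
Lemma invariant_coeff u : (forall h x, is_su2 h -> is_su2_3 x -> fn u (tmul x h) = fn u x) ->
  forall (h : SU) z', \sum_(z : J) u z * (U h z.1.1 z'.1.1 * U h z.1.2 z'.1.2 * U h z.2 z'.2) = u z'.
Proof.
move=> inv h z'.
apply: (@fn_inj (fun z' => \sum_(z : J) u z * (U h z.1.1 z'.1.1 * U h z.1.2 z'.1.2 * U h z.2 z'.2)) u).
move=> x Hx; rewrite -(inv (sval h) x (svalP h) Hx) /fn.
under [RHS]eq_bigr do rewrite (pj_rotate h _ Hx) big_distrr /=.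
rewrite exchange_big /=; apply: eq_bigr => w _; rewrite big_distrl /=.
by apply: eq_bigr => z _; rewrite -[LHS]mulrA.
Qed.

Local Opaque U.

Section Invariant.
Variables (d : nat) (E : 'I_d -> J -> CC).
Hypothesis oE : orthonormal E.
Hypothesis EU : forall a (h : SU) z',
  \sum_(z : J) E a z * (U h z.1.1 z'.1.1 * U h z.1.2 z'.1.2 * U h z.2 z'.2) = E a z'.

Lemma sum_put k (G : J -> CC) : \sum_z G z = \sum_i \sum_j \sum_y G (put k (i, j) y).
Proof.
rewrite (reindex (fun q : (I * I) * I => put k q.1 q.2)) /=; last by apply: onW_bij; apply: put_bij.
rewrite -(pair_bigA _ (fun q y => G (put k q y))) /=.
by rewrite -(pair_bigA _ (fun i j => \sum_y G (put k (i, j) y))).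
Qed.

Lemma put_orthonormal k a b : \sum_i \sum_j \sum_y
  E a (put k (i, j) y) * Num.conj (E b (put k (i, j) y)) = (a == b)%:R.
Proof. by rewrite -(sum_put k (fun z => E a z * Num.conj (E b z))) -oE. Qed.

Lemma put_invariant k (h : SU) a i' j' y' : \sum_i \sum_j \sum_y
  E a (put k (i, j) y) * (U h i i' * U h j j' * U h y y') = E a (put k (i', j') y').
Proof.
rewrite -[RHS](EU a h) [RHS](sum_put k); apply: eq_bigr => i _; apply: eq_bigr => j _.
apply: eq_bigr => y _.
exact: (congr1 (fun t => E a (put k (i, j) y) * t) (esym (put_weight (U h) k i j y i' j' y'))).
Qed.

(** [put k] moves the contracted leg to the last place; the gauge fixing is applied to one of the
    two others. *)
Lemma invariant_traceable : traceable #|I|%:R E.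
Proof.
move=> k w.
have := invariant_partial_trace U_unitary pc_rotate mean_eq_basis mean_le_basis
  (put_orthonormal k) (put_invariant k) w.
apply: le_trans; rewrite le_eqVlt; apply/orP; left; apply/eqP.
rewrite exchange_big /=; apply: eq_bigr => a _.
by rewrite -(pair_bigA _ (fun i j => `|\sum_y E a (put k (i, j) y) * w y| ^+ 2)).
Qed.

Lemma invariant_dim : (d <= #|I| * #|I|)%N.
Proof.
exact: (invariant_card SU1 U_unitary pc_rotate mean_eq_basis (put_orthonormal 2) (put_invariant 2)).
Qed.

End Invariant.
End Basis.

Local Opaque haarR haar wigD.

(** * The projection kernel in coordinates *)

Section Kernel.
Variables (D N : nat) (p : 'I_N -> su2 -> R).
Hypothesis pD : forall i, dpoly D (p i).
Hypothesis pO : forall i j, haarR (fun g => p i g * p j g) = (i == j)%:R.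
Hypothesis pspan : forall f, dpoly D f -> forall g, is_su2 g ->
  f g = \sum_i haarR (fun h => f h * p i h) * p i g.
Notation I := 'I_N.
Notation J := (I * I * I)%type.
Variable Lam : R.
Hypothesis LamD : forall k : nat, Rle (INR k) (Rmult 2 Lam) -> (k <= D)%N.

Lemma cdpoly_expand (f : su2 -> C) : cdpoly D f ->
  exists c : I -> CC, forall g, is_su2 g -> toC (f g) = \sum_i c i * (p i g)%:C.
Proof.
move=> [f1 f2].
exists (fun i => haarR (fun h => (f h).1 * p i h) +i* haarR (fun h => (f h).2 * p i h)) => g Hg.
apply: complex_eq.
  by rewrite Re_sum [LHS](pspan f1 Hg); apply: eq_bigr => i _; rewrite Re_scale.
by rewrite Im_sum [LHS](pspan f2 Hg); apply: eq_bigr => i _; rewrite Im_scale.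
Qed.

Lemma wigD_expand (n k l : nat) : Rle (INR n) (Rmult 2 Lam) -> (l <= n)%coq_nat ->
  exists c : I -> CC, forall g, is_su2 g -> toC (wigD n k l g) = \sum_i c i * (p i g)%:C.
Proof.
move=> nL ln; apply: cdpoly_expand; apply: (@cdpoly_le n); last exact: cdpoly_wigD.
by apply/ssrnat.leP; apply: LamD.
Qed.

Lemma dterm_expand t : dterm_ok Lam t ->
  exists u : J -> CC, forall x, is_su2_3 x -> toC (dterm_eval t x) = fn p u x.
Proof.
move=> [n1 [n2 [n3 [_ [l1 [_ [l2 [_ l3]]]]]]]].
have [c1 H1] := wigD_expand (dk1 t) n1 l1.
have [c2 H2] := wigD_expand (dk2 t) n2 l2.
have [c3 H3] := wigD_expand (dk3 t) n3 l3.
exists (fun z => toC (dc t) * (c1 z.1.1 * c2 z.1.2 * c3 z.2)) => x [X1 [X2 X3]].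
rewrite /dterm_eval 3!toC_mult H1 // H2 // H3 // -2!mulrA [X in _ * X]mulrA prod3_sum.
rewrite big_distrr /= /fn.
rewrite -(pair_bigA _ (fun (q : I * I) k => toC (dc t) * (c1 q.1 * c2 q.2 * c3 k) * (pj p (q, k) x)%:C)) /=.
rewrite -(pair_bigA _ (fun i j => \sum_k toC (dc t) * (c1 i * c2 j * c3 k) * (pj p (i, j, k) x)%:C)) /=.
apply: eq_bigr => i _; rewrite big_distrr; apply: eq_bigr => j _ /=.
rewrite big_distrr; apply: eq_bigr => k _ /=.
rewrite -[RHS]mulrA /pj 2!rmorphM /=; congr (_ * _).
by rewrite [RHS]mulrACA [X in _ = X * _]mulrACA.
Qed.

Lemma InH_expand f : InH Lam f -> exists u : J -> CC, forall x, is_su2_3 x -> toC (f x) = fn p u x.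
Proof.
move=> [ts [tok fE]].
suff [u Hu] : exists u : J -> CC, forall x, is_su2_3 x ->
    toC (List.fold_right Cplus (RtoC 0) (List.map (fun t => dterm_eval t x) ts)) = fn p u x.
  by exists u => x Hx; rewrite fE // Hu.
elim: ts tok {fE} => [|t ts IH] tok.
  by exists (fun=> 0) => x _; rewrite /fn big1 // => z _; rewrite mul0r.
have [u Hu] := dterm_expand (List.Forall_inv tok).
have [v Hv] := IH (List.Forall_inv_tail tok).
exists (fun z => u z + v z) => x Hx; rewrite /= toC_plus Hu // Hv // /fn -big_split.
by apply: eq_bigr => z _; rewrite mulrDl.
Qed.

Definition scale_dterm (c : C) (t : dterm) : dterm :=
  {| dc := Cmult c (dc t); dN1 := dN1 t; dN2 := dN2 t; dN3 := dN3 t;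
     dk1 := dk1 t; dk2 := dk2 t; dk3 := dk3 t; dl1 := dl1 t; dl2 := dl2 t; dl3 := dl3 t |}.

Lemma InH_add f f' g : InH Lam f -> InH Lam f' ->
  (forall x, is_su2_3 x -> g x = Cplus (f x) (f' x)) -> InH Lam g.
Proof.
move=> [ts [tok fE]] [ts' [tok' fE']] gE; exists (ts ++ ts')%list; split.
  by apply/List.Forall_app.
move=> x Hx; rewrite gE // fE // fE' // List.map_app List.fold_right_app.
elim: (List.map _ ts) => [|y s IH] /=; first by rewrite Cplus_0_l.
by rewrite -IH Cplus_assoc.
Qed.

Lemma InH_scale c f g : InH Lam f ->
  (forall x, is_su2_3 x -> g x = Cmult c (f x)) -> InH Lam g.
Proof.
move=> [ts [tok fE]] gE; exists (List.map (scale_dterm c) ts); split.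
  by apply/List.Forall_map; apply: List.Forall_impl tok.
move=> x Hx; rewrite gE // fE //; elim: (ts) => [|t s IH] /=; first by rewrite Cmult_0_r.
by rewrite -IH Cmult_plus_distr_l /dterm_eval /= !Cmult_assoc.
Qed.

Definition cyc (x : triple) : triple := (t2 x, t3 x, t1 x).

Lemma cyc_su2 x : is_su2_3 x -> is_su2_3 (cyc x).
Proof. by move=> [? [? ?]]; split; [|split]. Qed.

Lemma pj_poly z x : is_su2_3 x -> is_poly (fun h => pj p z (tmul x h)).
Proof.
move=> [H1 [H2 H3]].
have pp i g : is_su2 g -> is_poly (fun h => p i (su2_mul g h)).
  by move=> Hg; apply: poly_left => //; apply: pP pD i.
by apply: poly_mul; [apply: poly_mul|]; apply: pp.
Qed.

(** Three times the projection [Cphi] of the basis function with index [z]. *)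
Definition orbit_mean (x : triple) (z : J) : CC :=
  (haarR (fun h => pj p z (tmul x h)))%:C + (haarR (fun h => pj p z (tmul (cyc x) h)))%:C +
  (haarR (fun h => pj p z (tmul (cyc (cyc x)) h)))%:C.

Lemma mean_fn u x : is_su2_3 x ->
  mean (fun h => fn p u (tmul x h)) = \sum_z u z * (haarR (fun h => pj p z (tmul x h)))%:C.
Proof.
by move=> Hx; apply: (@mean_expand _ _ _ (fun z h => pj p z (tmul x h))) => // z; apply: pj_poly.
Qed.

Lemma toC_Cphi f u x : (forall y, is_su2_3 y -> toC (f y) = fn p u y) -> is_su2_3 x ->
  toC (Cphi f x) = (Rinv 3)%:C * \sum_z u z * orbit_mean x z.
Proof.
move=> fE Hx.
have -> : toC (Cphi f x) = (Rinv 3)%:C * (mean (fun h => toC (f (tmul x h))) +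
    mean (fun h => toC (f (tmul (cyc x) h))) + mean (fun h => toC (f (tmul (cyc (cyc x)) h)))).
  apply: etrans (toC_mult _ _) _; apply: (congr1 (fun t => (Rinv 3)%:C * t)).
  apply: etrans (toC_plus _ _) _; apply: (congr2 +%R); last exact: toC_haar.
  apply: etrans (toC_plus _ _) _; apply: (congr2 +%R); exact: toC_haar.
have M y : is_su2_3 y -> mean (fun h => toC (f (tmul y h))) =
    \sum_z u z * (haarR (fun h => pj p z (tmul y h)))%:C.
  move=> Hy; rewrite -(mean_fn u Hy); apply: mean_ext => h Hh; apply: fE; exact: tmul_su2.
rewrite (M x Hx) (M (cyc x) (cyc_su2 Hx)) (M _ (cyc_su2 (cyc_su2 Hx))).
rewrite -!big_split /=; congr (_ * _); apply: eq_bigr => z _.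
by rewrite -!mulrDr.
Qed.

(** Associativity moves [k] to the left of the averaging variable, where left invariance absorbs
    it. *)
Lemma orbit_mean_tmul x k z : is_su2_3 x -> is_su2 k -> orbit_mean (tmul x k) z = orbit_mean x z.
Proof.
move=> Hx Hk; rewrite /orbit_mean.
have L y : is_su2_3 y -> haarR (fun h => pj p z (tmul (tmul y k) h)) = haarR (fun h => pj p z (tmul y h)).
  move=> Hy; rewrite -(haarR_left k _ Hk (pj_poly z Hy)); apply: haarR_ext => h Hh.
  by rewrite /tmul /t1 /t2 /t3 /= !su2_mulA.
have e1 := L x Hx; have e2 := L _ (cyc_su2 Hx); have e3 := L _ (cyc_su2 (cyc_su2 Hx)).
exact: (congr2 +%R (congr2 +%R (congr1 (real_complex R) e1) (congr1 (real_complex R) e2))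
  (congr1 (real_complex R) e3)).
Qed.

(** A function fixed by [Cphi] depends on [x] only through [orbit_mean]. *)
Lemma InH0_invariant f u : InH0 Lam f -> (forall x, is_su2_3 x -> toC (f x) = fn p u x) ->
  forall h x, is_su2 h -> is_su2_3 x -> fn p u (tmul x h) = fn p u x.
Proof.
move=> [_ fP] fE h x Hh Hx.
have e y : is_su2_3 y -> fn p u y = (Rinv 3)%:C * \sum_z u z * orbit_mean y z.
  by move=> Hy; rewrite -(toC_Cphi fE Hy) (fP y Hy) (fE y Hy).
rewrite (e _ (tmul_su2 Hx Hh)) (e _ Hx).
apply: (congr1 (fun t => (Rinv 3)%:C * t)); apply: eq_bigr => z _.
exact: (congr1 (fun t => u z * t) (orbit_mean_tmul z Hx Hh)).
Qed.

Definition coeff_space (u : J -> CC) : Prop := InH0 Lam (fun x => ofC (fn p u x)).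

Lemma coeff_spaceP u : coeff_space u <-> InH Lam (fun x => ofC (fn p u x)) /\
  forall x, is_su2_3 x -> (Rinv 3)%:C * \sum_z u z * orbit_mean x z = fn p u x.
Proof.
have e x : is_su2_3 x -> toC (Cphi (fun y => ofC (fn p u y)) x) = (Rinv 3)%:C * \sum_z u z * orbit_mean x z.
  by move=> Hx; apply: toC_Cphi => // y _; rewrite ofCK.
split=> -[H0 H]; split=> // x Hx; first by rewrite -e // H // ofCK.
by apply: (can_inj toCK); rewrite e // H // ofCK.
Qed.

Lemma coeff_space_of f u : InH0 Lam f -> (forall x, is_su2_3 x -> toC (f x) = fn p u x) -> coeff_space u.
Proof.
move=> [[ts [tok fE]] fP] fu; apply/coeff_spaceP; split.
  by exists ts; split=> // x Hx; rewrite -fu // toCK fE.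
by move=> x Hx; rewrite -fu // -[in RHS]fP // (toC_Cphi fu).
Qed.

Lemma fn_add u v x : fn p (fun z => u z + v z) x = fn p u x + fn p v x.
Proof. by rewrite /fn -big_split; apply: eq_bigr => z _; rewrite mulrDl. Qed.

Lemma fn_scale c u x : fn p (fun z => c * u z) x = c * fn p u x.
Proof. by rewrite /fn big_distrr; apply: eq_bigr => z _ /=; rewrite mulrA. Qed.

Lemma coeff_space_add u v : coeff_space u -> coeff_space v -> coeff_space (fun z => u z + v z).
Proof.
move=> /coeff_spaceP [Hu Pu] /coeff_spaceP [Hv Pv]; apply/coeff_spaceP; split.
  apply: InH_add Hu Hv _ => x _; rewrite fn_add; apply: (can_inj toCK).
  by rewrite toC_plus !ofCK.
move=> x Hx; rewrite fn_add -Pu // -Pv // -mulrDr -big_split; congr (_ * _).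
by apply: eq_bigr => z _; rewrite mulrDl.
Qed.

Lemma coeff_space_scale c u : coeff_space u -> coeff_space (fun z => c * u z).
Proof.
move=> /coeff_spaceP [Hu Pu]; apply/coeff_spaceP; split.
  apply: (InH_scale (c := ofC c)) Hu _ => x _; rewrite fn_scale; apply: (can_inj toCK).
  by rewrite toC_mult !ofCK.
move=> x Hx; rewrite fn_scale -Pu // mulrCA; congr (_ * _); rewrite big_distrr.
by apply: eq_bigr => z _ /=; rewrite mulrA.
Qed.

Variable Ck : triple -> triple -> C.
Hypothesis CkP : is_proj_kernel Lam Ck.

(** In an orthonormal basis of the coefficient space, the reproducing property forces the kernel to
    be the sum over [a] of [E a] at [x] times the conjugate of [E a] at [y]; its tensor is
    [proj E]. *)
Lemma kernel_basis : exists (d : nat) (E : 'I_d -> J -> CC),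
  [/\ orthonormal E, traceable #|I|%:R E, (d <= #|I| * #|I|)%N &
  forall x y, is_su2_3 x -> is_su2_3 y -> toC (Ck x y) =
    \sum_z \sum_z' proj E z z' * (pj p z x * pj p z' y)%:C].
Proof.
have [d [E [oE WE span]]] := orthonormal_basis_of coeff_space_add coeff_space_scale.
have [C0 [Csym Crep]] := CkP.
have EU a h z' := invariant_coeff pD pO pspan (InH0_invariant (WE a) (fun x _ => ofCK _)) h z'.
exists d, E; split => //.
- exact: (invariant_traceable pD pO pspan oE EU).
- exact: (invariant_dim pD pO pspan oE EU).
move=> x y Hx Hy.
have [c cE] := InH_expand (C0 x Hx).1.
have Wc := coeff_space_of (C0 x Hx) cE.
(* The reproducing property applied to a basis function; hermitian symmetry turns the kernel into
   the conjugate of the function with coefficients [c]. *)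
have Edot a : fn p (E a) x = dot (E a) c.
  rewrite -[LHS]ofCK -(Crep _ (WE a) x Hx).
  apply: (toC_haar3_dot pD pO) => w Hw; rewrite toC_mult ofCK -cE // -toC_conj; congr (_ * _).
  by congr toC; apply: Csym.
rewrite Csym // toC_conj cE //.
have -> : fn p c y = \sum_a Num.conj (fn p (E a) x) * fn p (E a) y.
  rewrite /fn (eq_bigr (fun z => \sum_a (dot c (E a) * E a z) * (pj p z y)%:C)); last first.
    by move=> z _; rewrite [c z](span _ Wc) big_distrl.
  rewrite exchange_big; apply: eq_bigr => a _; rewrite -/(fn p (E a) x) Edot dotC big_distrr.
  by apply: eq_bigr => z _ /=; rewrite mulrA.
rewrite rmorph_sum /=.
under [RHS]eq_bigr => z _ do under eq_bigr => z' _ do rewrite big_distrl /=.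
under [RHS]eq_bigr => z _ do rewrite exchange_big /=.
rewrite [RHS]exchange_big /=; apply: eq_bigr => a _.
rewrite rmorphM /= conjCK conj_fn /fn big_distrl /=; apply: eq_bigr => z _.
rewrite big_distrr /=; apply: eq_bigr => z' _.
rewrite [LHS]mulrACA.
exact: (congr1 (fun t => E a z * Num.conj (E a z') * t) (esym (rmorphM (real_complex R) _ _))).
Qed.

End Kernel.

(** * The amplitude as a contraction *)

Lemma prod_blocks (A : comNzRingType) (m n : nat) (G : nat -> A) :
  \prod_(k < m * n) G k = \prod_(v < n) \prod_(g < m) G (m * v + g)%N.
Proof.
elim: n => [|n IH]; first by rewrite muln0 !big_ord0.
rewrite mulnS addnC big_split_ord big_ord_recr /=; congr (_ * _).
exact: IH.
Qed.

Lemma toC_fold_mult (T : Type) (f : T -> C) (l : list T) :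
  toC (List.fold_right Cmult (RtoC 1) (List.map f l)) = \prod_(t <- l) toC (f t).
Proof.
by elim: l => [|t l IH] /=; rewrite ?big_nil // big_cons toC_mult IH.
Qed.

Lemma List_seqE a n : List.seq a n = iota a n.
Proof. by elim: n a => //= n IH a; rewrite IH. Qed.

Lemma List_nthE (T : Type) (x : T) k l : List.nth k l x = nth x l k.
Proof. by elim: l k => [|y l IH] [|k] //=. Qed.

Lemma prod_slots (A : comNzRingType) (G : nat * nat -> A) n :
  \prod_(s <- slots n) G s = \prod_(v < n) \prod_(a < 4) G (nat_of_ord v, nat_of_ord a).
Proof.
transitivity (\prod_(v <- iota 0 n) \prod_(a <- iota 0 4) G (v, a)).
  rewrite /slots !List_seqE; elim: (iota 0 n) (iota 0 4) => [|v s IH] t; first by rewrite !big_nil.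
  rewrite big_cons -IH [List.flat_map _ _]/= big_cat /=; congr (_ * _).
  by elim: t {IH} => [|a t IH] /=; rewrite ?big_nil // !big_cons IH.
rewrite -[X in iota 0 X]subn0 -/(index_iota 0 n) big_mkord; apply: eq_bigr => v _.
by rewrite -[X in iota 0 X](subn0 4) -/(index_iota 0 4) big_mkord.
Qed.

Section PairedSum.
Variables (A : comNzRingType) (S J : finType) (mate : S -> S) (o : rel S) (z0 : J).
Hypothesis mateK : involutive mate.
Hypothesis oN : forall s, o (mate s) s = ~~ o s (mate s).

Lemma prod_pairs (G : S -> A) : \prod_s G s = \prod_(s | o s (mate s)) (G s * G (mate s)).
Proof.
rewrite (bigID (fun s => o s (mate s))) big_split /=; congr (_ * _).
rewrite (reindex mate) /=; last by apply: onW_bij; exists mate.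
by apply: eq_bigl => s; rewrite mateK oN negbK.
Qed.

(** Distributivity: choosing two indices for every line amounts to choosing one for every slot. The
    default [z0] fills the components at slots that do not represent their line. *)
Lemma sum_pairs (H : S -> J -> J -> A) :
  \sum_(mu : {ffun S -> J}) \prod_(s | o s (mate s)) H s (mu s) (mu (mate s)) =
  \prod_(s | o s (mate s)) \sum_z \sum_z' H s z z'.
Proof.
rewrite [RHS](eq_bigr (fun s => \sum_(q : J * J) H s q.1 q.2)); last first.
  by move=> s _; rewrite pair_bigA.
rewrite (big_distr_big (z0, z0)) /=.
pose to (mu : {ffun S -> J}) : {ffun S -> J * J} :=
  [ffun s => if o s (mate s) then (mu s, mu (mate s)) else (z0, z0)].
pose of_ (f : {ffun S -> J * J}) : {ffun S -> J} :=
  [ffun s => if o s (mate s) then (f s).1 else (f (mate s)).2].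
rewrite (reindex_onto to of_) /=; last first.
  move=> f /pffun_onP [/supportP fs _]; apply/ffunP => s; rewrite !ffunE mateK oN.
  case: (boolP (o s (mate s))) => os /=; first by rewrite -surjective_pairing.
  by rewrite fs // unfold_in.
apply: eq_big => [mu|mu _].
  symmetry; apply/andP; split.
    apply/pffun_onP; split=> //; apply/supportP => s.
    by rewrite unfold_in ffunE => /negPf ->.
  apply/eqP/ffunP => s; rewrite !ffunE mateK oN.
  by case: (boolP (o s (mate s))).
by apply: eq_bigr => s os; rewrite ffunE os.
Qed.
End PairedSum.

(** Regroups the twelve legs of a vertex by variable, two places for each of the six; checks
    [places] against [slot_vars]. *)
Lemma vertex_places (A : comNzRingType) (b : bool) (h : nat -> nat -> nat -> A) :
  \prod_(a < 4) (let: (i, j, k) := slot_vars b a in h a 0%N i * h a 1%N j * h a 2%N k) =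
  \prod_(g < 6) (h (places b g).1.1 (places b g).1.2 g * h (places b g).2.1 (places b g).2.2 g).
Proof.
rewrite -(big_mkord xpredT (fun a => let: (i, j, k) := slot_vars b a in h a 0%N i * h a 1%N j * h a 2%N k)).
rewrite -(big_mkord xpredT (fun g => h (places b g).1.1 (places b g).1.2 g * h (places b g).2.1 (places b g).2.2 g)).
by rewrite /index_iota /= !big_cons !big_nil; case: b => /=; ring.
Qed.

Section Amplitude.
Variables (n : nat) (tetra : nat -> bool) (mate : nat * nat -> nat * nat).
Hypothesis wf : bfl_wf n mate.
Hypothesis conn : bfl_connected n mate.
Hypothesis n0 : (0 < n)%N.
Notation S := ('I_n * 'I_4)%type.

Definition code (s : S) : nat * nat := (nat_of_ord s.1, nat_of_ord s.2).

Lemma code_inj : injective code.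
Proof. by move=> [v a] [w b] [] /val_inj -> /val_inj ->. Qed.

Lemma wf_code (s : S) : [/\ ((mate (code s)).1 < n)%N, ((mate (code s)).2 < 4)%N,
  mate (mate (code s)) = code s & mate (code s) <> code s].
Proof.
have [H1 [H2 [H3 H4]]] := wf (elimT ssrnat.ltP (ltn_ord s.1)) (elimT ssrnat.ltP (ltn_ord s.2)).
by split => //; apply/ssrnat.ltP.
Qed.

Definition omate (s : S) : S :=
  let: And4 h1 h2 _ _ := wf_code s in (Ordinal h1, Ordinal h2).

Lemma code_omate s : code (omate s) = mate (code s).
Proof. by rewrite /omate; case: (wf_code s) => h1 h2 _ _; rewrite /code /= -surjective_pairing. Qed.

Lemma omateK : involutive omate.
Proof. by move=> s; apply: code_inj; rewrite !code_omate; case: (wf_code s). Qed.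

Lemma omateF s : omate s != s.
Proof.
apply/eqP => /(congr1 code); rewrite code_omate.
by case: (wf_code s).
Qed.

(** Connectedness as an induction principle, by transport along a chain of adjacent vertices. *)
Lemma omate_connected (P : pred 'I_n) : (exists v, P v) ->
  (forall v a, P v -> P (omate (v, a)).1) -> forall v, P v.
Proof.
move=> [v Pv] Pcl w.
have := conn (elimT ssrnat.ltP (ltn_ord v)) (elimT ssrnat.ltP (ltn_ord w)).
suff H x y : clos_refl_trans nat (bfl_adj n mate) x y ->
    forall v : 'I_n, nat_of_ord v = x -> P v -> exists2 w : 'I_n, nat_of_ord w = y & P w.
  by move=> /H /(_ v erefl Pv) [w' /val_inj <-].
elim=> {x y} [x y [xn [a [a4 ay]]]|x|x y z _ IH1 _ IH2] v' e Pv'.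
- exists (omate (v', Ordinal (introT ssrnat.ltP a4))).1; last exact: Pcl.
  have := code_omate (v', Ordinal (introT ssrnat.ltP a4)); rewrite {2}/code /= e => h.
  by rewrite -ay -h.
- by exists v'.
by have [w' e' Pw'] := IH1 _ e Pv'; exact: IH2 e' Pw'.
Qed.

Definition before (s s' : S) : bool := slot_ltb (code s) (code s').

Lemma before_omate s : before (omate s) s = ~~ before s (omate s).
Proof.
have : code (omate s) <> code s by move=> /code_inj /eqP; rewrite (negPf (omateF s)).
rewrite /before; case: (code _) => [a b]; case: (code _) => [a' b'].
rewrite /slot_ltb /= => ne.
case: (PeanoNat.Nat.ltb_spec a a'); case: (PeanoNat.Nat.ltb_spec a' a);
case: (PeanoNat.Nat.eqb_spec a a'); case: (PeanoNat.Nat.eqb_spec a' a);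
case: (PeanoNat.Nat.ltb_spec b b'); case: (PeanoNat.Nat.ltb_spec b' b) => //=; try lia.
move=> h1 h2 e _ _ _; case: ne; rewrite e; congr (_, _); lia.
Qed.

Variables (N : nat) (p : 'I_N -> su2 -> R).
Hypothesis pP : forall i, is_poly (p i).
Hypothesis pO : forall i j, haarR (fun g => p i g * p j g) = (i == j)%:R.
Notation I := 'I_N.
Notation J := (I * I * I)%type.
Variables (i0 : I) (d : nat) (E : 'I_d -> J -> CC) (Ck : triple -> triple -> C).
Hypothesis CkE : forall x y, is_su2_3 x -> is_su2_3 y -> toC (Ck x y) =
  \sum_z \sum_z' proj E z z' * (pj p z x * pj p z' y)%:C.

Definition at_slot (l : list su2) (s : S) : triple := Xslot tetra l (code s).

Lemma at_slotE l s : at_slot l s = let: (i, j, k) := slot_vars (tetra s.1) s.2 in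
  (nth su2_one l (6 * s.1 + i), nth su2_one l (6 * s.1 + j), nth su2_one l (6 * s.1 + k)).
Proof.
rewrite /at_slot /Xslot /=; case: (slot_vars _ _) => [[i j] k].
by rewrite !List_nthE.
Qed.

Lemma at_slot_su2 l s : (forall k, is_su2 (nth su2_one l k)) -> is_su2_3 (at_slot l s).
Proof.
move=> Hl; rewrite at_slotE; case: (slot_vars _ _) => [[i j] k].
by split; [|split]; apply: Hl.
Qed.

Lemma integrand_expand l : (forall k, is_su2 (nth su2_one l k)) ->
  toC (bfl_integrand n tetra mate Ck l) = \sum_(mu : {ffun S -> J})
    (\prod_(s | before s (omate s)) proj E (mu s) (mu (omate s))) *
    (\prod_s pj p (mu s) (at_slot l s))%:C.
Proof.
move=> Hl; rewrite /bfl_integrand toC_fold_mult prod_slots.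
transitivity (\prod_(s | before s (omate s)) toC (Ck (at_slot l s) (at_slot l (omate s)))).
  rewrite [RHS]big_mkcond /= pair_bigA /=; apply: eq_bigr => -[v a] _ /=.
  rewrite /before /at_slot code_omate /code /=.
  by case: (slot_ltb _ _).
pose H s z z' := proj E z z' * (pj p z (at_slot l s) * pj p z' (at_slot l (omate s)))%:C.
rewrite (eq_bigr (fun s => \sum_z \sum_z' H s z z')); last first.
  by move=> s _; rewrite CkE //; apply: at_slot_su2.
rewrite -(sum_pairs (i0, i0, i0) omateK before_omate).
apply: eq_bigr => mu _.
rewrite (prod_pairs omateK before_omate) rmorph_prod -big_split /=.
by apply: eq_bigr => s _; rewrite /H.
Qed.

(** The variables are numbered in blocks of six; the default vertex is taken only beyond [6 * n]. *)
Definition vertex_of (k : nat) : 'I_n := insubd (Ordinal n0) (k %/ 6)%N.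

Definition variable_factor (mu : {ffun S -> J}) (k : nat) (g : su2) : R :=
  (p (slot_at mu (vertex_of k) (places (tetra (vertex_of k)) (k %% 6)).1) g *
   p (slot_at mu (vertex_of k) (places (tetra (vertex_of k)) (k %% 6)).2) g)%R.

Lemma vertex_of_block (v : 'I_n) (g : 'I_6) : vertex_of (6 * v + g) = v.
Proof.
by apply: val_inj; rewrite /vertex_of /= val_insubd mulnC divnMDl // divn_small // addn0 ltn_ord.
Qed.

Lemma variable_factor_block mu (v : 'I_n) (g : 'I_6) x : variable_factor mu (6 * v + g) x =
  (p (slot_at mu v (places (tetra v) g).1) x * p (slot_at mu v (places (tetra v) g).2) x)%R.
Proof. by rewrite /variable_factor vertex_of_block mulnC modnMDl modn_small. Qed.

Lemma prod_variables (mu : {ffun S -> J}) l : \prod_s pj p (mu s) (at_slot l s) =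
  \prod_(k < 6 * n) variable_factor mu k (nth su2_one l k).
Proof.
rewrite (prod_blocks 6 n (fun k => variable_factor mu k (nth su2_one l k))).
rewrite [LHS](eq_bigr (fun s => pj p (mu (s.1, s.2)) (at_slot l (s.1, s.2)))); last by case.
rewrite -(pair_bigA _ (fun v a => pj p (mu (v, a)) (at_slot l (v, a)))) /=; apply: eq_bigr => v _.
pose h a k i : R := p (slot_at mu v (a, k)) (nth su2_one l (6 * v + i)).
transitivity (\prod_(g < 6) (h (places (tetra v) g).1.1 (places (tetra v) g).1.2 g *
    h (places (tetra v) g).2.1 (places (tetra v) g).2.2 g)); last first.
  apply: eq_bigr => g _; rewrite variable_factor_block /h.
  by case: (places _ _) => [[? ?] [? ?]].
rewrite -vertex_places; apply: eq_bigr => a _; rewrite at_slotE /=.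
case: (slot_vars _ _) => [[i j] k].
by rewrite /h /slot_at /= inord_val.
Qed.

(** Each variable occurs in exactly two basis functions, and their orthonormality turns its integral
    into the identification of two indices. *)
Lemma toC_amplitude : toC (bfl_amplitude n tetra mate Ck) =
  contraction (fun v : 'I_n => tetra v) omate before E.
Proof.
rewrite /bfl_amplitude.
rewrite (@toC_haarN (6 * n) _ (fun mu : {ffun S -> J} =>
  \prod_(s | before s (omate s)) proj E (mu s) (mu (omate s))) variable_factor).
- apply: eq_bigr => mu _.
  rewrite (prod_blocks 6 n (fun k => haarR (variable_factor mu k))) rmorph_prod; congr (_ * _).
  apply: eq_bigr => v _; rewrite rmorph_prod; apply: eq_bigr => g _ /=.
  have -> : variable_factor mu (6 * v + g) = fun x =>
    (p (slot_at mu v (places (tetra v) g).1) x * p (slot_at mu v (places (tetra v) g).2) x)%R.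
    by apply: funext => x; apply: variable_factor_block.
  by rewrite pO rmorph_nat.
- by move=> mu k; apply: poly_mul; apply: pP.
move=> l _ Hl; rewrite integrand_expand //; apply: eq_bigr => mu _.
by rewrite prod_variables.
Qed.

End Amplitude.

Lemma natural_cutoff (x : R) : 0 <= x -> exists D : nat, D%:R <= x /\ forall k : nat, Rle (INR k) x -> (k <= D)%N.
Proof.
move=> x0; exists (Num.truncn x); have [le lt] := andP (truncn_itv x0).
by split=> // k; rewrite INRE => /RleP kx; rewrite -ltnS -(ltr_nat R); apply: le_lt_trans lt.
Qed.

Lemma amplitude_bound (Lam : R) : Rle (IZR 1) Lam ->
  forall (Ck : triple -> triple -> C), is_proj_kernel Lam Ck ->
  forall (n : nat) (tetra : nat -> bool) (mate : nat * nat -> nat * nat),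
    bfl_wf n mate -> bfl_connected n mate ->
    Rle (Cmod (bfl_amplitude n tetra mate Ck)) (Rmult (pow (pow (IZR 54) 3) n) (pow Lam (6 + 3 * n))).
Proof.
move=> /RleP; rewrite R1E => L1 Ck CkP n tetra mate wf conn.
apply/RleP; rewrite RmultE !RpowE (_ : IZR 54 = 54); last by rewrite IZRposE INRE.
have L0 : 0 <= Lam by apply: le_trans L1.
case: (posnP n) => [n0|n0].
  (* The empty graph has amplitude 1, which is at most [Lam ^ 6]. *)
  subst n; rewrite expr0 mul1r /bfl_amplitude /bfl_integrand /= Cmod_1.
  exact: exprn_ege1.
have [D [DL LD]] : exists D : nat, D%:R <= 2 * Lam /\ forall k : nat, Rle (INR k) (2 * Lam) -> (k <= D)%N.
  by apply: natural_cutoff; rewrite mulr_ge0.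
have [N [p [cN pD pO pspan]]] := degree_basis D.
(* The constant 1 is spanned by the basis, which is therefore not empty and provides the index to
   which labels are pinned. *)
have N1 : (0 < N)%N.
  case: N p {cN} pD pO pspan => // p pD pO pspan.
  have := pspan (fun=> 1) (dpoly_le 0 D _ (PeanoNat.Nat.le_0_l D) (dpoly_const 1)) su2_one su2_one_su2.
  by rewrite big_ord0 => /eqP; rewrite oner_eq0.
have [d [E [oE tE dI CkE]]] := kernel_basis pD pO pspan LD CkP.
have pP i := pP pD i.
have b := contraction_bound (fun v : 'I_n => tetra v) (omateK wf) (omateF wf) (omate_connected (wf:=wf) conn)
  (before_omate wf n0) (Ordinal N1) oE tE dI n0.
rewrite -(toC_amplitude tetra wf n0 pP pO (Ordinal N1) CkE) card_ord toC_norm -natrX in b.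
have {b} : Cmod (bfl_amplitude n tetra mate Ck) <= N%:R ^+ (n + 2).
  by rewrite -natrX -lecR; apply: le_trans b _; rewrite rmorph_nat.
move=> /le_trans; apply.
have NL : N%:R <= 54 * Lam ^+ 3.
  (* [D + 1 <= 2 * Lam + 1 <= 3 * Lam] since [Lam >= 1]; this makes [54 = 2 * 3 ^ 3]. *)
  have D3 : D.+1%:R <= 3 * Lam by rewrite -addn1 natrD; lra.
  apply: (@le_trans _ _ (2 * D.+1%:R ^+ 3)); first by rewrite -natrX -natrM ler_nat.
  have -> : 54 * Lam ^+ 3 = 2 * (3 * Lam) ^+ 3 by ring.
  by apply: ler_wpM2l => //; apply: lerXn2r; rewrite ?nnegrE ?mulr_ge0.
apply: (@le_trans _ _ ((54 * Lam ^+ 3) ^+ (n + 2))).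
  by apply: lerXn2r; rewrite ?nnegrE ?mulr_ge0 ?exprn_ge0.
rewrite exprMn -!exprM (_ : 3 * (n + 2) = 6 + 3 * n)%N; last by lia.
apply: ler_wpM2r; first exact: exprn_ge0.
(* [n + 2 <= 3 * n] because [n] is positive here. *)
by apply: ler_weXn2l; [rewrite ler1n | lia].
Qed.

End AmplitudeBound.

Theorem theorem2 :
  exists K : R, 0 < K /\
  forall (Lam : R), 1 <= Lam ->
  forall (Ck : triple -> triple -> C), is_proj_kernel Lam Ck ->
  forall (n : nat) (tetra : nat -> bool) (mate : nat * nat -> nat * nat),
    bfl_wf n mate -> bfl_connected n mate ->
    Cmod (bfl_amplitude n tetra mate Ck) <= K ^ n * Lam ^ (6 + 3 * n).
Proof.
exists (54 ^ 3); split; [apply pow_lt; lra|].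
exact AmplitudeBound.amplitude_bound.
Qed.
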